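(* Let $0<\alpha<1/4$ and let $f^*,g^*$ be the Mellin transforms of $f,g$, respectively, satisfying the conditions $sf^*(s),\ sg^*(s)\in L_2(\sigma_\alpha)$. Let $f*g$ be the convolution $$(f*g)(x)=\frac1{(2\pi i)^2}\int_{\sigma_\alpha}\int_{\sigma_\alpha}\frac{\cot(\pi s)\cot(\pi w)}{\cot(\pi(s+w))}f^*(s)g^*(w)x^{-s-w}\,ds\,dw,\qquad x>0.$$ Then the Mellin transform $(\mathcal{M}(f*g))(s)$ of $f*g$ belongs to $L_2(\sigma_{2\alpha})$ and is equal to $$(\mathcal{M}(f*g))(s)=\frac1{2\pi i\,\cot(\pi s)}\int_{\sigma_\alpha}\cot(\pi(s-w))\cot(\pi w)f^*(s-w)g^*(w)\,dw,\qquad s\in\sigma_{2\alpha}.$$ Moreover, the factorization equality $$(H_+(f*g))(x)=(H_+f)(x)\,(H_+g)(x),\qquad x>0,$$ holds. Besides, if $sf^*(s),\ sg^*(s)\in L_2(\sigma_\alpha)\cap L_1(\sigma_\alpha)$, then for all $x>0$ $$(f*g)(x)=(H_+g)(x)f(x)-\frac1\pi\int_0^\infty f(t)\,\frac{\sqrt x\,g(t)-\sqrt t\,g(x)}{t-x}\,\frac{dt}{\sqrt t}.$$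
   Context: $\mathbb{R}_+=(0,\infty)$; $\sigma_c=\{s\in\mathbb{C}:s=c+i\tau,\ \tau\in\mathbb{R}\}$, with $L_p(\sigma_c)$ taken with respect to $|ds|=d\tau$. For $0<c<1/2$, $L_2(\mathbb{R}_+;x^{2c-1}dx)$ is the space of complex-valued $f$ with $\int_0^\infty|f(x)|^2x^{2c-1}dx<\infty$. The Mellin transform of $f\in L_2(\mathbb{R}_+;x^{2c-1}dx)$ is $(\mathcal{M}f)(s)=f^*(s)=\int_0^\infty f(t)t^{s-1}dt$, $s\in\sigma_c$, convergent in mean square in $L_2(\sigma_c)$, with inverse $f(x)=\frac1{2\pi i}\int_{\sigma_c}f^*(s)x^{-s}ds$ (convergent in mean square in $L_2(\mathbb{R}_+;x^{2c-1}dx)$). Here $f,g\in L_2(\mathbb{R}_+;x^{2\alpha-1}dx)$ are complex-valued functions on $\mathbb{R}_+$ with Mellin transforms on $\sigma_\alpha$; when $f^*\in L_1(\sigma_\alpha)$, $f$ is identified with its continuous representative given by the absolutely convergent inversion integral (likewise for $g$). Under the stated hypotheses $f*g\in L_2(\mathbb{R}_+;x^{4\alpha-1}dx)$, and its Mellin transform is taken on $\sigma_{2\alpha}$. The half-Hilbert transform is $(H_+f)(x)=\frac1\pi PV\int_0^\infty\frac{f(t)}{t-x}dt$, $x>0$, extended as a bounded operator to $L_2(\mathbb{R}_+;x^{2c-1}dx)$, $0<c<1/2$, where it is given by $(H_+f)(x)=-\frac1\pi\frac{d}{dx}\int_0^\infty\log|1-x/t|\,f(t)\,dt$. *)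

(* Defs.v *)
From HB Require Import structures.
From mathcomp Require Import all_boot all_order all_algebra.
From mathcomp Require Import all_classical all_reals all_analysis.
From mathcomp Require Import complex.

Set Implicit Arguments.
Unset Strict Implicit.
Unset Printing Implicit Defensive.

Import Order.TTheory GRing.Theory Num.Theory.
Import numFieldNormedType.Exports.

Local Notation normc := Normc.normc.

Local Open Scope classical_set_scope.
Local Open Scope complex_scope.
Local Open Scope ring_scope.

(* MathComp-Analysis has no complex exponential or trigonometric functions. *)
Section ComplexElementaryFunctions.
Context {R : realType}.
Implicit Types z s : R[i].

Definition cexp z : R[i] :=
  (expR (complex.Re z))%:C * (cos (complex.Im z) +i* sin (complex.Im z)).

(* x ^ s, meaningful for x > 0. *)
Definition cpow (x : R) s : R[i] := cexp (s * (ln x)%:C).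

Definition ccos z : R[i] := (cexp ('i%C * z) + cexp (- ('i%C * z))) / 2.
Definition csin z : R[i] := (cexp ('i%C * z) - cexp (- ('i%C * z))) / (2 * 'i%C).
Definition ccot z : R[i] := ccos z / csin z.

End ComplexElementaryFunctions.

(* The library integrates only real and extended-real functions, so complex
   functions are integrated componentwise. *)
Section ComplexIntegral.
Context {R : realType} {d : measure_display} {T : measurableType d}.
Implicit Types (mu : {measure set T -> \bar R}) (D : set T) (f : T -> R[i]).

Definition cmeasurable D f : Prop :=
  measurable_fun D (fun x => complex.Re (f x)) /\
  measurable_fun D (fun x => complex.Im (f x)).

Definition cintegrable mu D f : Prop :=
  mu.-integrable D (fun x => (complex.Re (f x))%:E) /\
  mu.-integrable D (fun x => (complex.Im (f x))%:E).

Definition cintegral mu D f : R[i] :=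
  Rintegral mu D (fun x => complex.Re (f x)) +i*
  Rintegral mu D (fun x => complex.Im (f x)).

End ComplexIntegral.

Section Mellin.
Context {R : realType}.
Implicit Types (f : R -> R[i]) (F G : R[i] -> R[i]) (c x : R) (s : R[i]).

Local Notation mu := (@lebesgue_measure R).
Definition Rplus : set R := `]0, +oo[.

Definition memL2_Rplus c f : Prop :=
  cmeasurable Rplus f /\
  (\int[mu]_(x in Rplus) (normc (f x) ^+ 2 * x `^ (2 * c - 1))%:E < +oo)%E.

(* Functions on the vertical line sigma_c are functions on R[i] of which only
   the values at the points c + i t are used. *)
Definition memL1_line c F : Prop :=
  cintegrable mu setT (fun t : R => F (c +i* t)).

Definition memL2_line c F : Prop :=
  cmeasurable (setT : set R) (fun t : R => F (c +i* t)) /\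
  (\int[mu]_t (normc (F (c +i* t)) ^+ 2)%:E < +oo)%E.

(* ds = i dt along s = c + i t. *)
Definition line_integral c F : R[i] :=
  'i%C * cintegral mu setT (fun t : R => F (c +i* t)).

Definition mellin_trunc f (a b : R) s : R[i] :=
  cintegral mu `[a, b] (fun t => f t * cpow t (s - 1)).

(* F represents, on sigma_c, the class in L_2(sigma_c) of the Mellin transform
   of f: the mean-square limit of the integrals over [a, b] as a -> 0+ and
   b -> +oo independently. *)
Definition is_mellin c f F : Prop :=
  [/\ memL2_Rplus c f, memL2_line c F &
      (\int[mu]_t
         (normc (F (c +i* t) - mellin_trunc f p.1 p.2 (c +i* t)) ^+ 2)%:E)%E
      @[p --> filter_prod (0 : R)^'+ (pinfty_nbhs R)] --> 0%E].

Definition mellin_inv c F x : R[i] :=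
  (2 * pi%:C * 'i%C)^-1 * line_integral c (fun s => F s * cpow x (- s)).

Definition conv_kernel F G x s w : R[i] :=
  ccot (pi%:C * s) * ccot (pi%:C * w) / ccot (pi%:C * (s + w)) *
  F s * G w * cpow x (- s - w).

Definition mellin_conv c F G x : R[i] :=
  ((2 * pi%:C * 'i%C) ^+ 2)^-1 *
  line_integral c (fun w => line_integral c (fun s => conv_kernel F G x s w)).

Definition mellin_conv_cvg c F G x : Prop :=
  cintegrable (mu \x mu)%E setT
    (fun p : R * R => conv_kernel F G x (c +i* p.1) (c +i* p.2)).

Definition spectral_kernel F G s w : R[i] :=
  ccot (pi%:C * (s - w)) * ccot (pi%:C * w) * F (s - w) * G w.

Definition spectral_conv c F G s : R[i] :=
  (2 * pi%:C * 'i%C * ccot (pi%:C * s))^-1 *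
  line_integral c (spectral_kernel F G s).

End Mellin.

Section HalfHilbert.
Context {R : realType}.
Implicit Types (f : R -> R[i]) (x y : R).

Local Notation mu := (@lebesgue_measure R).

Definition log_kernel f y (t : R) : R[i] := (ln `|1 - y / t|)%:C * f t.

Definition log_potential f y : R[i] := cintegral mu Rplus (log_kernel f y).

(* The half-Hilbert transform on the weighted L_2 spaces:
   - (1/pi) d/dx int_0^oo log |1 - x/t| f(t) dt. *)
Definition half_hilbert f x : R[i] :=
  - (pi^-1)%:C *
  (derive1 (fun y => complex.Re (log_potential f y)) x +i*
   derive1 (fun y => complex.Im (log_potential f y)) x).

Definition pv_kernel f x (t : R) : R[i] := f t / (t - x)%:C.

Definition pv_domain x (e : R) : set R :=
  [set t | 0 < t /\ e < `|t - x|].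

(* All the expressions defining H_+ f at x > 0 make sense, and the principal
   value (1/pi) PV int_0^oo f(t) / (t - x) dt agrees with half_hilbert f x. *)
Definition half_hilbert_cvg f x : Prop :=
  [/\ forall y, 0 < y -> cintegrable mu Rplus (log_kernel f y),
      derivable (fun y => complex.Re (log_potential f y)) x 1,
      derivable (fun y => complex.Im (log_potential f y)) x 1,
      forall e, 0 < e -> cintegrable mu (pv_domain x e) (pv_kernel f x) &
      normc ((pi^-1)%:C * cintegral mu (pv_domain x e) (pv_kernel f x)
             - half_hilbert f x)
      @[e --> (0 : R)^'+] --> (0 : R)].

Definition commutator_kernel (f g : R -> R[i]) x (t : R) : R[i] :=
  f t * (((Num.sqrt x)%:C * g t - (Num.sqrt t)%:C * g x) / (t - x)%:C)
  / (Num.sqrt t)%:C.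

End HalfHilbert.

(* Main.v *)
(* Consider functions x |-> int A(t) x^(-s) dt, s = c + i t, with density A.
   On a single power, H_+ x^(-s) = cot(pi s) x^(-s) for 0 < Re s < 1: both the
   logarithmic kernel and the regularized kernel
   (t^(-s) - x^(-s) rho(t)) / (t - x), where rho(t) = min(1, x/t) has vanishing
   principal value, integrate to partial fraction expansions of the cotangent.
   If A is integrable against (1 + |t|)^(1/4), which follows from s F(s) in L_2,
   Fubini applies and H_+ multiplies the density by cot(pi s).  A product of two
   such functions has the convolution of the densities as its density, which
   yields the factorization, the factor 1 / cot(pi (s + w)) depending only on
   the sum.

   The Mellin transform of f * g is identified by Plancherel's formula, proved
   by Abel summation (the weight min(x^e, x^(-e)) produces a Poisson kernel); it
   needs a continuous bounded density.

   The last formula follows by applying H_+ to f g / sqrt x and to f, since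
   cot s cot w tan (s + w) = cot s + cot w + tan (s + w). *)

Require Import Defs.
From HB Require Import structures.
From mathcomp Require Import all_boot all_order all_algebra.
From mathcomp Require Import all_classical all_reals all_analysis.
From mathcomp Require Import complex measurable_realfun.
From mathcomp Require Import ring lra.

Set Implicit Arguments.
Unset Strict Implicit.
Unset Printing Implicit Defensive.

Import Order.TTheory GRing.Theory Num.Theory.
Import numFieldNormedType.Exports.

Local Open Scope classical_set_scope.
Local Open Scope complex_scope.
Local Open Scope ring_scope.

Local Notation normc := Normc.normc.
Local Notation Re := complex.Re.
Local Notation Im := complex.Im.

(** * Complex elementary functions *)

(** The exponent 1/4 of the weight balances two demands. Near x the Hilbert kernel costs a positive
    power of 1 + |t|, traded for the same power of the distance to x, which makes the singularity
    integrable; on the line, s F(s) in L_2 leaves room for any power below 1/2. The condition alpha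
    < 1/4 keeps the line of real part 2 alpha left of 1/2, a zero of cot (pi s), so that 1 / cot is
    bounded there. The obstacle is Plancherel's formula for f * g. Its sharp inequality holds for
    any integrable, square integrable density, because the autocorrelation is largest at 0. Equality
    recovers the value at 0 as a limit, hence the demand for continuity. The convolution is
    continuous by approximation, and the approximants come from the hypothesis itself: truncated
    Mellin transforms are continuous and converge to F in mean square. The transform of f * g is
    never computed from its definition: f * g is an inversion integral, and the truncation error is
    bounded by the defect in Plancherel's formula. *)

Section ComplexNumbers.
Context {R : realType}.
Implicit Types (z w s : R[i]) (x y : R).

Lemma complex_eqP z w : Re z = Re w -> Im z = Im w -> z = w.
Proof. by case: z w => [a b] [c d] /= -> ->. Qed.

Lemma ReD z w : Re (z + w) = Re z + Re w. Proof. by case: z; case: w. Qed.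
Lemma ImD z w : Im (z + w) = Im z + Im w. Proof. by case: z; case: w. Qed.
Lemma ReN z : Re (- z) = - Re z. Proof. by case: z. Qed.
Lemma ImN z : Im (- z) = - Im z. Proof. by case: z. Qed.
Lemma ReB z w : Re (z - w) = Re z - Re w. Proof. by rewrite ReD ReN. Qed.
Lemma ImB z w : Im (z - w) = Im z - Im w. Proof. by rewrite ImD ImN. Qed.
Lemma ReM z w : Re (z * w) = Re z * Re w - Im z * Im w.
Proof. by case: z; case: w. Qed.
Lemma ImM z w : Im (z * w) = Re z * Im w + Im z * Re w.
Proof. by case: z; case: w. Qed.
Lemma ReV z : Re z^-1 = Re z / (Re z ^+ 2 + Im z ^+ 2).
Proof. by case: z. Qed.
Lemma ImV z : Im z^-1 = - Im z / (Re z ^+ 2 + Im z ^+ 2).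
Proof. by case: z => a b /=; rewrite mulNr. Qed.
Lemma ReMr x z : Re (x%:C * z) = x * Re z.
Proof. by rewrite ReM /= mul0r subr0. Qed.
Lemma ImMr x z : Im (x%:C * z) = x * Im z.
Proof. by rewrite ImM /= mul0r addr0. Qed.

Lemma normc_sqr z : normc z ^+ 2 = Re z ^+ 2 + Im z ^+ 2.
Proof. by case: z => a b /=; rewrite sqr_sqrtr// addr_ge0// sqr_ge0. Qed.
Lemma normc_ge0 z : 0 <= normc z.
Proof. by case: z => a b /=; exact: sqrtr_ge0. Qed.
Lemma normcD z w : normc (z + w) <= normc z + normc w.
Proof. exact: le_normcD. Qed.
Lemma normcN z : normc (- z) = normc z.
Proof. exact: normcN. Qed.
Lemma normcB z w : normc (z - w) <= normc z + normc w.
Proof. by rewrite -(normcN w); exact: normcD. Qed.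
Lemma normc_distC z w : normc (z - w) = normc (w - z).
Proof. by rewrite -normcN opprB. Qed.
Lemma normc_real x : normc x%:C = `|x|.
Proof. by rewrite /= expr0n/= addr0 sqrtr_sqr. Qed.
Lemma normc_Re z : `|Re z| <= normc z.
Proof.
by rewrite -sqrtr_sqr; case: z => a b /=; rewrite ler_wsqrtr// lerDl sqr_ge0.
Qed.
Lemma normc_Im z : `|Im z| <= normc z.
Proof.
by rewrite -sqrtr_sqr; case: z => a b /=; rewrite ler_wsqrtr// lerDr sqr_ge0.
Qed.
Lemma normc_le z : normc z <= `|Re z| + `|Im z|.
Proof.
have h : 0 <= `|Re z| + `|Im z| by rewrite addr_ge0.
rewrite -(ler_pXn2r (ltn0Sn 1)) ?nnegrE ?normc_ge0//.
rewrite normc_sqr sqrrD !real_normK ?num_real// addrAC lerDl.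
by rewrite mulrn_wge0// mulr_ge0.
Qed.
Lemma normc_eq0 z : (normc z == 0) = (z == 0).
Proof.
apply/eqP/eqP => [|->]; first exact: Normc.eq0_normc.
exact: Normc.normc0.
Qed.
Lemma normc_gt0 z : (0 < normc z) = (z != 0).
Proof. by rewrite lt_neqAle normc_ge0 andbT eq_sym normc_eq0. Qed.

Lemma normc_sum (I : Type) (r : seq I) (P : pred I) (F : I -> R[i]) :
  normc (\sum_(i <- r | P i) F i) <= \sum_(i <- r | P i) normc (F i).
Proof.
elim/big_rec2 : _ => [|i x y _ h]; first by rewrite Normc.normc0.
by apply: le_trans (normcD _ _) _; rewrite lerD2l.
Qed.
Lemma ReJ z : Re (conjc z) = Re z. Proof. by case: z. Qed.
Lemma ImJ z : Im (conjc z) = - Im z. Proof. by case: z. Qed.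
Lemma normcJ z : normc (conjc z) = normc z.
Proof. by case: z => a b /=; rewrite sqrrN. Qed.
Lemma mulcJ z : z * (conjc z) = (normc z ^+ 2)%:C.
Proof.
apply: complex_eqP; rewrite ?ReM ?ImM ReJ ImJ /= ?normc_sqr; ring.
Qed.
Lemma conjcM z w : conjc (z * w) = conjc z * conjc w.
Proof. by apply: complex_eqP; rewrite !(ReJ, ImJ, ReM, ImM); ring. Qed.
Lemma normc_mulM z w : normc (z * w) = normc z * normc w.
Proof. exact: Normc.normcM. Qed.

(* An integral is bounded through the real part of its product with a
   unimodular constant. *)
Lemma normc_unimodular z :
  exists2 u : R[i], normc u = 1 & Re (u * z) = normc z.
Proof.
have [->|z0] := eqVneq z 0.
  by exists 1; rewrite ?Normc.normc1// mulr0 Normc.normc0.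
have nz : normc z != 0 by rewrite normc_eq0.
exists ((normc z)^-1%:C * (conjc z)).
  rewrite Normc.normcM normcJ normc_real ger0_norm ?invr_ge0 ?normc_ge0//.
  by rewrite mulVf.
rewrite -mulrA (mulrC (conjc z)) mulcJ -rmorphM/=; field.
exact: nz.
Qed.

Lemma cexpD z w : cexp (z + w) = cexp z * cexp w.
Proof.
rewrite /cexp ReD ImD expRD sinD cosD.
by apply: complex_eqP; rewrite !(ReM, ImM)/=; ring.
Qed.
Lemma cexp0 : cexp (0 : R[i]) = 1.
Proof.
by rewrite /cexp/= expR0 sin0 cos0; apply: complex_eqP; rewrite !(ReM, ImM)/=; ring.
Qed.
Lemma cexpVN z : cexp z * cexp (- z) = 1.
Proof. by rewrite -cexpD subrr cexp0. Qed.
Lemma cexp_neq0 z : cexp z != 0.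
Proof.
by apply/eqP => h; have /eqP := cexpVN z; rewrite h mul0r eq_sym oner_eq0.
Qed.
Lemma cexpN z : cexp (- z) = (cexp z)^-1.
Proof. by rewrite -[RHS]mulr1 -(cexpVN z) mulKf// cexp_neq0. Qed.
Lemma normc_cexp z : normc (cexp z) = expR (Re z).
Proof.
rewrite /cexp Normc.normcM normc_real ger0_norm ?expR_ge0//.
by rewrite /= cos2Dsin2 sqrtr1 mulr1.
Qed.
Lemma cexp_real x : cexp x%:C = (expR x)%:C.
Proof.
by rewrite /cexp/= sin0 cos0; apply: complex_eqP; rewrite !(ReM, ImM)/=; ring.
Qed.
Lemma cexpJ z : cexp (conjc z) = conjc (cexp z).
Proof.
rewrite /cexp ReJ ImJ sinN cosN.
by apply: complex_eqP; rewrite ?ReJ ?ImJ !(ReM, ImM)/=; ring.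
Qed.
Lemma cexpMn z n : cexp (n%:R * z) = cexp z ^+ n.
Proof.
elim: n => [|n IH]; first by rewrite mul0r cexp0.
by rewrite -natr1 mulrDl mul1r cexpD IH exprSr.
Qed.

Lemma cpowD x s w : cpow x (s + w) = cpow x s * cpow x w.
Proof. by rewrite /cpow mulrDl cexpD. Qed.
Lemma cpowN x s : cpow x (- s) = (cpow x s)^-1.
Proof. by rewrite /cpow mulNr cexpN. Qed.
Lemma cpowB x s w : cpow x (s - w) = cpow x s / cpow x w.
Proof. by rewrite cpowD cpowN. Qed.
Lemma cpow_neq0 x s : cpow x s != 0.
Proof. exact: cexp_neq0. Qed.

Lemma cpow_real x y : 0 < x -> cpow x y%:C = (x `^ y)%:C.
Proof. by move=> x0; rewrite /cpow -rmorphM/= cexp_real /powR gt_eqF. Qed.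
Lemma cpow1 x : 0 < x -> cpow x 1 = x%:C.
Proof. by move=> x0; rewrite (cpow_real 1 x0) powRr1// ltW. Qed.
Lemma normc_cpow x s : 0 < x -> normc (cpow x s) = x `^ Re s.
Proof.
move=> x0; rewrite /cpow normc_cexp ReM/= mulr0 subr0 /powR gt_eqF//.
Qed.

Lemma cpowV x s : 0 < x -> cpow x^-1 s = cpow x (- s).
Proof. by move=> x0; rewrite /cpow lnV// rmorphN/= mulrN mulNr. Qed.
Lemma cpowJ x s : cpow x (conjc s) = conjc (cpow x s).
Proof.
rewrite /cpow -cexpJ; congr cexp.
by apply: complex_eqP; rewrite ?(ReJ, ImJ) !(ReM, ImM) ?(ReJ, ImJ)/=; ring.
Qed.
Lemma cpow_Mn x s n : cpow x (n%:R * s) = cpow x s ^+ n.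
Proof. by rewrite /cpow -mulrA cexpMn. Qed.
Lemma cpow_nat x n : 0 < x -> cpow x n%:R = (x ^+ n)%:C.
Proof. by move=> x0; rewrite -[n%:R]mulr1 cpow_Mn cpow1// rmorphXn. Qed.
Lemma cpow_1 s : cpow 1 s = 1.
Proof. by rewrite /cpow ln1 mulr0 cexp0. Qed.

End ComplexNumbers.

(** * Moduli of sine, cosine and cotangent on vertical lines *)

Section Trigonometry.
Context {R : realType}.
Implicit Types (z w s : R[i]) (x y : R).

Definition chR y : R := (expR y + expR (- y)) / 2.
Definition shR y : R := (expR y - expR (- y)) / 2.

Lemma chshR y : chR y ^+ 2 = 1 + shR y ^+ 2.
Proof.
rewrite /chR /shR; have := expRxMexpNx_1 y; set a := expR y; set b := expR _.
move=> h; have -> : ((a + b) / 2) ^+ 2 = a * b + ((a - b) / 2) ^+ 2 by field.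
by rewrite h.
Qed.

Lemma csinE z : csin z = (sin (Re z) * chR (Im z)) +i* (cos (Re z) * shR (Im z)).
Proof.
rewrite /csin /cexp; case: z => x y /=.
have -> : (2 * 'i%C : R[i])^-1 = - (2^-1)%:C * 'i%C.
  apply: (@mulIf _ (2 * 'i%C)).
    by rewrite mulf_neq0// ?pnatr_eq0// -normc_eq0/= expr0n expr1n add0r sqrtr1 oner_eq0.
  rewrite mulVf; last first.
    by rewrite mulf_neq0// ?pnatr_eq0// -normc_eq0/= expr0n expr1n add0r sqrtr1 oner_eq0.
  have -> : - (2^-1)%:C * 'i%C * (2 * 'i%C) = - (2^-1 *+ 2)%:C * ('i%C ^+ 2) :> R[i].
    by rewrite rmorphMn/=; ring.
  by rewrite sqr_i mulrNN mulr1 -[_ *+ 2]mulr_natl mulfV ?pnatr_eq0.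
rewrite !mul0r !mul1r !sub0r !add0r ?opprK sinN cosN /chR /shR.
by apply: complex_eqP; rewrite ?(ReM, ImM, ReD, ImD, ReN, ImN)/=; field.
Qed.

Lemma ccosE z : ccos z = (cos (Re z) * chR (Im z)) +i* (- (sin (Re z) * shR (Im z))).
Proof.
rewrite /ccos /cexp; case: z => x y /=.
have -> : (2 : R[i])^-1 = (2^-1)%:C.
  by rewrite rmorphV/= ?unitfE ?pnatr_eq0// rmorph_nat.
rewrite !mul0r !mul1r !sub0r !add0r ?opprK sinN cosN /chR /shR.
by apply: complex_eqP; rewrite ?(ReM, ImM, ReD, ImD, ReN, ImN)/=; field.
Qed.

Lemma csinD z w : csin (z + w) = csin z * ccos w + ccos z * csin w.
Proof.
rewrite !csinE !ccosE ReD ImD sinD cosD /chR /shR opprD !expRD.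
by apply: complex_eqP; rewrite ?(ReM, ImM, ReD, ImD, ReN, ImN)/=; field.
Qed.
Lemma ccosD z w : ccos (z + w) = ccos z * ccos w - csin z * csin w.
Proof.
rewrite !csinE !ccosE ReD ImD sinD cosD /chR /shR opprD !expRD.
by apply: complex_eqP; rewrite ?(ReM, ImM, ReD, ImD, ReN, ImN)/=; field.
Qed.
Lemma csinN z : csin (- z) = - csin z.
Proof.
rewrite !csinE ReN ImN sinN cosN /chR /shR opprK.
by apply: complex_eqP; rewrite ?(ReM, ImM, ReD, ImD, ReN, ImN)/=; field.
Qed.
Lemma ccosN z : ccos (- z) = ccos z.
Proof.
rewrite !ccosE ReN ImN sinN cosN /chR /shR opprK.
by apply: complex_eqP; rewrite ?(ReM, ImM, ReD, ImD, ReN, ImN)/=; field.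
Qed.
Lemma ccotN z : ccot (- z) = - ccot z.
Proof. by rewrite /ccot csinN ccosN invrN mulrN. Qed.

Lemma csin_real x : csin x%:C = (sin x)%:C.
Proof.
rewrite csinE/= /chR /shR oppr0 expR0.
by apply: complex_eqP => /=; field.
Qed.
Lemma ccos_real x : ccos x%:C = (cos x)%:C.
Proof.
rewrite ccosE/= /chR /shR oppr0 expR0.
by apply: complex_eqP => /=; field.
Qed.

Lemma csin2Dccos2 z : csin z ^+ 2 + ccos z ^+ 2 = 1.
Proof.
have := ccosD z (- z); rewrite subrr ccosN csinN.
rewrite -[0]/(0%:C : R[i]) ccos_real cos0 mulrN opprK addrC -!expr2.
by move=> <-.
Qed.

(** The hyperbolic and circular Pythagorean identities collapse the products. The term
    [shR (Im z) ^+ 2] is shared with the cosine, so quotients of the two are controlled by the real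
    part alone. *)
Lemma normc_csin2 z : normc (csin z) ^+ 2 = sin (Re z) ^+ 2 + shR (Im z) ^+ 2.
Proof.
rewrite csinE normc_sqr/= (exprMn _ (sin _)) (exprMn _ (cos _)) chshR.
have := cos2Dsin2 (Re z); set a := cos _; set b := sin _ => h.
have -> : a ^+ 2 = 1 - b ^+ 2 by rewrite -h; ring.
by ring.
Qed.
Lemma normc_ccos2 z : normc (ccos z) ^+ 2 = cos (Re z) ^+ 2 + shR (Im z) ^+ 2.
Proof.
rewrite ccosE normc_sqr/= sqrrN (exprMn _ (sin _)) (exprMn _ (cos _)) chshR.
have := cos2Dsin2 (Re z); set a := cos _; set b := sin _ => h.
have -> : b ^+ 2 = 1 - a ^+ 2 by rewrite -h; ring.
by ring.
Qed.

Lemma csin_neq0 z : sin (Re z) != 0 -> csin z != 0.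
Proof.
move=> h; rewrite -normc_eq0.
have : 0 < normc (csin z) ^+ 2.
  by rewrite normc_csin2 ltr_wpDr ?sqr_ge0// exprn_even_gt0.
by apply: contraTneq => ->; rewrite expr0n ltxx.
Qed.
Lemma ccos_neq0 z : cos (Re z) != 0 -> ccos z != 0.
Proof.
move=> h; rewrite -normc_eq0.
have : 0 < normc (ccos z) ^+ 2.
  by rewrite normc_ccos2 ltr_wpDr ?sqr_ge0// exprn_even_gt0.
by apply: contraTneq => ->; rewrite expr0n ltxx.
Qed.

(** Adding the same nonnegative number [shR (Im z) ^+ 2] to the squares of the real cosine and sine
    cannot push their quotient above 1 / sin^2. The bound does not see the imaginary part, so the
    cotangent is a bounded multiplier on each vertical line that avoids its poles. *)
Lemma normc_ccot_le z : sin (Re z) != 0 -> normc (ccot z) <= `|sin (Re z)|^-1.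
Proof.
move=> h.
have h0 : 0 < normc (csin z) by rewrite normc_gt0 csin_neq0.
rewrite /ccot normc_mulM Normc.normcV ler_pdivrMr//.
rewrite mulrC ler_pdivlMr ?normr_gt0//.
rewrite -(ler_pXn2r (ltn0Sn 1)) ?nnegrE ?mulr_ge0 ?normc_ge0//.
rewrite exprMn normc_csin2 normc_ccos2 real_normK ?num_real//.
have := cos2Dsin2 (Re z); set a := cos _; set b := sin _ => e.
have -> : a ^+ 2 = 1 - b ^+ 2 by rewrite -e; ring.
have b1 : b ^+ 2 <= 1 by rewrite -e lerDr sqr_ge0.
have := sqr_ge0 (shR (Im z)); have := sqr_ge0 b; set p := b ^+ 2 in b1 *.
set q := _ ^+ 2 => p0 q0; nra.
Qed.

(** The same comparison with sine and cosine exchanged. It serves the factor 1 / cot on the line of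
    real part 2 alpha, where the cosine does not vanish because 2 alpha < 1/2. *)
Lemma normc_ccotV_le z : cos (Re z) != 0 ->
  normc (ccot z)^-1 <= `|cos (Re z)|^-1.
Proof.
move=> h.
have h0 : 0 < normc (ccos z) by rewrite normc_gt0 ccos_neq0.
rewrite /ccot invf_div normc_mulM Normc.normcV ler_pdivrMr//.
rewrite mulrC ler_pdivlMr ?normr_gt0//.
rewrite -(ler_pXn2r (ltn0Sn 1)) ?nnegrE ?mulr_ge0 ?normc_ge0//.
rewrite exprMn normc_csin2 normc_ccos2 real_normK ?num_real//.
have := cos2Dsin2 (Re z); set a := cos _; set b := sin _ => e.
have -> : b ^+ 2 = 1 - a ^+ 2 by rewrite -e; ring.
have b1 : a ^+ 2 <= 1 by rewrite -e lerDl sqr_ge0.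
have := sqr_ge0 (shR (Im z)); have := sqr_ge0 a; set p := a ^+ 2 in b1 *.
set q := _ ^+ 2 => p0 q0; nra.
Qed.

Lemma sin_pi_neq0 x : 0 < x -> x < 1 -> sin (pi * x) != 0.
Proof.
move=> x0 x1; rewrite gt_eqF// sin_gt0_pi// mulr_gt0 ?pi_gt0//=.
by rewrite -[ltRHS]mulr1 ltr_pM2l ?pi_gt0.
Qed.
Lemma cos_pi_neq0 x : 0 < x -> x < 2^-1 -> cos (pi * x) != 0.
Proof.
move=> x0 x1; rewrite gt_eqF// cos_gt0_pihalf//.
have p := pi_gt0 R; rewrite ltr_pM2l// x1 andbT.
by rewrite (@lt_trans _ _ 0) ?mulr_gt0// oppr_lt0 divr_gt0.
Qed.

End Trigonometry.

(** * Complex functions of a real variable: derivatives *)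

Section ComplexDerivative.
Context {R : realType}.
Implicit Types (F G : R -> R[i]) (z w s : R[i]) (x y t : R).

(** The variable is real, so holomorphy never enters; working by components lets the real chain rule
    and the real fundamental theorem of calculus be applied twice. *)
Definition cderiv F x l : Prop :=
  is_derive x (1 : R) (fun t => Re (F t)) (Re l) /\
  is_derive x (1 : R) (fun t => Im (F t)) (Im l).

Lemma is_derive_eqv (f g : R -> R) x (a b : R) :
  is_derive x (1 : R) f a -> f = g -> a = b -> is_derive x (1 : R) g b.
Proof. by move=> h <- <-. Qed.

Lemma is_derive_mul (f g : R -> R) x (a b : R) :
  is_derive x (1 : R) f a -> is_derive x (1 : R) g b ->
  is_derive x (1 : R) (fun t => f t * g t) (a * g x + f x * b).
Proof.
move=> hf hg; apply: (is_derive_eqv (is_deriveM hf hg)) => //.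
by rewrite /GRing.scale/= addrC; congr (_ + _); exact: mulrC.
Qed.

Lemma is_derive_add (f g : R -> R) x (a b : R) :
  is_derive x (1 : R) f a -> is_derive x (1 : R) g b ->
  is_derive x (1 : R) (fun t => f t + g t) (a + b).
Proof. by move=> hf hg; exact: (is_derive_eqv (is_deriveD hf hg)). Qed.

Lemma is_derive_sub (f g : R -> R) x (a b : R) :
  is_derive x (1 : R) f a -> is_derive x (1 : R) g b ->
  is_derive x (1 : R) (fun t => f t - g t) (a - b).
Proof. by move=> hf hg; exact: (is_derive_eqv (is_deriveB hf hg)). Qed.

Lemma cderiv_eq F x l l' : cderiv F x l -> l = l' -> cderiv F x l'.
Proof. by move=> h <-. Qed.

Lemma cderiv_cst z x : cderiv (fun=> z) x 0.
Proof. by split; exact: is_derive_cst. Qed.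

Lemma cderiv_real (f : R -> R) x (l : R) :
  is_derive x (1 : R) f l -> cderiv (fun t => (f t)%:C) x l%:C.
Proof. by split=> //=; exact: is_derive_cst. Qed.

Lemma cderivD F G x l m : cderiv F x l -> cderiv G x m ->
  cderiv (fun t => F t + G t) x (l + m).
Proof.
move=> [f1 f2] [g1 g2]; split.
  rewrite ReD; under [X in is_derive _ _ X]eq_fun do rewrite ReD.
  exact: is_derive_add.
rewrite ImD; under [X in is_derive _ _ X]eq_fun do rewrite ImD.
exact: is_derive_add.
Qed.

Lemma cderivM F G x l m : cderiv F x l -> cderiv G x m ->
  cderiv (fun t => F t * G t) x (l * G x + F x * m).
Proof.
move=> [f1 f2] [g1 g2]; split.
  under [X in is_derive _ _ X]eq_fun do rewrite ReM.
  apply: (is_derive_eqv (is_derive_sub (is_derive_mul f1 g1)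
    (is_derive_mul f2 g2))) => //.
  by rewrite ReD !ReM; ring.
under [X in is_derive _ _ X]eq_fun do rewrite ImM.
apply: (is_derive_eqv (is_derive_add (is_derive_mul f1 g2)
  (is_derive_mul f2 g1))) => //.
by rewrite ImD !ImM; ring.
Qed.

Lemma cderivMl F z x l : cderiv F x l -> cderiv (fun t => z * F t) x (z * l).
Proof.
move=> h; apply: cderiv_eq (cderivM (cderiv_cst z x) h) _.
by rewrite mul0r add0r.
Qed.

Lemma cderivMr F z x l : cderiv F x l -> cderiv (fun t => F t * z) x (l * z).
Proof.
move=> h; apply: cderiv_eq (cderivM h (cderiv_cst z x)) _.
by rewrite mulr0 addr0.
Qed.

Lemma cderivB F G x l m : cderiv F x l -> cderiv G x m ->
  cderiv (fun t => F t - G t) x (l - m).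
Proof.
move=> h1 h2; rewrite -[m]mul1r -mulNr.
have -> : (fun t => F t - G t) = (fun t => F t + (-1) * G t).
  by apply/funext => t; rewrite mulN1r.
by apply: cderivD => //; exact: cderivMl.
Qed.

Lemma cderiv_cexp F x l : cderiv F x l ->
  cderiv (fun t => cexp (F t)) x (l * cexp (F x)).
Proof.
move=> [f1 f2].
have h1 := is_derive1_comp (is_derive_expR (Re (F x))) f1.
have h2 := is_derive1_comp (is_derive_sin (Im (F x))) f2.
have h3 := is_derive1_comp (is_derive_cos (Im (F x))) f2.
have {}h1 : cderiv (fun t => (expR (Re (F t)))%:C) x (expR (Re (F x)) * Re l)%:C.
  exact: cderiv_real.
have h4 : cderiv (fun t => cos (Im (F t)) +i* sin (Im (F t))) x
    ((- sin (Im (F x)) * Im l) +i* (cos (Im (F x)) * Im l)).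
  by split.
apply: cderiv_eq (cderivM h1 h4) _.
by rewrite /cexp; apply: complex_eqP; rewrite ?(ReM, ImM, ReD, ImD)/=; ring.
Qed.

Lemma cderiv_cpow z x : 0 < x ->
  cderiv (cpow ^~ z) x (z * cpow x (z - 1)).
Proof.
move=> x0; have hl : cderiv (fun t => z * (ln t)%:C) x (z * (x^-1)%:C).
  exact/cderivMl/cderiv_real/is_derive1_ln.
apply: cderiv_eq (cderiv_cexp hl) _; rewrite -/(cpow x z).
rewrite cpowB cpow1// -mulrA; congr (_ * _); rewrite mulrC; congr (_ * _).
by rewrite -(fmorphV (real_complex R)).
Qed.

Lemma is_derive_continuous (f : R -> R) x l : is_derive x (1 : R) f l ->
  {for x, continuous f}.
Proof. by move=> [h _]; exact/differentiable_continuous/derivable1_diffP. Qed.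

Lemma cderiv_continuous F x l : cderiv F x l ->
  {for x, continuous (fun t => Re (F t))} /\
  {for x, continuous (fun t => Im (F t))}.
Proof. by move=> [h1 h2]; split; exact: is_derive_continuous h1 || exact: is_derive_continuous h2. Qed.

End ComplexDerivative.

(** * Measurability of complex functions *)

Section ComplexMeasurable.
Context {R : realType} {d : measure_display} {T : measurableType d}.
Implicit Types (D : set T) (f g : T -> R[i]) (h : T -> R).

Lemma cmeasurable_cst D (z : R[i]) : cmeasurable D (fun=> z).
Proof. by split; exact: measurable_cst. Qed.

Lemma cmeasurable_real D h : measurable_fun D h ->
  cmeasurable D (fun x => (h x)%:C).
Proof. by split=> //=; exact: measurable_cst. Qed.

Lemma cmeasurable_pair D h1 h2 : measurable_fun D h1 -> measurable_fun D h2 ->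
  cmeasurable D (fun x => (h1 x) +i* (h2 x)).
Proof. by []. Qed.

Lemma cmeasurableD D f g : cmeasurable D f -> cmeasurable D g ->
  cmeasurable D (fun x => f x + g x).
Proof.
move=> [f1 f2] [g1 g2]; split.
  by under eq_fun do rewrite ReD; exact: measurable_funD.
by under eq_fun do rewrite ImD; exact: measurable_funD.
Qed.

Lemma cmeasurableM D f g : cmeasurable D f -> cmeasurable D g ->
  cmeasurable D (fun x => f x * g x).
Proof.
move=> [f1 f2] [g1 g2]; split.
  under eq_fun do rewrite ReM.
  by apply: measurable_funB; exact: measurable_funM.
under eq_fun do rewrite ImM.
by apply: measurable_funD; exact: measurable_funM.
Qed.

Lemma cmeasurableN D f : cmeasurable D f -> cmeasurable D (fun x => - f x).
Proof.
move=> hf; have := cmeasurableM (cmeasurable_cst D (-1)) hf.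
by under eq_fun do rewrite mulN1r.
Qed.

Lemma cmeasurableB D f g : cmeasurable D f -> cmeasurable D g ->
  cmeasurable D (fun x => f x - g x).
Proof. by move=> hf hg; apply: cmeasurableD => //; exact: cmeasurableN. Qed.

Lemma measurable_funV D h : measurable_fun D h ->
  measurable_fun D (fun x => (h x)^-1).
Proof.
move=> mh.
(* The power -1 of the nonnegative [h x ^+ 2] is measurable as a real power; where [h] vanishes both
   sides are 0, the inverse of 0 being 0. *)
have -> : (fun x => (h x)^-1) = (fun x => h x * (h x ^+ 2) `^ (-1)).
  apply/funext => x; rewrite powR_inv1 ?sqr_ge0//.
  have [->|h0] := eqVneq (h x) 0; first by rewrite invr0 mul0r.
  by field.
apply: measurable_funM => //.
apply: (measurableT_comp (measurable_powR (-1))).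
exact: measurable_funX.
Qed.

Lemma cmeasurableV D f : cmeasurable D f -> cmeasurable D (fun x => (f x)^-1).
Proof.
move=> [f1 f2].
have h : measurable_fun D (fun x => (Re (f x) ^+ 2 + Im (f x) ^+ 2)^-1).
  by apply: measurable_funV; apply: measurable_funD; exact: measurable_funX.
split.
  by under eq_fun do rewrite ReV; exact: measurable_funM.
under eq_fun do rewrite ImV.
by apply: measurable_funM => //; exact: measurableT_comp.
Qed.

Lemma cmeasurableJ D f : cmeasurable D f -> cmeasurable D (fun x => conjc (f x)).
Proof.
move=> [f1 f2]; split.
  by under eq_fun do rewrite ReJ.
by under eq_fun do rewrite ImJ; exact: measurableT_comp.
Qed.

Lemma cmeasurable_cexp D f : cmeasurable D f -> cmeasurable D (fun x => cexp (f x)).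
Proof.
move=> [f1 f2]; apply: cmeasurableM; first exact/cmeasurable_real/measurableT_comp.
apply: cmeasurable_pair.
  exact: (measurableT_comp (continuous_measurable_fun (@continuous_cos R))).
exact: (measurableT_comp (continuous_measurable_fun (@continuous_sin R))).
Qed.

Lemma cmeasurable_cpow D h f : measurable_fun D h -> cmeasurable D f ->
  cmeasurable D (fun x => cpow (h x) (f x)).
Proof.
move=> mh mf; apply: cmeasurable_cexp; apply: cmeasurableM => //.
exact/cmeasurable_real/measurableT_comp.
Qed.

Lemma cmeasurable_ccot D f : cmeasurable D f -> cmeasurable D (fun x => ccot (f x)).
Proof.
move=> mf.
have m1 : cmeasurable D (fun x => cexp ('i%C * f x)).
  by apply: cmeasurable_cexp; apply: cmeasurableM => //; exact: cmeasurable_cst.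
have m2 : cmeasurable D (fun x => cexp (- ('i%C * f x))).
  apply: cmeasurable_cexp; apply: cmeasurableN.
  by apply: cmeasurableM => //; exact: cmeasurable_cst.
apply: cmeasurableM.
  by apply: cmeasurableM; [exact: cmeasurableD|exact: cmeasurable_cst].
apply: cmeasurableV.
by apply: cmeasurableM; [exact: cmeasurableB|exact: cmeasurable_cst].
Qed.

Lemma measurable_normc D f : cmeasurable D f ->
  measurable_fun D (fun x => normc (f x)).
Proof.
move=> [f1 f2].
have -> : (fun x => normc (f x)) =
    (fun x => (Re (f x) ^+ 2 + Im (f x) ^+ 2) `^ 2^-1).
  apply/funext => x; rewrite powR12_sqrt ?addr_ge0 ?sqr_ge0//.
  by case: (f x).
apply: (measurableT_comp (measurable_powR 2^-1)).
by apply: measurable_funD; exact: measurable_funX.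
Qed.

Lemma cmeasurableS D E f : measurable E -> D `<=` E ->
  cmeasurable E f -> cmeasurable D f.
Proof. by move=> mE DE [f1 f2]; split; exact: measurable_funS DE _. Qed.

Lemma eq_cmeasurable D f g : (forall x, D x -> f x = g x) ->
  cmeasurable D f -> cmeasurable D g.
Proof.
move=> fg [f1 f2]; split; [apply: eq_measurable_fun f1 | apply: eq_measurable_fun f2];
by move=> x /set_mem /fg ->.
Qed.

End ComplexMeasurable.

Section ComplexMeasurableComp.
Context {R : realType} {d1 d2 : measure_display} {T1 : measurableType d1}
  {T2 : measurableType d2}.

Lemma cmeasurable_comp (f : T2 -> R[i]) (h : T1 -> T2) :
  cmeasurable setT f -> measurable_fun setT h ->
  cmeasurable setT (fun x => f (h x)).
Proof.
by move=> [f1 f2] mh; split; [exact: (measurableT_comp f1)|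
  exact: (measurableT_comp f2)].
Qed.

End ComplexMeasurableComp.

(** * Limits of complex functions along a filter *)

Section ComplexConvergence.
Context {R : realType} {T : Type} {F : set_system T} {FF : ProperFilter F}.
Implicit Types (u v : T -> R[i]) (l m : R[i]).

Definition ccvg u l : Prop :=
  Re (u x) @[x --> F] --> Re l /\ Im (u x) @[x --> F] --> Im l.

Lemma ccvgP u l : ccvg u l <-> normc (u x - l) @[x --> F] --> (0 : R).
Proof.
split=> [[h1 h2]|h].
  have h : `|Re (u x) - Re l| + `|Im (u x) - Im l| @[x --> F] --> (0 : R).
    rewrite -[X in _ --> X](addr0 (0 : R)).
    by apply: cvgD; apply/norm_cvg0P => /=; exact/subr_cvg0.
  apply: (squeeze_cvgr _ (cvg_cst 0) h); near=> x.
  rewrite normc_ge0/= -ReB -ImB; exact: normc_le.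
have h0 f : (forall x, `|f x| <= normc (u x - l)) -> f x @[x --> F] --> (0 : R).
  move=> hf; apply/norm_cvg0P; apply: (squeeze_cvgr _ (cvg_cst 0) h).
  by near=> x; rewrite normr_ge0 hf.
by split; apply/subr_cvg0; apply: h0 => x;
  rewrite -?ReB -?ImB; [exact: normc_Re|exact: normc_Im].
Unshelve. all: by end_near. Qed.

Lemma eq_ccvg u v l : ccvg u l -> (forall x, u x = v x) -> ccvg v l.
Proof. by move=> + /funext <-. Qed.

Lemma ccvg_cst l : ccvg (fun=> l) l.
Proof. by split; exact: cvg_cst. Qed.

Lemma ccvgD u v l m : ccvg u l -> ccvg v m -> ccvg (fun x => u x + v x) (l + m).
Proof.
move=> [u1 u2] [v1 v2]; split.
  by under eq_fun do rewrite ReD; rewrite ReD; exact: cvgD.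
by under eq_fun do rewrite ImD; rewrite ImD; exact: cvgD.
Qed.

Lemma ccvgM u v l m : ccvg u l -> ccvg v m -> ccvg (fun x => u x * v x) (l * m).
Proof.
move=> [u1 u2] [v1 v2]; split.
  by under eq_fun do rewrite ReM; rewrite ReM; apply: cvgB; exact: cvgM.
by under eq_fun do rewrite ImM; rewrite ImM; apply: cvgD; exact: cvgM.
Qed.

Lemma ccvgN u l : ccvg u l -> ccvg (fun x => - u x) (- l).
Proof.
move=> h; have := ccvgM (ccvg_cst (-1)) h.
by under eq_fun do rewrite mulN1r; rewrite mulN1r.
Qed.

Lemma ccvgB u v l m : ccvg u l -> ccvg v m -> ccvg (fun x => u x - v x) (l - m).
Proof. by move=> hu hv; apply: ccvgD => //; exact: ccvgN. Qed.

Lemma ccvg_unique u l m : ccvg u l -> ccvg u m -> l = m.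
Proof.
move=> [u1 u2] [v1 v2]; apply: complex_eqP; exact: cvg_unique u1 v1 || exact: cvg_unique u2 v2.
Qed.

Lemma ccvg_real (f : T -> R) (l : R) : f x @[x --> F] --> l ->
  ccvg (fun x => (f x)%:C) l%:C.
Proof. by split=> //=; exact: cvg_cst. Qed.

Lemma ccvgV u l : l != 0 -> ccvg u l -> ccvg (fun x => (u x)^-1) l^-1.
Proof.
move=> l0 [u1 u2].
have h0 : Re l ^+ 2 + Im l ^+ 2 != 0 by rewrite -normc_sqr expf_neq0// normc_eq0.
have h : (Re (u x) ^+ 2 + Im (u x) ^+ 2)^-1 @[x --> F] -->
    (Re l ^+ 2 + Im l ^+ 2)^-1.
  by apply: cvgV => //; rewrite !expr2; apply: cvgD; apply: cvgM.
split.
  by under eq_fun do rewrite ReV; rewrite ReV; exact: cvgM.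
by under eq_fun do rewrite ImV; rewrite ImV; apply: cvgM => //; exact: cvgN.
Qed.

Lemma ccvg_normc u l : ccvg u l -> normc (u x) @[x --> F] --> normc l.
Proof.
move=> [u1 u2].
have e z : normc z = Num.sqrt (Re z ^+ 2 + Im z ^+ 2) by case: z.
rewrite e; under eq_fun do rewrite e.
have h : Re (u x) ^+ 2 + Im (u x) ^+ 2 @[x --> F] --> Re l ^+ 2 + Im l ^+ 2.
  by rewrite !expr2; apply: cvgD; apply: cvgM.
exact: (cvg_comp _ _ h (@sqrt_continuous R _)).
Qed.

Lemma ccvg_sum (I : Type) (r : seq I) (f : I -> T -> R[i]) (l : I -> R[i]) :
  (forall i, ccvg (f i) (l i)) ->
  ccvg (fun x => \sum_(i <- r) f i x) (\sum_(i <- r) l i).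
Proof.
move=> h; elim: r => [|a r IH].
  rewrite big_nil; under eq_fun do rewrite big_nil.
  exact: ccvg_cst.
by rewrite big_cons; under eq_fun do rewrite big_cons; exact: ccvgD.
Qed.

Lemma ccvg_squeeze u l (g : T -> R) :
  (\forall x \near F, normc (u x - l) <= g x) -> g x @[x --> F] --> (0 : R) ->
  ccvg u l.
Proof.
move=> h hg; apply/ccvgP; apply: (squeeze_cvgr _ (cvg_cst 0) hg).
by near=> x; rewrite normc_ge0/=; near: x.
Unshelve. all: by end_near. Qed.

End ComplexConvergence.
Arguments ccvg {R T} F u l.

(** * Integration of complex functions *)

Section ComplexIntegral.
Context {R : realType} {d : measure_display} {T : measurableType d}.
Variables (mu : {measure set T -> \bar R}) (D : set T).
Hypothesis mD : measurable D.
Implicit Types (f : T -> R[i]) (g : T -> R).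

Lemma cintegrable_measurable f : cintegrable mu D f -> cmeasurable D f.
Proof.
by move=> [h1 h2]; split; apply/measurable_EFinP; exact: measurable_int h1 || exact: measurable_int h2.
Qed.

Lemma integrable_dom g h : measurable_fun D g -> mu.-integrable D (EFin \o h) ->
  (forall x, D x -> `|g x| <= h x) -> mu.-integrable D (EFin \o g).
Proof.
move=> mg ih gh; apply: le_integrable ih => //; first exact/measurable_EFinP.
move=> x Dx /=; rewrite lee_fin (le_trans (gh x Dx))//; exact: ler_norm.
Qed.

Lemma cintegrable_dom f g : cmeasurable D f -> mu.-integrable D (EFin \o g) ->
  (forall x, D x -> normc (f x) <= g x) -> cintegrable mu D f.
Proof.
move=> [f1 f2] ig fg; split; apply: (integrable_dom _ ig) => // x Dx;
apply: le_trans (fg x Dx); [exact: normc_Re|exact: normc_Im].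
Qed.

Lemma cintegrable_norm f : cintegrable mu D f ->
  mu.-integrable D (fun x => (normc (f x))%:E).
Proof.
move=> h; have [f1 f2] := h.
have i : mu.-integrable D (fun x => (`|Re (f x)| + `|Im (f x)|)%:E).
  by under eq_fun do rewrite EFinD; apply: integrableD => //;
    exact: (integrable_norm f1) || exact: (integrable_norm f2).
apply: (integrable_dom _ i); first exact/measurable_normc/cintegrable_measurable.
by move=> x _; rewrite ger0_norm ?normc_ge0// normc_le.
Qed.

Lemma eq_cintegrable f f' : (forall x, D x -> f x = f' x) ->
  cintegrable mu D f -> cintegrable mu D f'.
Proof.
move=> e [h1 h2]; split; [apply: eq_integrable h1 => // x /set_mem Dx|
  apply: eq_integrable h2 => // x /set_mem Dx]; by rewrite e.
Qed.

Lemma eq_cintegral f f' : (forall x, D x -> f x = f' x) ->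
  cintegral mu D f = cintegral mu D f'.
Proof.
by move=> e; congr Complex; apply: eq_Rintegral => x /set_mem Dx; rewrite e.
Qed.

Lemma cintegrableD f f' : cintegrable mu D f -> cintegrable mu D f' ->
  cintegrable mu D (fun x => f x + f' x).
Proof.
move=> [f1 f2] [g1 g2]; split.
  by under eq_fun do rewrite ReD EFinD; exact: integrableD.
by under eq_fun do rewrite ImD EFinD; exact: integrableD.
Qed.

Lemma cintegralD f f' : cintegrable mu D f -> cintegrable mu D f' ->
  cintegral mu D (fun x => f x + f' x) = cintegral mu D f + cintegral mu D f'.
Proof.
move=> [f1 f2] [g1 g2]; apply: complex_eqP; rewrite ?ReD ?ImD/=.
  by rewrite -RintegralD//; apply: eq_Rintegral => x _; rewrite ReD.
by rewrite -RintegralD//; apply: eq_Rintegral => x _; rewrite ImD.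
Qed.

Lemma cintegrableZ f (z : R[i]) : cintegrable mu D f ->
  cintegrable mu D (fun x => z * f x).
Proof.
move=> [f1 f2]; split.
  under eq_fun do rewrite ReM EFinB !EFinM.
  by apply: integrableB => //; exact: integrableZl.
under eq_fun do rewrite ImM EFinD !EFinM.
by apply: integrableD => //; exact: integrableZl.
Qed.

Lemma cintegralZ f (z : R[i]) : cintegrable mu D f ->
  cintegral mu D (fun x => z * f x) = z * cintegral mu D f.
Proof.
have iM (r : R) g : mu.-integrable D (EFin \o g) ->
    mu.-integrable D (fun x => (r * g x)%:E).
  by move=> ig; under eq_fun do rewrite EFinM; exact: integrableZl.
move=> [f1 f2]; apply: complex_eqP; rewrite ?ReM ?ImM/=.
  rewrite -!RintegralZl// -RintegralB//; [|exact: iM..].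
  by apply: eq_Rintegral => x _; rewrite ReM.
rewrite -!RintegralZl// -RintegralD//; [|exact: iM..].
by apply: eq_Rintegral => x _; rewrite ImM.
Qed.

Lemma cintegrableZr f (z : R[i]) : cintegrable mu D f ->
  cintegrable mu D (fun x => f x * z).
Proof. by under [fun x => _ * _]eq_fun do rewrite mulrC; exact: cintegrableZ. Qed.

Lemma cintegralZr f (z : R[i]) : cintegrable mu D f ->
  cintegral mu D (fun x => f x * z) = cintegral mu D f * z.
Proof.
by move=> h; under [fun x => _ * _]eq_fun do rewrite mulrC;
  rewrite cintegralZ// mulrC.
Qed.

Lemma cintegrableN f : cintegrable mu D f -> cintegrable mu D (fun x => - f x).
Proof.
by move/(cintegrableZ (-1)); under [fun x => _ * _]eq_fun do rewrite mulN1r.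
Qed.

Lemma cintegrableB f f' : cintegrable mu D f -> cintegrable mu D f' ->
  cintegrable mu D (fun x => f x - f' x).
Proof. by move=> h1 h2; apply: cintegrableD => //; exact: cintegrableN. Qed.

Lemma cintegralN f : cintegrable mu D f ->
  cintegral mu D (fun x => - f x) = - cintegral mu D f.
Proof.
move=> h; rewrite -mulN1r -cintegralZ//; apply: eq_cintegral => x _.
by rewrite mulN1r.
Qed.

Lemma cintegralB f f' : cintegrable mu D f -> cintegrable mu D f' ->
  cintegral mu D (fun x => f x - f' x) = cintegral mu D f - cintegral mu D f'.
Proof.
by move=> h1 h2; rewrite cintegralD ?cintegralN//; exact: cintegrableN.
Qed.

Lemma cintegrable0 : cintegrable mu D (fun=> 0).
Proof. by split; exact: integrable0. Qed.

Lemma cintegral0 : cintegral mu D (fun=> 0) = 0.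
Proof.
by apply: complex_eqP; rewrite /= /Rintegral integral0.
Qed.

Lemma cintegrable_sum (I : Type) (r : seq I) (F : I -> T -> R[i]) :
  (forall i, cintegrable mu D (F i)) ->
  cintegrable mu D (fun x => \sum_(i <- r) F i x).
Proof.
move=> h; elim: r => [|a r IH].
  under eq_fun do rewrite big_nil; exact: cintegrable0.
by under eq_fun do rewrite big_cons; exact: cintegrableD.
Qed.

Lemma cintegral_sum (I : Type) (r : seq I) (F : I -> T -> R[i]) :
  (forall i, cintegrable mu D (F i)) ->
  cintegral mu D (fun x => \sum_(i <- r) F i x) =
  \sum_(i <- r) cintegral mu D (F i).
Proof.
move=> h; elim: r => [|a r IH].
  by rewrite big_nil; under eq_fun do rewrite big_nil; exact: cintegral0.
rewrite big_cons -IH -cintegralD//; last exact: cintegrable_sum.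
by apply: eq_cintegral => x _; rewrite big_cons.
Qed.

Lemma cintegrable_real g : mu.-integrable D (EFin \o g) ->
  cintegrable mu D (fun x => (g x)%:C).
Proof. by split=> //=; exact: integrable0. Qed.

Lemma cintegral_real g : cintegral mu D (fun x => (g x)%:C) =
  (Rintegral mu D g)%:C.
Proof.
apply: complex_eqP => //=; rewrite /Rintegral.
by rewrite integral0.
Qed.

Lemma cintegral_conj f : cintegrable mu D f ->
  cintegral mu D (fun x => conjc (f x)) = conjc (cintegral mu D f).
Proof.
move=> [h1 h2]; apply: complex_eqP; rewrite ?ReJ ?ImJ/=.
  by apply: eq_Rintegral => x _; rewrite ReJ.
rewrite -mulN1r -RintegralZl//; apply: eq_Rintegral => x _.
by rewrite ImJ mulN1r.
Qed.

Lemma cintegrable_conj f : cintegrable mu D f ->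
  cintegrable mu D (fun x => conjc (f x)).
Proof.
move=> [h1 h2]; split.
  by apply: eq_integrable h1 => // x _; rewrite ReJ.
by under eq_fun do rewrite ImJ EFinN; exact: integrableN.
Qed.

(** After rotation the integral is real and nonnegative, whence the constant 1. Separate bounds on
    the components would lose a factor, and with it the sharp constant 2 pi of the later Plancherel
    inequality, on which the Mellin limit rests. *)
Lemma normc_cintegral f : cintegrable mu D f ->
  normc (cintegral mu D f) <= Rintegral mu D (fun x => normc (f x)).
Proof.
move=> h; have [u u1 <-] := normc_unimodular (cintegral mu D f).
rewrite -cintegralZ//= ; have [h1 _] := cintegrableZ u h.
apply: le_Rintegral => //; first exact: cintegrable_norm.
move=> x Dx; apply: (le_trans (ler_norm _)); apply: (le_trans (normc_Re _)).
by rewrite normc_mulM u1 mul1r.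
Qed.

Lemma normc_cintegral_le f g : cintegrable mu D f ->
  mu.-integrable D (EFin \o g) -> (forall x, D x -> normc (f x) <= g x) ->
  normc (cintegral mu D f) <= Rintegral mu D g.
Proof.
move=> h ig fg; apply: le_trans (normc_cintegral h) _.
by apply: le_Rintegral => //; exact: cintegrable_norm.
Qed.

Lemma cdominated_cvg (f_ : nat -> T -> R[i]) f g :
  (forall n, cmeasurable D (f_ n)) -> cmeasurable D f ->
  mu.-integrable D (EFin \o g) ->
  (forall x, D x -> ccvg \oo (fun n => f_ n x) (f x)) ->
  (forall n x, D x -> normc (f_ n x) <= g x) ->
  cintegrable mu D f /\
  ccvg \oo (fun n => cintegral mu D (f_ n)) (cintegral mu D f).
Proof.
move=> mf_ mf ig cf fg.
(* Any projection dominated by the modulus inherits the majorant [g]; taking [Re] and then [Im] for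
   [p] gives both components. *)
have main (p : R[i] -> R) : (forall z, `|p z| <= normc z) ->
    (forall n, measurable_fun D (fun x => p (f_ n x))) ->
    measurable_fun D (fun x => p (f x)) ->
    (forall x, D x -> p (f_ n x) @[n --> \oo] --> p (f x)) ->
    mu.-integrable D (fun x => (p (f x))%:E) /\
    Rintegral mu D (fun x => p (f_ n x)) @[n --> \oo] -->
      Rintegral mu D (fun x => p (f x)).
  move=> pn m1 m2 c.
  have [|||||i _ cI] := @dominated_convergence _ _ _ mu D mD
    (fun n x => (p (f_ n x))%:E) (fun x => (p (f x))%:E) (EFin \o g).
  - by move=> n; exact/measurable_EFinP.
  - exact/measurable_EFinP.
  - by apply: aeW => x Dx; apply: cvg_EFin; [exact: nearW|exact: c].
  - exact: ig.
  - by apply: aeW => x n Dx; rewrite lee_fin (le_trans (pn _))// fg.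
  split => //; apply: fine_cvg; move: cI.
  by rewrite fineK//; exact: integrable_fin_num.
have [i1 c1] := main _ (@normc_Re R) (fun n => (mf_ n).1) mf.1 (fun x Dx => (cf x Dx).1).
have [i2 c2] := main _ (@normc_Im R) (fun n => (mf_ n).2) mf.2 (fun x Dx => (cf x Dx).2).
by split; split.
Qed.

End ComplexIntegral.

Section ComplexIntegralSets.
Context {R : realType} {d : measure_display} {T : measurableType d}.
Variables (mu : {measure set T -> \bar R}).
Implicit Types (f : T -> R[i]) (g : T -> R) (D E : set T).

Lemma cintegrableS D E f : measurable D -> measurable E -> E `<=` D ->
  cintegrable mu D f -> cintegrable mu E f.
Proof. by move=> mD mE ED [h1 h2]; split; exact: integrableS ED _. Qed.

Lemma cintegralU D E f : measurable D -> measurable E -> [disjoint D & E] ->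
  cintegrable mu (D `|` E) f ->
  cintegral mu (D `|` E) f = cintegral mu D f + cintegral mu E f.
Proof.
move=> mD mE dis [h1 h2]; apply: complex_eqP; rewrite ?ReD ?ImD/=;
exact: Rintegral_setU.
Qed.

Lemma cintegral_mkcond D f :
  cintegral mu D f = cintegral mu setT (fun x => (\1_D x)%:C * f x).
Proof.
congr Complex; rewrite Rintegral_mkcond; apply: eq_Rintegral => x _;
rewrite patchE indicE ?ReMr ?ImMr; case: ifP => _; by rewrite ?mul1r ?mul0r.
Qed.

Lemma cintegrable_mkcond D f : measurable D ->
  cintegrable mu D f <-> cintegrable mu setT (fun x => (\1_D x)%:C * f x).
Proof.
move=> mD.
have main (h : T -> R) : mu.-integrable D (EFin \o h) <->
    mu.-integrable setT (fun x => (\1_D x * h x)%:E).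
  rewrite integrable_mkcond//; suff -> : (EFin \o h) \_ D = (fun x => (\1_D x * h x)%:E) by [].
  by apply/funext => x; rewrite patchE indicE; case: ifP => _ /=;
    rewrite ?mul1r ?mul0r.
split=> [[/main h1 /main h2]|[h1 h2]]; split.
- by under eq_fun do rewrite ReMr.
- by under eq_fun do rewrite ImMr.
- by apply/main; apply: eq_integrable h1 => // x _; rewrite ReMr.
- by apply/main; apply: eq_integrable h2 => // x _; rewrite ImMr.
Qed.

(** Overlaps are harmless: the function cut to the union is bounded by the sum of the two cut
    moduli. *)
Lemma cintegrableU D E f : measurable D -> measurable E ->
  cintegrable mu D f -> cintegrable mu E f -> cintegrable mu (D `|` E) f.
Proof.
move=> mD mE hD hE; have mU := measurableU _ _ mD mE.
apply/(cintegrable_mkcond f mU).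
have /(cintegrable_mkcond f mD)/cintegrable_norm iD := hD.
have /(cintegrable_mkcond f mE)/cintegrable_norm iE := hE.
have [d1 d2] := cintegrable_measurable hD.
have [e1 e2] := cintegrable_measurable hE.
have mf : cmeasurable (D `|` E) f by split; exact/measurable_funU.
have r : cmeasurable setT (fun x => (\1_(D `|` E) x)%:C * f x).
  have e (p : T -> R) : (fun x => \1_(D `|` E) x * p x) = p \_ (D `|` E).
    by apply/funext => x; rewrite patchE indicE; case: ifP => _; rewrite ?mul1r ?mul0r.
  split; [under eq_fun do rewrite ReMr|under eq_fun do rewrite ImMr];
  by rewrite e; apply/(measurable_restrictT _ mU); exact: mf.1 || exact: mf.2.
apply: (cintegrable_dom measurableT _ (integrableD measurableT (iD measurableT) (iE measurableT))).
  exact: r.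
move=> x _ /=; rewrite !indicE in_setU.
case: (x \in D); case: (x \in E); rewrite ?mul1r ?mul0r ?Normc.normc0 ?addr0 ?add0r//.
by rewrite lerDl normc_ge0.
Qed.

(** The functions cut to [F n] are dominated by [normc (f x)], so it is enough that each point of
    [D] lies in [F n] for all large [n]; the sets themselves may fail to increase. *)
Lemma cintegral_bigcup_cvg (F : nat -> set T) D f :
  (forall n, measurable (F n)) -> measurable D ->
  (forall n, F n `<=` D) ->
  (forall x, D x -> \forall n \near \oo, F n x) ->
  cintegrable mu D f ->
  ccvg \oo (fun n => cintegral mu (F n) f) (cintegral mu D f).
Proof.
move=> mF mD FD DF hf.
have e n : cintegral mu (F n) f = cintegral mu D (fun x => (\1_(F n) x)%:C * f x).
  rewrite cintegral_mkcond [RHS]cintegral_mkcond; apply: eq_cintegral => x _.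
  rewrite mulrA -rmorphM/= !indicE.
  case: (boolP (x \in F n)) => [/set_mem Fx|_]; last by rewrite mulr0.
  by rewrite mem_set ?mulr1//; exact: FD Fx.
under [X in ccvg _ X]eq_fun do rewrite e.
apply: (proj2 (@cdominated_cvg _ _ _ _ _ mD _ _ (fun x => normc (f x)) _ _ _ _ _)).
- move=> n; apply: cmeasurableM; last exact: cintegrable_measurable hf.
  exact/cmeasurable_real/measurable_indic.
- exact: cintegrable_measurable hf.
- exact: cintegrable_norm.
- move=> x Dx; apply/ccvgP; apply: cvg_near_cst.
  near=> n; rewrite indicE mem_set; last by near: n; exact: DF.
  by rewrite mul1r subrr Normc.normc0.
- move=> n x Dx; rewrite normc_mulM normc_real -[leRHS]mul1r.
  by rewrite ler_wpM2r ?normc_ge0// indicE; case: (x \in _); rewrite ?normr1 ?normr0.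
Unshelve. all: by end_near. Qed.

(** Monotone convergence, for the cases where no majorant is known beforehand: a uniform bound along
    an exhausting sequence is what a primitive or an a priori estimate provides. *)
Lemma integrable_bigcup_le (F : nat -> set T) D g (M : R) :
  (forall n, measurable (F n)) -> measurable D -> nondecreasing_seq F ->
  D = \bigcup_n F n -> measurable_fun D g -> (forall x, D x -> 0 <= g x) ->
  (forall n, (\int[mu]_(x in F n) (g x)%:E <= M%:E)%E) ->
  mu.-integrable D (EFin \o g).
Proof.
move=> mF mD ndF DE mg g0 hM; apply/integrableP; split; first exact/measurable_EFinP.
have FD n : F n `<=` D by rewrite DE => x Fx; exists n.
have -> : (\int[mu]_(x in D) `|(EFin \o g) x| = \int[mu]_(x in \bigcup_n F n) (g x)%:E)%E.
  rewrite -DE; apply: eq_integral => x /set_mem Dx /=; rewrite ger0_norm//.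
  exact: g0.
have c : (\int[mu]_(x in F n) (g x)%:E @[n --> \oo] -->
    \int[mu]_(x in \bigcup_n F n) (g x)%:E)%E.
  apply: ge0_nondecreasing_set_cvg_integral => //.
  - by move=> n; apply/measurable_EFinP; exact: measurable_funS (FD n) mg.
  - by move=> n x Fx; rewrite lee_fin g0//; exact: FD Fx.
rewrite -(cvg_lim _ c)//; apply: (@le_lt_trans _ _ M%:E); last exact: ltry.
by apply: lime_le; [exact: cvgP c|exact: nearW].
Qed.

End ComplexIntegralSets.

(** * Exchange of integrals *)

Section Fubini.
Context {R : realType} {d1 d2 : measure_display} {T1 : measurableType d1}
  {T2 : measurableType d2}.
Variables (m1 : {sigma_finite_measure set T1 -> \bar R})
  (m2 : {sigma_finite_measure set T2 -> \bar R}).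

Lemma Rfubini (f : T1 * T2 -> R) :
  (m1 \x m2)%E.-integrable setT (EFin \o f) ->
  [/\ m1.-integrable setT (fun x => (Rintegral m2 setT (fun y => f (x, y)))%:E),
      m2.-integrable setT (fun y => (Rintegral m1 setT (fun x => f (x, y)))%:E),
      Rintegral m1 setT (fun x => Rintegral m2 setT (fun y => f (x, y))) =
        Rintegral (m1 \x m2)%E setT f &
      Rintegral m2 setT (fun y => Rintegral m1 setT (fun x => f (x, y))) =
        Rintegral (m1 \x m2)%E setT f].
Proof.
move=> hf.
(* The inner integral is finite only for almost every point. Replacing it by its [fine] part, which
   sends infinite values to 0, changes neither integrability nor the outer integral. *)
have aux d (T : measurableType d) (m : {measure set T -> \bar R}) (F : T -> \bar R) :
    m.-integrable setT F -> m.-integrable setT (fun x => (fine (F x))%:E) /\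
    (\int[m]_x (fine (F x))%:E = \int[m]_x F x)%E.
  move=> iF; have mF := measurable_int _ iF.
  have mfF : measurable_fun setT (fun x => (fine (F x))%:E).
    by apply/measurable_EFinP; exact: measurableT_comp.
  have le x : (`|(fine (F x))%:E| <= `|F x|)%E by case: (F x) => [r| |] /=; rewrite ?lexx ?normr0 ?leey.
  split; first by apply: le_integrable iF => // x _.
  apply: ae_eq_integral => //; have := integrable_ae measurableT iF.
  by apply: filterS => x h _; rewrite fineK//; exact: h.
have i1 := integrable_fubini_F hf.
(* For the other order, integrability of the inner integral follows from Tonelli applied to the
   absolute value. *)
have i2 : m2.-integrable setT (fun y => \int[m1]_x (f (x, y))%:E)%E.
  have mG := measurable_fubini_G hf; have mf := measurable_int _ hf.
  apply/integrableP; split => //.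
  have /integrable21ltyP := hf; move=> /(_ (measurable_int _ hf)).
  apply: le_lt_trans; apply: ge0_le_integral => //.
  - exact: measurableT_comp.
  - apply: (measurable_fun_fubini_tonelli_G (fun z => `|(EFin \o f) z|%E)) => //.
    exact: measurableT_comp.
  - move=> y _; apply: le_abse_integral => //.
    exact: (measurableT_comp mf (pair2_measurable y)).
have [j1 e1] := aux _ _ _ _ i1.
have [j2 e2] := aux _ _ _ _ i2.
split => //; rewrite /Rintegral.
- exact: (congr1 fine (etrans e1 (integral12_prod_meas1 hf))).
- exact: (congr1 fine (etrans e2 (integral21_prod_meas1 hf))).
Qed.

Lemma cfubini (f : T1 * T2 -> R[i]) : cintegrable (m1 \x m2)%E setT f ->
  [/\ cintegrable m1 setT (fun x => cintegral m2 setT (fun y => f (x, y))),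
      cintegrable m2 setT (fun y => cintegral m1 setT (fun x => f (x, y))),
      cintegral m1 setT (fun x => cintegral m2 setT (fun y => f (x, y))) =
        cintegral (m1 \x m2)%E setT f &
      cintegral m2 setT (fun y => cintegral m1 setT (fun x => f (x, y))) =
        cintegral (m1 \x m2)%E setT f].
Proof.
move=> [/Rfubini[a1 a2 a3 a4] /Rfubini[b1 b2 b3 b4]]; split.
- by split.
- by split.
- by congr Complex.
- by congr Complex.
Qed.

Lemma integrable_prodM (g1 : T1 -> R) (g2 : T2 -> R) :
  m1.-integrable setT (EFin \o g1) -> m2.-integrable setT (EFin \o g2) ->
  (m1 \x m2)%E.-integrable setT (fun p => (g1 p.1 * g2 p.2)%:E).
Proof.
move=> i1 i2.
have n1 := integrable_norm i1; have n2 := integrable_norm i2.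
have mg1 : measurable_fun setT g1 by exact/measurable_EFinP/(measurable_int _ i1).
have mg2 : measurable_fun setT g2 by exact/measurable_EFinP/(measurable_int _ i2).
have mf : measurable_fun setT (fun p : T1 * T2 => (g1 p.1 * g2 p.2)%:E).
  apply/measurable_EFinP; apply: measurable_funM.
    exact: (measurableT_comp mg1).
  exact: (measurableT_comp mg2).
apply/integrable12ltyP => //.
have -> : (fun x => \int[m2]_y `|(g1 (x, y).1 * g2 (x, y).2)%:E|)%E =
    (fun x => `|g1 x|%:E * \int[m2]_y `|g2 y|%:E)%E.
  apply/funext => x; rewrite -ge0_integralZl//.
    by apply: eq_integral => y _; rewrite /= normrM EFinM.
  exact: (measurable_int _ n2).
rewrite ge0_integralZr//; last 2 first.
- exact: (measurable_int _ n1).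
- exact: integral_ge0.
rewrite lte_mul_pinfty//.
- exact: integral_ge0.
- exact: (integrable_fin_num measurableT n1).
- exact: (integrable_lty measurableT n2).
Qed.

(** Most exchanges of integrals below have a kernel bounded by a product of integrable functions of
    one variable; this form spares a discussion of integrability on the product each time.
    Restriction to [D1] and [D2] is carried by indicators. *)
Lemma cfubini_set D1 D2 (f : T1 -> T2 -> R[i]) (g1 : T1 -> R) (g2 : T2 -> R) :
  measurable D1 -> measurable D2 ->
  cmeasurable setT (fun p : T1 * T2 => f p.1 p.2) ->
  m1.-integrable D1 (EFin \o g1) -> m2.-integrable D2 (EFin \o g2) ->
  (forall x y, D1 x -> D2 y -> normc (f x y) <= g1 x * g2 y) ->
  [/\ cintegrable m1 D1 (fun x => cintegral m2 D2 (fun y => f x y)),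
      cintegrable m2 D2 (fun y => cintegral m1 D1 (fun x => f x y)) &
  cintegral m1 D1 (fun x => cintegral m2 D2 (fun y => f x y)) =
  cintegral m2 D2 (fun y => cintegral m1 D1 (fun x => f x y))].
Proof.
move=> mD1 mD2 mf i1 i2 fg.
pose F p := (\1_D1 p.1)%:C * (\1_D2 p.2)%:C * f p.1 p.2.
have ind d (T : measurableType d) (m : {measure set T -> \bar R}) D (g : T -> R) :
    measurable D -> m.-integrable D (EFin \o g) ->
    m.-integrable setT (fun x => (\1_D x * g x)%:E).
  move=> mD; rewrite integrable_mkcond//.
  suff -> : (EFin \o g) \_ D = (fun x => (\1_D x * g x)%:E) by [].
  by apply/funext => x; rewrite patchE indicE; case: ifP => _ /=;
    rewrite ?mul1r ?mul0r.
have iF : cintegrable (m1 \x m2)%E setT F.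
  apply: (cintegrable_dom measurableT _
    (integrable_prodM (ind _ _ _ _ _ mD1 i1) (ind _ _ _ _ _ mD2 i2))).
    apply: cmeasurableM => //; apply: cmeasurableM; apply: cmeasurable_real.
      exact: (measurableT_comp (measurable_indic _)).
    exact: (measurableT_comp (measurable_indic _)).
  move=> [x y] _ /=; rewrite /F/= !indicE.
  case: (boolP (x \in D1)) => [/set_mem xD|_]; last first.
    by rewrite !mul0r Normc.normc0.
  case: (boolP (y \in D2)) => [/set_mem yD|_]; last first.
    by rewrite !(mul0r, mulr0) Normc.normc0.
  by rewrite !mul1r; exact: fg.
have h1 x : cintegral m2 setT (fun y => F (x, y)) =
    (\1_D1 x)%:C * cintegral m2 D2 (fun y => f x y).
  rewrite indicE; case: (boolP (x \in D1)) => xD; last first.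
    rewrite mul0r -[RHS](cintegral0 m2 setT); apply: eq_cintegral => y _.
    by rewrite /F/= indicE (negbTE xD) !mul0r.
  rewrite mul1r [RHS]cintegral_mkcond; apply: eq_cintegral => y _.
  by rewrite /F/= indicE xD !mul1r.
have h2 y : cintegral m1 setT (fun x => F (x, y)) =
    (\1_D2 y)%:C * cintegral m1 D1 (fun x => f x y).
  rewrite indicE; case: (boolP (y \in D2)) => yD; last first.
    rewrite mul0r -[RHS](cintegral0 m1 setT); apply: eq_cintegral => x _.
    by rewrite /F/= [\1_D2 _]indicE (negbTE yD) mulr0 !mul0r.
  rewrite mul1r [RHS]cintegral_mkcond; apply: eq_cintegral => x _.
  by rewrite /F/= [\1_D2 _]indicE yD mulr1.
have [a1 a2 a3 a4] := cfubini iF.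
split.
- by apply/cintegrable_mkcond => //; apply: eq_cintegrable a1.
- by apply/cintegrable_mkcond => //; apply: eq_cintegrable a2.
rewrite cintegral_mkcond [RHS]cintegral_mkcond.
transitivity (cintegral m1 setT (fun x => cintegral m2 setT (fun y => F (x, y)))).
  by apply: eq_cintegral.
by rewrite a3 -a4; apply: eq_cintegral.
Qed.

End Fubini.

(** * Improper integrals from primitives *)

Section FundamentalTheorem.
Context {R : realType}.
Local Notation mu := (@lebesgue_measure R).
Implicit Types (F f : R -> R[i]) (P p : R -> R) (a b x : R).

Lemma continuous_on_within p a b :
  (forall x, a <= x <= b -> {for x, continuous p}) ->
  {within `[a, b], continuous p}.
Proof. by move=> h; apply: continuous_in_subspaceT => x /set_mem/= /h. Qed.

Lemma integrable_continuous p a b :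
  (forall x, a <= x <= b -> {for x, continuous p}) ->
  mu.-integrable `[a, b] (EFin \o p).
Proof.
move=> h; apply: continuous_compact_integrable; first exact: segment_compact.
exact: continuous_on_within.
Qed.

Lemma Rintegral_FTC2 P p a b : a <= b ->
  (forall x, a <= x <= b -> is_derive x (1 : R) P (p x)) ->
  (forall x, a <= x <= b -> {for x, continuous p}) ->
  Rintegral mu `[a, b] p = P b - P a.
Proof.
rewrite le_eqVlt => /orP[/eqP<-|ab] dP cp.
  by rewrite set_itv1 Rintegral_set1 subrr.
have cP x : a <= x <= b -> {for x, continuous P}.
  by move=> xab; exact: is_derive_continuous (dP _ xab).
rewrite /Rintegral (@continuous_FTC2 _ p P a b)//.
- exact: continuous_on_within.
- split.
  + by move=> x; rewrite in_itv/= => /andP[ax xb]; have [|] := dP x; rewrite ?(ltW ax) ?(ltW xb)//.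
  + by apply: cvg_at_right_filter; apply: cP; rewrite lexx ltW.
  + by apply: cvg_at_left_filter; apply: cP; rewrite lexx ltW.
- move=> x; rewrite in_itv/= => /andP[ax xb]; rewrite derive1E.
  by have [|_ ->] := dP x; rewrite ?(ltW ax) ?(ltW xb)//.
Qed.

Lemma cintegrable_continuous f a b :
  (forall x, a <= x <= b -> exists l, cderiv f x l) ->
  cintegrable mu `[a, b] f.
Proof.
by move=> h; split; apply: integrable_continuous => x /h [l] /cderiv_continuous[].
Qed.

Lemma cintegral_FTC2 F f a b : a <= b ->
  (forall x, a <= x <= b -> cderiv F x (f x)) ->
  (forall x, a <= x <= b -> exists l, cderiv f x l) ->
  cintegral mu `[a, b] f = F b - F a.
Proof.
move=> ab dF cf; apply: complex_eqP; rewrite ?ReB ?ImB/=.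
  apply: (@Rintegral_FTC2 (fun t => Re (F t))) => // x /[dup] h /cf [l].
    by move=> _; exact: (dF _ h).1.
  by move=> /cderiv_continuous[].
apply: (@Rintegral_FTC2 (fun t => Im (F t))) => // x /[dup] h /cf [l].
  by move=> _; exact: (dF _ h).2.
by move=> /cderiv_continuous[].
Qed.

(** [D] is exhausted from inside by intervals on which the primitive is differentiable up to the
    ends. They are half-open so as to cover both []0, x]], where [b n] stays at [x], and []x, +oo[],
    where [a n] decreases to [x] without reaching it. *)
Lemma cintegral_FTC_lim (D : set R) (a b : nat -> R) F f l :
  measurable D -> (forall n, a n <= b n) ->
  (forall n x, a n < x <= b n -> D x) ->
  (forall x, D x -> \forall n \near \oo, a n < x <= b n) ->
  (forall n x, a n <= x <= b n -> cderiv F x (f x)) ->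
  (forall n x, a n <= x <= b n -> exists l, cderiv f x l) ->
  cintegrable mu D f ->
  ccvg \oo (fun n => F (b n) - F (a n)) l -> cintegral mu D f = l.
Proof.
move=> mD ab abD Dab dF cf hf hl.
have abD' n : `]a n, b n] `<=` D.
  by move=> x /=; rewrite in_itv/=; exact: abD.
have h := @cintegral_bigcup_cvg _ _ _ mu (fun n => `]a n, b n]%classic) D f
  (fun n => measurable_itv _) mD abD' _ hf.
apply: ccvg_unique (h _) _.
  by move=> x /Dab; apply: filterS => n; rewrite /= in_itv.
have e n : cintegral mu `]a n, b n] f = F (b n) - F (a n).
  have [h1 h2] := cintegrable_continuous (@cf n).
  rewrite -(cintegral_FTC2 (ab n) (@dF n) (@cf n)).
  have sub : `]a n, b n]%classic `<=` `[a n, b n]%classic.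
    exact: subset_itv_oc_cc.
  congr Complex; apply: Rintegral_itv_obnd_cbnd.
    by apply: (@integrableS _ _ _ mu `[a n, b n]%classic) => //.
  by apply: (@integrableS _ _ _ mu `[a n, b n]%classic) => //.
by under [X in ccvg _ X]eq_fun do rewrite e.
Qed.

(** Increments of the primitive are the integrals over the exhausting intervals, so a bound on them
    feeds [integrable_bigcup_le]. It supplies the integrability that [cintegral_FTC_lim]
    presupposes. *)
Lemma Rintegral_FTC_lim (D : set R) (a b : nat -> R) P p (M : R) :
  measurable D -> (forall n, a n <= b n) ->
  (forall n, a n.+1 <= a n) -> (forall n, b n <= b n.+1) ->
  (forall n x, a n < x <= b n -> D x) ->
  (forall x, D x -> \forall n \near \oo, a n < x <= b n) ->
  (forall n x, a n <= x <= b n -> is_derive x (1 : R) P (p x)) ->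
  (forall n x, a n <= x <= b n -> {for x, continuous p}) ->
  (forall n x, a n <= x <= b n -> 0 <= p x) ->
  (forall n, P (b n) - P (a n) <= M) ->
  mu.-integrable D (EFin \o p).
Proof.
move=> mD ab da db abD Dab dP cp p0 hM.
have DE : D = \bigcup_n (`]a n, b n]%classic).
  apply/seteqP; split => [x /Dab|x [n _]]/=; last by rewrite in_itv/=; exact: abD.
  by move=> /filter_ex[n h]; exists n; rewrite //= in_itv.
have nd : nondecreasing_seq (fun n => `]a n, b n]%classic).
  apply/nondecreasing_seqP => n; rewrite subsetEset => x /=; rewrite !in_itv/=.
  by move=> /andP[h1 h2]; rewrite (le_lt_trans (da n) h1) (le_trans h2 (db n)).
have mp n : measurable_fun `]a n, b n]%classic p.
  apply: (@measurable_funS _ _ _ _ `[a n, b n]%classic) => //.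
    exact: subset_itv_oc_cc.
  apply/measurable_EFinP.
  exact: (measurable_int mu (integrable_continuous (cp n))).
have mU := proj2 (measurable_fun_bigcup p (fun n => @measurable_itv R `]a n, b n])) mp.
apply: (@integrable_bigcup_le _ _ _ mu (fun n => `]a n, b n]%classic) D p M
  (fun n => measurable_itv _) mD nd DE) => //.
- by rewrite DE; exact: mU.
- move=> x; rewrite DE => -[n _]/=; rewrite in_itv/= => /andP[h1 h2].
  by apply: (p0 n); rewrite h2 ltW.
- move=> n; apply: (@le_trans _ _ (\int[mu]_(x in `[a n, b n]) (p x)%:E)%E).
    apply: ge0_subset_integral => //.
    + exact: (measurable_int mu (integrable_continuous (cp n))).
    + by move=> x /=; rewrite in_itv/= => h; rewrite lee_fin; exact: p0 h.
    + exact: subset_itv_oc_cc.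
  have i := integrable_continuous (cp n).
  rewrite -[leLHS]fineK; last exact: integrable_fin_num i.
  by rewrite lee_fin; have := Rintegral_FTC2 (ab n) (dP n) (cp n);
    rewrite /Rintegral => ->.
Qed.

End FundamentalTheorem.

(** * Integrals of complex powers near 0 and at infinity *)

Section PowerIntegrals.
Context {R : realType}.
Local Notation mu := (@lebesgue_measure R).
Implicit Types (x p t : R) (z : R[i]) (n : nat).

(** Starting at 1/2 keeps every term strictly inside the unit interval, so that [x * hseq n < x] and
    [1 + hseq n <= 2 <= (hseq n)^-1] hold for each [n], the first included. *)
Definition hseq n : R := n.+2%:R^-1.

Lemma hseq_gt0 n : 0 < hseq n. Proof. by rewrite invr_gt0 ltr0n. Qed.
Lemma hseq_lt1 n : hseq n < 1.
Proof. by rewrite invf_lt1 ?ltr0n// ltr1n. Qed.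

Lemma hseq_dec n : hseq n.+1 <= hseq n.
Proof. by rewrite lef_pV2 ?posrE ?ltr0n// ler_nat. Qed.
Lemma cvg_hseq : hseq n @[n --> \oo] --> (0 : R).
Proof.
have := @cvg_harmonic R; rewrite -(cvg_shiftS (@harmonic R)); exact.
Qed.
Lemma near_hseq e : 0 < e -> \forall n \near \oo, hseq n < e.
Proof. by move=> e0; exact: cvgr_lt _ cvg_hseq _ e0. Qed.
Lemma cvg_hseq_pow p : 0 < p -> hseq n `^ p @[n --> \oo] --> (0 : R).
Proof.
move=> p0; have /cvg_at_rightP := powR_cvg0 p0; apply; split.
  exact: hseq_gt0.
exact: cvg_hseq.
Qed.

(** A power beats the logarithm: apply ln u < u to u = h^(-p/2), where h is [hseq n], and spend half
    of the exponent [p]. It kills the boundary term at 0 of a logarithmic primitive. *)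
Lemma hseq_ln p n : 0 < p ->
  hseq n `^ p * ln (hseq n)^-1 <= (2 / p) * hseq n `^ (p / 2).
Proof.
move=> p0; have h0 := hseq_gt0 n; have p2 : 0 < p / 2 by rewrite divr_gt0.
have h : ln ((hseq n)^-1 `^ (p / 2)) < (hseq n)^-1 `^ (p / 2).
  by apply: ln_sublinear; rewrite powR_gt0// invr_gt0.
rewrite ln_powR in h.
have e : (hseq n)^-1 `^ (p / 2) = (hseq n `^ (p / 2))^-1.
  by rewrite -[in LHS]powR_inv1 ?ltW// -powRrM mulN1r powRN.
rewrite e in h; have e2 : hseq n `^ p = hseq n `^ (p / 2) * hseq n `^ (p / 2).
  by rewrite -powRD ?(gt_eqF h0) ?implybT// -splitr.
have q0 : 0 < hseq n `^ (p / 2) by rewrite powR_gt0.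
rewrite e2; move: h q0; set q := _ `^ _; set L := ln _ => h q0.
have : L < 2 / p * q^-1.
  by rewrite -(ltr_pM2l p2) mulrA (_ : p / 2 * (2 / p) = 1) ?mul1r//; field; rewrite gt_eqF.
move=> /ltW hL; rewrite -mulrA; apply: (le_trans (ler_wpM2l (ltW q0) (ler_wpM2l (ltW q0) hL))).
rewrite (_ : q * (q * _) = 2 / p * q)//; field; rewrite !gt_eqF//.
Qed.

Lemma continuous_powRl p x : 0 < x -> {for x, continuous (fun t => t `^ p)}.
Proof. by move=> x0; exact: is_derive_continuous (is_derive1_powR p x0). Qed.

Lemma is_derive_powR_div p x : 0 < x -> p != 0 ->
  is_derive x (1 : R) (fun t => t `^ p / p) (x `^ (p - 1)).
Proof.
move=> x0 p0.
have h := is_derive_mul (is_derive1_powR p x0) (is_derive_cst p^-1 x (1 : R)).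
apply: (is_derive_eqv h) => //=.
by rewrite mulr0 addr0 mulrC mulrA mulVf ?mul1r.
Qed.

Lemma near_hseq_low x t : 0 < x -> 0 < t -> t <= x ->
  \forall n \near \oo, x * hseq n < t <= x.
Proof.
move=> x0 t0 tx; have := near_hseq (divr_gt0 t0 x0); apply: filterS => n.
by rewrite ltr_pdivlMr// mulrC tx andbT.
Qed.

Lemma near_hseq_high x t : 0 < x -> x < t ->
  \forall n \near \oo, x * (1 + hseq n) < t <= x * (hseq n)^-1.
Proof.
move=> x0 xt; have t0 : 0 < t := lt_trans x0 xt.
have h1 : 0 < t / x - 1 by rewrite subr_gt0 ltr_pdivlMr// mul1r.
near=> n.
have h2 : hseq n < t / x - 1 by near: n; exact: near_hseq.
have h3 : hseq n < x / t by near: n; apply: near_hseq; rewrite divr_gt0.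
apply/andP; split; first by rewrite mulrC -ltr_pdivlMr// addrC -ltrBrDr.
by rewrite ler_pdivlMr ?hseq_gt0// mulrC -ler_pdivlMr// ltW.
Unshelve. all: by end_near. Qed.

Lemma hseq_high_le x n : 0 < x -> x * (1 + hseq n) <= x * (hseq n)^-1.
Proof.
move=> x0; rewrite ler_pM2l//; apply: (@le_trans _ _ 2).
  by rewrite -[2]/(1 + 1)%R lerD2l ltW// hseq_lt1.
by rewrite /hseq invrK ler_nat.
Qed.

Lemma hseq_high_dec x n : 0 < x -> x * (1 + hseq n.+1) <= x * (1 + hseq n).
Proof. by move=> x0; rewrite ler_pM2l// lerD2l hseq_dec. Qed.

Lemma hseq_high_inc x n : 0 < x -> x * (hseq n)^-1 <= x * (hseq n.+1)^-1.
Proof. by move=> x0; rewrite ler_pM2l// lef_pV2 ?posrE ?hseq_gt0// hseq_dec. Qed.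

Lemma integrable_powR_low p x : 0 < x -> 0 < p ->
  mu.-integrable `]0, x] (fun t => (t `^ (p - 1))%:E).
Proof.
move=> x0 p0; have p1 := lt0r_neq0 p0.
have h0 n : 0 < x * hseq n by rewrite mulr_gt0// hseq_gt0.
apply: (@Rintegral_FTC_lim _ _ (fun n => x * hseq n) (fun=> x)
    (fun t => t `^ p / p) _ (x `^ p / p)) => //.
- by move=> n; rewrite -[leRHS]mulr1 ler_pM2l// ltW ?hseq_lt1.
- by move=> n; rewrite ler_pM2l// hseq_dec.
- by move=> n t /andP[h1 h2] /=; rewrite in_itv/= h2 (lt_trans (h0 n) h1).
- by move=> t /=; rewrite in_itv/= => /andP[t0 tx]; exact: near_hseq_low.
- move=> n t /andP[h1 _]; apply: is_derive_powR_div => //.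
  exact: lt_le_trans (h0 n) h1.
- move=> n t /andP[h1 _]; apply: continuous_powRl.
  exact: lt_le_trans (h0 n) h1.
- by move=> n t _; exact: powR_ge0.
- by move=> n; rewrite lerBlDr lerDl divr_ge0 ?powR_ge0// ltW.
Qed.

Lemma integrable_powR_high p x : 0 < x -> 0 < p ->
  mu.-integrable `]x, +oo[ (fun t => (t `^ (- p - 1))%:E).
Proof.
move=> x0 p0; have p1 : - p != 0 by rewrite oppr_eq0 lt0r_neq0.
have h0 n : 0 < x * (1 + hseq n) by rewrite mulr_gt0// addr_gt0// hseq_gt0.
have h1 n t : x * (1 + hseq n) <= t -> x < t.
  by apply: lt_le_trans; rewrite -[ltLHS]mulr1 ltr_pM2l// ltrDl hseq_gt0.
apply: (@Rintegral_FTC_lim _ _ (fun n => x * (1 + hseq n))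
    (fun n => x * (hseq n)^-1) (fun t => t `^ (- p) / (- p)) _
    (x `^ (- p) / p)) => //.
- by move=> n; exact: hseq_high_le.
- by move=> n; exact: hseq_high_dec.
- by move=> n; exact: hseq_high_inc.
- by move=> n t /andP[h _] /=; rewrite in_itv/= andbT (h1 n)// ltW.
- by move=> t /=; rewrite in_itv/= andbT => xt; exact: near_hseq_high.
- move=> n t /andP[h _]; apply: is_derive_powR_div => //.
  exact: lt_le_trans (h0 n) h.
- move=> n t /andP[h _]; apply: continuous_powRl.
  exact: lt_le_trans (h0 n) h.
- by move=> n t _; exact: powR_ge0.
- move=> n; rewrite invrN !mulrN opprK addrC lerBlDr.
  apply: (@le_trans _ _ (x `^ (- p) / p)); last first.
    by rewrite lerDl divr_ge0 ?powR_ge0// ltW.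
  apply: ler_wpM2r; first by rewrite invr_ge0 ltW.
  rewrite !powRN lef_pV2 ?posrE ?powR_gt0//.
  by apply: ge0_ler_powR; rewrite ?nnegrE ltW//; exact: h1 (lexx _).
Qed.

Lemma cderiv_cpow_div z t : 0 < t -> z != 0 ->
  cderiv (fun t => cpow t z / z) t (cpow t (z - 1)).
Proof.
move=> t0 z0; apply: cderiv_eq (cderivMr z^-1 (cderiv_cpow z t0)) _.
by rewrite mulrC mulrA mulVf ?mul1r.
Qed.

Lemma cpow_cvg0 z (u : nat -> R) : 0 < Re z -> (forall n, 0 < u n) ->
  u n @[n --> \oo] --> (0 : R) -> ccvg \oo (fun n => cpow (u n) z) 0.
Proof.
move=> z0 u0 cu; apply/ccvgP.
under eq_fun do rewrite subr0 normc_cpow//.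
have /cvg_at_rightP := powR_cvg0 z0; apply; split => //.
Qed.

Lemma cmeasurable_cpowl (D : set R) z : cmeasurable D (fun t => cpow t z).
Proof. by apply: cmeasurable_cpow; [exact: measurable_id|exact: cmeasurable_cst]. Qed.

Lemma Re_neq0 z : 0 < Re z -> z != 0.
Proof. by move=> h; apply/eqP => z0; rewrite z0 ltxx in h. Qed.

Lemma cintegral_cpow_low z x : 0 < x -> 0 < Re z ->
  cintegrable mu `]0, x] (fun t => cpow t (z - 1)) /\
  cintegral mu `]0, x] (fun t => cpow t (z - 1)) = cpow x z / z.
Proof.
move=> x0 z0; have z1 := Re_neq0 z0.
have h0 n : 0 < x * hseq n by rewrite mulr_gt0// hseq_gt0.
have i : cintegrable mu `]0, x] (fun t => cpow t (z - 1)).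
  apply: (cintegrable_dom _ _ (integrable_powR_low x0 z0)) => //.
    exact: cmeasurable_cpowl.
  move=> t Dt; rewrite normc_cpow ?ReB//.
  by move: Dt; rewrite /= in_itv/= => /andP[].
split => //.
apply: (@cintegral_FTC_lim _ _ (fun n => x * hseq n) (fun=> x)
  (fun t => cpow t z / z)) => //.
- by move=> n; rewrite -[leRHS]mulr1 ler_pM2l// ltW ?hseq_lt1.
- by move=> n t /andP[h1 h2] /=; rewrite in_itv/= h2 (lt_trans (h0 n) h1).
- by move=> t /=; rewrite in_itv/= => /andP[t0 tx]; exact: near_hseq_low.
- move=> n t /andP[h1 _]; apply: cderiv_cpow_div => //.
  exact: lt_le_trans (h0 n) h1.
- move=> n t /andP[h1 _]; eexists; apply: cderiv_cpow.
  exact: lt_le_trans (h0 n) h1.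
- rewrite -[X in ccvg _ _ X]subr0; apply: ccvgB; first exact: ccvg_cst.
  rewrite -(mul0r z^-1); apply: ccvgM; last exact: ccvg_cst.
  apply: cpow_cvg0 => //; rewrite -(mulr0 x); apply: cvgM; first exact: cvg_cst.
  exact: cvg_hseq.
Qed.

Lemma cintegral_cpow_high z x : 0 < x -> 0 < Re z ->
  cintegrable mu `]x, +oo[ (fun t => cpow t (- z - 1)) /\
  cintegral mu `]x, +oo[ (fun t => cpow t (- z - 1)) = cpow x (- z) / z.
Proof.
move=> x0 z0; have z1 : - z != 0 by rewrite oppr_eq0 Re_neq0.
have h0 n : 0 < x * (1 + hseq n) by rewrite mulr_gt0// addr_gt0// hseq_gt0.
have h1 n t : x * (1 + hseq n) <= t -> x < t.
  by apply: lt_le_trans; rewrite -[ltLHS]mulr1 ltr_pM2l// ltrDl hseq_gt0.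
have i : cintegrable mu `]x, +oo[ (fun t => cpow t (- z - 1)).
  apply: (cintegrable_dom _ _ (integrable_powR_high x0 z0)) => //.
    exact: cmeasurable_cpowl.
  move=> t Dt; rewrite normc_cpow ?ReB ?ReN//.
  by move: Dt; rewrite /= in_itv/= andbT; exact: lt_trans.
split => //.
apply: (@cintegral_FTC_lim _ _ (fun n => x * (1 + hseq n))
    (fun n => x * (hseq n)^-1) (fun t => cpow t (- z) / (- z))) => //.
- by move=> n; exact: hseq_high_le.
- by move=> n t /andP[h _] /=; rewrite in_itv/= andbT (h1 n)// ltW.
- by move=> t /=; rewrite in_itv/= andbT => xt; exact: near_hseq_high.
- move=> n t /andP[h _]; apply: cderiv_cpow_div => //.
  exact: lt_le_trans (h0 n) h.
- move=> n t /andP[h _]; eexists; apply: cderiv_cpow.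
  exact: lt_le_trans (h0 n) h.
- rewrite (_ : cpow x (- z) / z = 0 / (- z) - cpow x (- z) / (- z)); last first.
    by rewrite mul0r invrN mulrN sub0r opprK.
  apply: ccvgB; apply: ccvgM; try exact: ccvg_cst.
    (* Inverting the base turns the end at infinity into an end at 0, where [cpow_cvg0] applies. *)
    have e n : cpow (x * (hseq n)^-1) (- z) = cpow (x^-1 * hseq n) z.
      rewrite -cpowV ?mulr_gt0 ?invr_gt0 ?hseq_gt0//.
      by rewrite invfM invrK.
    under [X in ccvg _ X]eq_fun do rewrite e.
    apply: cpow_cvg0 => //; first by move=> n; rewrite mulr_gt0 ?invr_gt0 ?hseq_gt0.
    rewrite -(mulr0 x^-1); apply: cvgM; first exact: cvg_cst.
    exact: cvg_hseq.
  have [c1 c2] := cderiv_continuous (cderiv_cpow (- z) x0).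
  have cx : x * (1 + hseq n) @[n --> \oo] --> x.
    rewrite -[X in _ --> X]mulr1; apply: cvgM; first exact: cvg_cst.
    rewrite -[X in _ --> X]addr0; apply: cvgD; first exact: cvg_cst.
    exact: cvg_hseq.
  by split; [exact: (cvg_comp _ _ cx c1)|exact: (cvg_comp _ _ cx c2)].
Qed.

End PowerIntegrals.

(** * Partial fractions of the cotangent *)

Section Cotangent.
Context {R : realType}.
Implicit Types (a z w s : R[i]) (x y : R) (n k M : nat).
Local Notation Pi := (pi : R).

Lemma csinDpihalf a : csin (a + (pi / 2)%:C) = ccos a.
Proof.
by rewrite csinD csin_real ccos_real sin_pihalf cos_pihalf mulr0 add0r mulr1.
Qed.
Lemma ccosDpihalf a : ccos (a + (pi / 2)%:C) = - csin a.
Proof.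
by rewrite ccosD csin_real ccos_real sin_pihalf cos_pihalf mulr0 sub0r mulr1.
Qed.
Lemma ccotDpi a : ccot (a + Pi%:C) = ccot a.
Proof.
rewrite /ccot csinD ccosD csin_real ccos_real sinpi cospi !mulr0 addr0 subr0.
by rewrite -[_%:C]/(- 1)%:C rmorphN rmorph1 !mulrN1 mulNr invrN mulrN opprK.
Qed.

(** The shift by pi / 2 turns the cotangent into minus the tangent, and cot - tan doubles the angle.
    Iterated, this produces the partial fraction expansion without contour integrals. *)
Lemma ccot_double a : csin a != 0 -> ccos a != 0 ->
  ccot a + ccot (a + (pi / 2)%:C) = 2 * ccot (2 * a).
Proof.
move=> s0 c0; rewrite /ccot csinDpihalf ccosDpihalf.
rewrite (_ : 2 * a = a + a); last by rewrite mulr_natl mulr2n.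
rewrite csinD ccosD; field.
rewrite s0 c0 !andbT (mulrC (ccos a)) -[X in X != _]mulr2n -mulr_natr.
by apply: mulf_neq0; [exact: mulf_neq0|rewrite pnatr_eq0].
Qed.

Lemma ccotD_sum a b : csin a != 0 -> csin b != 0 ->
  ccot a + ccot b = csin (a + b) / (csin a * csin b).
Proof.
by move=> h1 h2; rewrite /ccot csinD; field; rewrite h1 h2.
Qed.

(** A crude form of Jordan's inequality. The mean value theorem gives t cos t <= sin t; with t = x /
    2, sin x = 2 sin t cos t >= 2 t cos^2 t = t (1 + cos x) >= t, the cosine of x being nonnegative
    up to pi / 2. *)
Lemma sin_ge_half x : 0 <= x -> x <= pi / 2 -> x / 2 <= sin x.
Proof.
move=> x0 xp.
have sc (t : R) : 0 < t -> t < pi -> t * cos t <= sin t.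
  move=> t0 tp.
  have [|c] := @MVT R sin cos 0 t t0.
  - by apply: continuous_subspaceT; exact: continuous_sin.
  rewrite in_itv/= sin0 !subr0 => /andP[c0 ct] ->.
  rewrite mulrC ler_pM2r// ltW// ltr_cos ?in_itv/= ?(ltW c0) ?(ltW t0) ?(ltW tp)//=.
  by rewrite ltW// (lt_trans ct).
have [->|xn0] := eqVneq x 0; first by rewrite mul0r sin0.
have {xn0}x0' : 0 < x by rewrite lt_neqAle eq_sym xn0.
have pp := pi_gt0 R.
have h := sc (x / 2); have hx : x = (x / 2) *+ 2 by rewrite -mulr_natr; field.
rewrite {2}hx sin_mulr2n.
set t := x / 2 in h hx *.
have t0 : 0 < t by rewrite divr_gt0.
have tp : t < pi by rewrite /t ltr_pdivrMr//; nra.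
have c0 : 0 <= cos t.
  by apply: cos_ge0_pihalf; apply/andP; split; [nra|rewrite /t; nra].
have {}h := h t0 tp.
have c2 : 2 * cos t ^+ 2 = cos x + 1.
  by rewrite hx cos_mulr2n -mulr_natl; ring.
have cx : 0 <= cos x.
  by apply: cos_ge0_pihalf; apply/andP; split => //; nra.
have : t * cos t ^+ 2 *+ 2 <= (cos t * sin t) *+ 2.
  by rewrite lerMn2r/= expr2 mulrA mulrC ler_wpM2l.
apply: le_trans.
by rewrite -mulr_natl; nra.
Qed.

Lemma cderiv_csin w x : cderiv (fun t => csin (t%:C * w)) x (w * ccos (x%:C * w)).
Proof.
have i0 : (2 * 'i%C : R[i]) != 0.
  by rewrite mulf_neq0 ?pnatr_eq0// -normc_eq0/= expr0n expr1n add0r sqrtr1 oner_eq0.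
have h : cderiv (fun t => t%:C * w) x w.
  by apply: cderiv_eq (cderivMr w (cderiv_real (is_derive_id x 1))) _; rewrite mul1r.
have h1 := cderiv_cexp (cderivMl 'i%C h).
have h2 := cderiv_cexp (cderivMl (- 'i%C) h).
have {}h2 : cderiv (fun t => cexp (- ('i%C * (t%:C * w)))) x
    (- 'i%C * w * cexp (- ('i%C * (x%:C * w)))).
  rewrite -mulNr; have e : (fun t : R => cexp (- ('i%C * (t%:C * w)))) = (fun t => cexp (- 'i%C * (t%:C * w))).
    by apply/funext => t; rewrite mulNr.
  by rewrite e.
apply: cderiv_eq (cderivMr (2 * 'i%C)^-1 (cderivB h1 h2)) _.
rewrite /ccos; set A := cexp _; set B := cexp _; field.
by move: i0; rewrite mulf_eq0 negb_or => /andP[_].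
Qed.

Lemma cderiv_seq (F : R -> R[i]) l (u : nat -> R) :
  cderiv F 0 l -> (forall n, u n != 0) -> u n @[n --> \oo] --> (0 : R) ->
  ccvg \oo (fun n => (u n)^-1%:C * (F (u n) - F 0)) l.
Proof.
have main (f : R -> R) (d : R) : is_derive (0 : R) (1 : R) f d ->
    (forall n, u n != 0) -> u n @[n --> \oo] --> (0 : R) ->
    (u n)^-1 * (f (u n) - f 0) @[n --> \oo] --> d.
  move=> [df <-] u0 cu.
  have h : (h^-1 *: ((f \o shift 0) (h *: (1 : R)) - f 0)) @[h --> 0^'] --> 'D_1 f 0.
    exact: df.
  move/cvgr_dnbhsP : h => /(_ u (conj u0 cu)).
  apply: cvg_trans; apply: near_eq_cvg; near=> n.
  by rewrite /= addr0 /GRing.scale/= mulr1.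
move=> [h1 h2] u0 cu; split.
  by under eq_fun do rewrite ReMr ReB; exact: main h1 u0 cu.
by under eq_fun do rewrite ImMr ImB; exact: main h2 u0 cu.
Unshelve. all: by end_near. Qed.

Definition dyad n : R := (2 ^ n)%:R^-1.

Lemma dyad_gt0 n : 0 < dyad n.
Proof. by rewrite invr_gt0 ltr0n expn_gt0. Qed.

Lemma cvg_dyad : dyad n @[n --> \oo] --> (0 : R).
Proof.
have h : (2^-1 : R) ^+ n @[n --> \oo] --> (0 : R).
  by apply: cvg_expr; rewrite ger0_norm ?invr_ge0// invf_lt1// ltr1n.
apply: cvg_trans h; apply: near_eq_cvg; near=> n.
by rewrite /dyad natrX exprVn.
Unshelve. all: by end_near. Qed.


(** The poles -k and k + 1 are paired, symmetrically about 1/2, because the regularized kernel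
    produces them in this way: one from the integral to the right of [x], the other from the
    left. *)
Definition cot_sum n s : R[i] :=
  \sum_(k < n) ((s + k%:R)^-1 + (s - k.+1%:R)^-1).

(** Induction by the duplication formula, joining the indices k and 2^n + k, whose arguments differ
    by pi / 2 at level n + 1. The strip 0 < Re s < 1 keeps all arguments off the poles. *)
Lemma ccot_dyad n s : 0 < Re s -> Re s < 1 ->
  \sum_(k < 2 ^ n) ccot ((pi * dyad n)%:C * (s + k%:R)) =
  (2 ^ n)%:R * ccot (Pi%:C * s).
Proof.
elim: n s => [|n IH] s s0 s1.
  by rewrite expn0 big_ord1 addr0 /dyad expn0 invr1 mulr1 mul1r.
rewrite expnS mul2n -addnn big_split_ord/=.
have dS : dyad n.+1 = dyad n / 2 by rewrite /dyad expnS natrM invfM mulrC.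
have e k : (pi * dyad n.+1)%:C * (s + (2 ^ n + k)%:R) =
    (pi * dyad n.+1)%:C * (s + k%:R) + (pi / 2)%:C.
  rewrite natrD addrCA mulrDr [LHS]addrC; congr (_ + _).
  rewrite -(rmorph_nat (real_complex R)) -rmorphM/= dS; apply: complex_eqP => //=.
  have : ((2 ^ n)%:R : R) != 0 by rewrite pnatr_eq0 expn_eq0.
  by rewrite /dyad; set q := _%:R => q0; field.
under [X in _ + X]eq_bigr do rewrite e.
rewrite -big_split/=.
have d0 := dyad_gt0 n.+1; have pp := pi_gt0 R.
have hs (k : 'I_(2 ^ n)) : 0 < Re (s + k%:R) * dyad n.+1 < 2^-1.
  have -> : Re (s + k%:R) = Re s + k%:R.
    by rewrite ReD -(rmorph_nat (real_complex R)).
  rewrite mulr_gt0 ?(ltr_wpDr _ s0)//= dS mulrA.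
  rewrite -[ltRHS]mul1r ltr_pM2r ?invr_gt0// /dyad ltr_pdivrMr ?mul1r; last by rewrite ltr0n expn_gt0.
  apply: (@lt_le_trans _ _ (1 + k%:R)); first by rewrite ltrD2r.
  by rewrite addrC natr1 ler_nat.
rewrite (eq_bigr (fun k : 'I_(2 ^ n) => 2 * ccot ((pi * dyad n)%:C * (s + k%:R)))).
  rewrite -mulr_sumr IH// mulrA; congr (_ * _).
  by rewrite -natrM mul2n addnn.
move=> k _; have /andP[h1 h2] := hs k.
rewrite ccot_double.
- congr (_ * ccot _); rewrite mulrA; congr (_ * _).
  rewrite -(rmorph_nat (real_complex R)) -rmorphM/= dS; apply: complex_eqP => //=.
  by field.
- apply: csin_neq0; rewrite ReMr -mulrA (mulrC (dyad _)) sin_pi_neq0//.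
  by apply: (lt_trans h2); rewrite invf_lt1// ltr1n.
- by apply: ccos_neq0; rewrite ReMr -mulrA (mulrC (dyad _)) cos_pi_neq0.
Qed.

Lemma ccot_dyad_pair n s : 0 < Re s -> Re s < 1 ->
  \sum_(k < 2 ^ n) (ccot ((pi * dyad n.+1)%:C * (s + k%:R)) +
                    ccot ((pi * dyad n.+1)%:C * (s - k.+1%:R))) =
  (2 ^ n.+1)%:R * ccot (Pi%:C * s).
Proof.
move=> s0 s1; rewrite -ccot_dyad// [in RHS]expnS mul2n -addnn big_split_ord/=.
rewrite big_split/=; congr (_ + _).
(* The upper half of the indices, read backwards and moved by the period pi, becomes the shifts -(k
   + 1); for fixed k these arguments tend to 0 as [n] grows, as those of the lower half do. *)
rewrite (reindex_inj rev_ord_inj)/=; apply: eq_bigr => k _.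
rewrite -(ccotDpi (_ * (s - _))); congr ccot.
have kN := ltn_ord k.
have -> : (2 ^ n - k.+1).+1 = (2 ^ n - k)%N by rewrite subnSK.
rewrite natrB ?(ltnW kN)//.
have -> : Pi%:C = (pi * dyad n.+1)%:C * (2 ^ n.+1)%:R.
  rewrite -(rmorph_nat (real_complex R)) -rmorphM/= /dyad -mulrA mulVf ?mulr1//.
rewrite -mulrDr expnS mul2n -addnn !natrD; congr (_ * _); ring.
Qed.



Lemma ccvg_csin_dyad w :
  ccvg \oo (fun n => (dyad n.+1)^-1%:C * csin ((dyad n.+1)%:C * w)) w.
Proof.
have d0 n : dyad n.+1 != 0 by rewrite gt_eqF// dyad_gt0.
have cd : dyad n.+1 @[n --> \oo] --> (0 : R) by rewrite (cvg_shiftS dyad); exact: cvg_dyad.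
have h : cderiv (fun t => csin (t%:C * w)) 0 w.
  apply: cderiv_eq (cderiv_csin w 0) _.
  by rewrite (_ : 0%:C = 0)// mul0r (ccos_real 0) cos0 mulr1.
have := cderiv_seq h d0 cd.
by under eq_fun do rewrite (_ : 0%:C = 0)// mul0r (csin_real 0) sin0 subr0.
Qed.

Lemma ccvg_ccos_dyad w : ccvg \oo (fun n => ccos ((dyad n.+1)%:C * w)) 1.
Proof.
have cd : dyad n.+1 @[n --> \oo] --> (0 : R) by rewrite (cvg_shiftS dyad); exact: cvg_dyad.
have c0 : ccvg \oo (fun n => csin ((dyad n.+1)%:C * (w / 2))) 0.
  have h := ccvgM (ccvg_real cd) (ccvg_csin_dyad (w / 2)).
  rewrite mul0r in h; apply: eq_ccvg (h _ _) _ => n.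
  by rewrite mulrA -rmorphM/= divff ?mul1r ?gt_eqF ?dyad_gt0.
have e n : ccos ((dyad n.+1)%:C * w) = 1 - csin ((dyad n.+1)%:C * (w / 2)) ^+ 2 *+ 2.
  have -> : (dyad n.+1)%:C * w = (dyad n.+1)%:C * (w / 2) + (dyad n.+1)%:C * (w / 2).
    by field.
  rewrite ccosD; have := csin2Dccos2 ((dyad n.+1)%:C * (w / 2)).
  by set S := csin _; set C := ccos _ => <-; ring.
under eq_fun do rewrite e.
rewrite -[X in ccvg _ _ X]subr0 -[in X in ccvg _ _ X](mul0rn _ 2).
apply: ccvgB; first exact: ccvg_cst.
rewrite mulr2n; under eq_fun do rewrite mulr2n expr2.
by rewrite -{1 2}(mul0r 0); apply: ccvgD; apply: ccvgM.
Qed.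

Lemma ccvg_ccot_dyad w : w != 0 ->
  ccvg \oo (fun n => (dyad n.+1)%:C * ccot ((dyad n.+1)%:C * w)) w^-1.
Proof.
move=> w0.
have h := ccvgM (ccvg_ccos_dyad w) (ccvgV w0 (ccvg_csin_dyad w)).
rewrite mul1r in h; apply: eq_ccvg (h _ _) _ => n.
rewrite /ccot invfM mulrCA; congr (_ * _).
by rewrite -(fmorphV (real_complex R)) invrK.
Qed.

(** At each level [n] the terms with k < 2^n add up to exactly pi cot (pi s), and for fixed [k] the
    term tends to the k-th partial fraction: the setting of Tannery's theorem. *)
Definition dyad_term n s k : R[i] :=
  (pi * dyad n.+1)%:C * (ccot ((pi * dyad n.+1)%:C * (s + k%:R)) +
                    ccot ((pi * dyad n.+1)%:C * (s - k.+1%:R))).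

Lemma dyad_term_sum n s : 0 < Re s -> Re s < 1 ->
  \sum_(0 <= k < 2 ^ n) dyad_term n s k = Pi%:C * ccot (Pi%:C * s).
Proof.
move=> s0 s1; rewrite big_mkord -mulr_sumr ccot_dyad_pair// mulrA.
rewrite -(rmorph_nat (real_complex R)) -rmorphM/= /dyad -mulrA mulVf ?mulr1//.
Qed.

Lemma ReDn s k : Re (s + k%:R) = Re s + k%:R.
Proof. by rewrite ReD -(rmorph_nat (real_complex R)). Qed.
Lemma ReBn s k : Re (s - k%:R) = Re s - k%:R.
Proof. by rewrite ReB -(rmorph_nat (real_complex R)). Qed.

Lemma strip_neq0 s k : 0 < Re s -> s + k%:R != 0.
Proof. by move=> s0; apply: Re_neq0; rewrite ReDn ltr_wpDr. Qed.
Lemma strip_neq0' s k : Re s < 1 -> s - k.+1%:R != 0.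
Proof.
move=> s1; rewrite -oppr_eq0 opprB; apply: Re_neq0; rewrite -opprB ReN ReBn.
rewrite opprB subr_gt0 (lt_le_trans s1)// ler1n//.
Qed.

Lemma ccvg_dyad_term s k : 0 < Re s -> Re s < 1 ->
  ccvg \oo (fun n => dyad_term n s k) ((s + k%:R)^-1 + (s - k.+1%:R)^-1).
Proof.
move=> s0 s1.
have p0 : Pi%:C != 0 by rewrite -normc_eq0 normc_real normr_eq0 gt_eqF// pi_gt0.
have aux w : w != 0 -> ccvg \oo (fun n => (pi * dyad n.+1)%:C *
    ccot ((pi * dyad n.+1)%:C * w)) w^-1.
  move=> w0; have pw : Pi%:C * w != 0 by rewrite mulf_neq0.
  have h := ccvgM (ccvg_cst Pi%:C) (ccvg_ccot_dyad pw).
  rewrite invfM mulrA divff// mul1r in h; apply: eq_ccvg (h _ _) _ => n.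
  by rewrite mulrA -rmorphM/= mulrA -rmorphM/= [dyad _ * _]mulrC.
rewrite /dyad_term; under eq_fun do rewrite mulrDr.
by apply: ccvgD; apply: aux; [exact: strip_neq0|exact: strip_neq0'].
Qed.

(** The two cotangents add to sin (X + Y) / (sin X sin Y). The sum X + Y = d pi (2 s - 1) does not
    depend on k and its sine is O(d), while each sine in the denominator has modulus at least pi d k
    / 2. The powers of d cancel and 1 / k^2 remains. *)
Lemma dyad_term_bound s : 0 < Re s -> Re s < 1 ->
  exists2 C : R, 0 <= C & \forall n \near \oo, forall k, (0 < k < 2 ^ n)%N ->
    normc (dyad_term n s k) <= C / k%:R ^+ 2.
Proof.
move=> s0 s1; pose w := Pi%:C * (s + s - 1).
have pp := pi_gt0 R.
(* The 4 comes from squaring the 1/2 of [sin_ge_half]; [normc w + 1] is an eventual bound for |sin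
   (d w)| / d, which tends to [normc w]. *)
exists (4 * (normc w + 1) / pi).
  by rewrite divr_ge0 ?(ltW pp)// mulr_ge0// addr_ge0// normc_ge0.
have hw : \forall n \near \oo, normc ((dyad n.+1)^-1%:C * csin ((dyad n.+1)%:C * w)) < normc w + 1.
  by apply: (cvgr_lt _ (ccvg_normc (ccvg_csin_dyad w))); rewrite ltrDl.
apply: filterS hw => n hw k /andP[k0 kn].
have d0 := dyad_gt0 n.+1; set d := dyad n.+1 in hw d0 *.
(* Below index 2^n both real parts stay within pi / 2 in absolute value, the range of
   [sin_ge_half]. *)
have kd : k.+1%:R * d <= 2^-1.
  rewrite /d /dyad expnS natrM invfM mulrCA ler_piMr ?invr_ge0//.
  by rewrite ler_pdivrMr ?mul1r ?ler_nat// ltr0n expn_gt0.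
have k0' : 0 < k%:R :> R by rewrite ltr0n.
rewrite -natr1 in kd.
rewrite /dyad_term -/d; set X := _ * (s + _); set Y := _ * (s - _).
have rX : Re X = pi * d * (Re s + k%:R) by rewrite /X ReMr ReDn.
have rY : Re Y = - (pi * d * (k%:R + 1 - Re s)).
  by rewrite /Y ReMr ReBn -natr1; ring.
have low z (t : R) : `|Re z| = t -> pi * d * k%:R <= t -> t <= pi / 2 ->
    pi * d * k%:R / 2 <= normc (csin z).
  move=> zt t1 t2.
  have t0 : 0 <= t by rewrite -zt.
  have h1 : `|sin (Re z)| <= normc (csin z).
    rewrite -(ler_pXn2r (ltn0Sn 1)) ?nnegrE ?normc_ge0//.
    by rewrite real_normK ?num_real// normc_csin2 lerDl sqr_ge0.
  apply: le_trans h1; rewrite (le_trans _ (_ : t / 2 <= _))//.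
    by rewrite ler_pM2r.
  apply: (le_trans (sin_ge_half t0 t2)); rewrite -zt.
  case: (leP 0 (Re z)) => h; first by rewrite ger0_norm// ler_norm.
  by rewrite ltr0_norm// sinN -normrN ler_norm.
have pd0 : 0 < pi * d by rewrite mulr_gt0.
have hX : pi * d * k%:R / 2 <= normc (csin X).
  apply: (low _ (pi * d * (Re s + k%:R))).
  - by rewrite rX ger0_norm// mulr_ge0 ?(ltW pd0)// addr_ge0// ltW.
  - by rewrite ler_pM2l// lerDr ltW.
  - rewrite -mulrA ler_pM2l// (le_trans _ kd)// mulrC ler_pM2r//.
    by rewrite addrC lerD2l ltW.
have hY : pi * d * k%:R / 2 <= normc (csin Y).
  apply: (low _ (pi * d * (k%:R + 1 - Re s))).
  - rewrite rY normrN ger0_norm// mulr_ge0 ?(ltW pd0)// subr_ge0.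
    by rewrite (le_trans (ltW s1))// lerDr ltW.
  - by rewrite ler_pM2l// -addrA lerDl subr_ge0 ltW.
  - rewrite -mulrA ler_pM2l// (le_trans _ kd)// mulrC ler_pM2r//.
    by rewrite lerBlDr lerDl ltW.
have q0 : 0 < pi * d * k%:R / 2 by rewrite !mulr_gt0.
have X0 : csin X != 0 by rewrite -normc_gt0 (lt_le_trans q0).
have Y0 : csin Y != 0 by rewrite -normc_gt0 (lt_le_trans q0).
rewrite ccotD_sum//.
have -> : X + Y = d%:C * w.
  by rewrite /X /Y /w rmorphM/= -natr1; ring.
have hS : normc (csin (d%:C * w)) <= d * (normc w + 1).
  move: hw; rewrite normc_mulM normc_real ger0_norm ?invr_ge0 ?(ltW d0)//.
  by rewrite mulrC ltr_pdivrMr// => /ltW; rewrite [X in _ <= X -> _]mulrC.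
rewrite (normc_mulM (_%:C)) (normc_mulM (csin _) _^-1) Normc.normcV.
rewrite (normc_mulM (csin X)) normc_real ger0_norm ?(ltW pd0)//.
have hXY : (pi * d * k%:R / 2) ^+ 2 <= normc (csin X) * normc (csin Y).
  by rewrite expr2 ler_pM// ltW.
apply: (@le_trans _ _ (pi * d * (d * (normc w + 1) / (pi * d * k%:R / 2) ^+ 2))).
  rewrite ler_pM2l//; apply: ler_pM => //.
  - exact: normc_ge0.
  - by rewrite invr_ge0 mulr_ge0// normc_ge0.
  have P1 : 0 < normc (csin X) * normc (csin Y).
    by rewrite mulr_gt0// ?(lt_le_trans q0 hX) ?(lt_le_trans q0 hY).
  have P2 : 0 < (pi * d * k%:R / 2) ^+ 2 by rewrite exprn_gt0.
  by rewrite lef_pV2.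
rewrite le_eqVlt; apply/orP; left; apply/eqP.
move: (normc w) (gt_eqF pp) (gt_eqF d0) (gt_eqF k0') => W.
move: (k%:R : R) => q h1 h2 h3; move: (pi : R) h1 => p h1.
by field; rewrite h1 h2 h3.
Qed.

(** Comparison with the telescoping sum of 1 / (k - 1) - 1 / k. *)
Lemma sum_inv_sqr_le K m : (0 < K)%N ->
  \sum_(K.+1 <= k < m) (k%:R ^+ 2)^-1 <= K%:R^-1 :> R.
Proof.
move=> K0; have K0' : 0 < K%:R :> R by rewrite ltr0n.
have [mK|Km] := leqP m K.+1; first by rewrite big_geq// invr_ge0 ltW.
apply: (@le_trans _ _ (\sum_(K.+1 <= k < m) ((- k%:R^-1) - (- k.-1%:R^-1)))).
  apply: ler_sum_nat => -[//|k] /andP[h _]; rewrite opprK addrC /=.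
  have k0 : 0 < k%:R :> R by rewrite ltr0n (leq_trans K0).
  have k1 : 0 < k%:R + 1 :> R by rewrite addr_gt0.
  rewrite -natr1 (_ : k%:R^-1 - _ = (k%:R * (k%:R + 1))^-1); last first.
    by field; rewrite !gt_eqF.
  rewrite lef_pV2 ?posrE ?mulr_gt0 ?exprn_gt0// expr2 ler_pM2r//.
  by rewrite lerDl.
case: m Km => // m Km; rewrite ltnS in Km.
rewrite big_add1/= (eq_bigr (fun k => (- k.+1%:R^-1) - (- k%:R^-1))); last by [].
rewrite telescope_sumr//.
  by rewrite opprK addrC lerBlDr lerDl invr_ge0.
exact: ltnW.
Qed.

(** Tannery's argument: the first [K.+1] terms converge one by one, and the remaining ones add up to
    at most C / K uniformly in the level. *)
Lemma cot_partial_fractions s : 0 < Re s -> Re s < 1 ->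
  ccvg \oo (fun n => cot_sum n s) (Pi%:C * ccot (Pi%:C * s)).
Proof.
move=> s0 s1; have [C C0 hC] := dyad_term_bound s0 s1.
have main K : (0 < K)%N ->
    normc (cot_sum K.+1 s - Pi%:C * ccot (Pi%:C * s)) <= C / K%:R.
  move=> K0.
  have c : ccvg \oo (fun n => \sum_(k < K.+1) dyad_term n s k - Pi%:C * ccot (Pi%:C * s))
      (cot_sum K.+1 s - Pi%:C * ccot (Pi%:C * s)).
    apply: ccvgB; last exact: ccvg_cst.
    by apply: ccvg_sum => k; exact: ccvg_dyad_term.
  apply: (cvgr_to_le (ccvg_normc c)).
  near=> n.
  have Kn : (K.+1 <= 2 ^ n)%N.
    by near: n; exists K.+1 => // n /= h; rewrite (leq_trans h)// ltnW// ltn_expl.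
  have hn : forall k, (0 < k < 2 ^ n)%N -> normc (dyad_term n s k) <= C / k%:R ^+ 2.
    by near: n.
  rewrite -(dyad_term_sum n s0 s1) (big_cat_nat _ Kn)//= big_mkord opprD addNKr.
  rewrite normcN (le_trans (normc_sum _ _ _))//.
  apply: (@le_trans _ _ (C * \sum_(K.+1 <= k < 2 ^ n) (k%:R ^+ 2)^-1)).
    rewrite mulr_sumr; apply: ler_sum_nat => k /andP[h1 h2].
    by apply: hn; rewrite h2 andbT (leq_trans _ h1).
  by rewrite ler_wpM2l// sum_inv_sqr_le.
have h : ccvg \oo (fun n => cot_sum n.+2 s) (Pi%:C * ccot (Pi%:C * s)).
  apply: (@ccvg_squeeze _ _ _ _ _ _ (fun n => C * n.+1%:R^-1)).
    by near=> n; exact: main.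
  rewrite -(mulr0 C); apply: cvgM; [exact: cvg_cst|exact: cvg_harmonic].
case: h => h1 h2; split.
  by rewrite -(cvg_shiftn 2); under eq_fun do rewrite addn2.
by rewrite -(cvg_shiftn 2); under eq_fun do rewrite addn2.
Unshelve. all: by end_near. Qed.
End Cotangent.

(** * Half-Hilbert transform of powers *)

Section Affine.
Context {R : realType}.
Local Notation mu := (@lebesgue_measure R).
Implicit Types (a t : R).

(** The Boolean selects the translation t + a or the reflection a - t, so one appeal to the
    uniqueness of Lebesgue measure covers both; convolutions need each of them. *)
Definition shift_map (b : bool) a t : R := a + (-1) ^+ b * t.

Lemma measurable_shift_map b a : @measurable_fun _ _ (measurableTypeR R)
  (measurableTypeR R) setT (shift_map b a).
Proof.
have h : measurable_fun (setT : set R) (shift_map b a).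
  apply: measurable_funD; first exact: measurable_cst.
  by apply: measurable_funM; [exact: measurable_cst|exact: measurable_id].
exact: h.
Qed.

Lemma lebesgue_shift b a (A : set (measurableTypeR R)) : measurable A ->
  mu A = pushforward mu (shift_map b a) A.
Proof.
move=> mA.
pose m : {measure set (measurableTypeR R) -> \bar R} :=
  measure_function_pushforward__canonical__measure_function_Measure mu (measurable_shift_map b a).
apply: (@lebesgue_measure_unique R m) => // X [[x y] _ <-].
rewrite /m /= /pushforward.
have -> : shift_map b a @^-1` `]x, y] =
    (if b then `[a - y, a - x[ else `]x - a, y - a])%classic.
  apply/seteqP; split=> t; case: b m => _; rewrite /shift_map/= ?expr0 ?expr1 !in_itv/=;
  by move=> /andP[h1 h2]; apply/andP; split; lra.
case: b m => _; rewrite !lebesgue_measure_itv/= !lte_fin.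
  rewrite -[a - y < a - x]/(a - y < a - x)%R ltrD2l ltrN2; case: ifP => // _.
  by rewrite -!EFinB; congr EFin; ring.
rewrite ltrD2r; case: ifP => // _.
by rewrite -!EFinB; congr EFin; ring.
Qed.

Lemma ge0_integral_shift b a (f : R -> \bar R) : measurable_fun setT f ->
  (forall t, 0 <= f t)%E ->
  (\int[mu]_t f (shift_map b a t) = \int[mu]_t f t)%E.
Proof.
move=> mf f0.
pose m : {measure set (measurableTypeR R) -> \bar R} :=
  measure_function_pushforward__canonical__measure_function_Measure mu (measurable_shift_map b a).
have e1 : (\int[mu]_t f t = \int[m]_t f t)%E.
  by apply: eq_measure_integral => A mA _; exact: lebesgue_shift.
have e2 := @ge0_integral_pushforward _ _ (measurableTypeR R) (measurableTypeR R) R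
  _ (measurable_shift_map b a) mu setT f measurableT mf (fun t _ => f0 t).
by rewrite e1 -e2.
Qed.

Lemma integrable_shift b a (f : R -> \bar R) : mu.-integrable setT f ->
  mu.-integrable setT (f \o shift_map b a).
Proof.
move=> /integrableP[mf fi]; apply/integrableP; split.
  exact: (measurableT_comp mf (measurable_shift_map b a)).
have := @ge0_integral_shift b a (fun t => `|f t|)%E; rewrite /= => ->//.
exact: (measurableT_comp _ mf).
Qed.

Lemma integral_shift b a (f : R -> \bar R) : mu.-integrable setT f ->
  (\int[mu]_t f (shift_map b a t) = \int[mu]_t f t)%E.
Proof.
move=> fi; have fi' := integrable_shift b a fi.
pose m : {measure set (measurableTypeR R) -> \bar R} :=
  measure_function_pushforward__canonical__measure_function_Measure mu (measurable_shift_map b a).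
have e1 : (\int[mu]_t f t = \int[m]_t f t)%E.
  by apply: eq_measure_integral => A mA _; exact: lebesgue_shift.
have e2 := @integral_pushforward _ _ (measurableTypeR R) (measurableTypeR R) R
  _ (measurable_shift_map b a) mu setT f (measurable_int mu fi) fi' measurableT.
by rewrite e1 -e2.
Qed.

Lemma integrable_indic_mul (A : set R) (f : R -> R) : measurable A ->
  mu.-integrable A (EFin \o f) ->
  mu.-integrable setT (fun t => (\1_A t * f t)%:E).
Proof.
move=> mA; rewrite integrable_mkcond//.
suff -> : (EFin \o f) \_ A = (fun t => (\1_A t * f t)%:E) by [].
by apply/funext => t; rewrite patchE indicE; case: ifP => _ /=;
  rewrite ?mul1r ?mul0r.
Qed.

End Affine.

(** * The regularized Hilbert kernel and its majorant *)

Section Regularization.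
Context {R : realType}.
Local Notation mu := (@lebesgue_measure R).
Implicit Types (x t c tau : R) (s : R[i]).

(* Weight under which the truncated Hilbert kernels are uniformly controlled. *)
Definition wgt tau : R := (1 + `|tau|) `^ 4^-1.

Lemma wgt_ge1 tau : 1 <= wgt tau.
Proof.
rewrite -[1 in X in X <= _](powRr0 (1 + `|tau|)); apply: ler_powR => //.
by rewrite lerDl.
Qed.
Lemma wgt_gt0 tau : 0 < wgt tau. Proof. exact: lt_le_trans ltr01 (wgt_ge1 _). Qed.
(** From 1 + |tau + v| <= (1 + |tau|) (1 + |v|). Submultiplicativity is what lets the weight pass
    through a convolution. *)
Lemma wgtD tau v : wgt (tau + v) <= wgt tau * wgt v.
Proof.
have n0 (u : R) : 0 <= 1 + `|u| by rewrite addr_ge0.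
rewrite /wgt -powRM//; apply: ge0_ler_powR; rewrite ?nnegrE ?mulr_ge0//.
apply: (@le_trans _ _ (1 + (`|tau| + `|v|))); first by rewrite lerD2l ler_normD.
have := mulr_ge0 (normr_ge0 tau) (normr_ge0 v); nra.
Qed.

(** Interpolation between a bounded and a Lipschitz estimate. Taken at u = (1 + |tau|) |t - x|, it
    pays only the weight in tau and leaves the singularity |t - x|^(-3/4), which is integrable. *)
Lemma min1_le_pow (u : R) : 0 <= u -> Num.min 1 u <= u `^ 4^-1.
Proof.
rewrite le_eqVlt => /orP[/eqP<-|u0]; first by rewrite ge_min powR_ge0 orbT.
have [u1|u1] := leP u 1.
  apply: ger1_powR; first by rewrite u0.
  by rewrite invf_le1// ler1n.
by rewrite -[leLHS](powRr0 u) ler_powR// ltW.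
Qed.

(** The difference is the integral of the derivative between [x] and [t]. There the power is at most
    its value at the lower bound [x0], and the exponent has modulus at most c + |tau| <= 1 +
    |tau|. *)
Lemma normc_cpow_lipschitz c tau x0 x t : 0 < c -> c < 1 -> 0 < x0 ->
  x0 <= x -> x0 <= t ->
  normc (cpow t (- (c +i* tau)) - cpow x (- (c +i* tau))) <=
  (1 + `|tau|) * x0 `^ (- c - 1) * `|t - x|.
Proof.
move=> c0 c1 x00; wlog xt : x t / x <= t => [H x0x x0t|x0x x0t].
  case: (leP x t) => h; first exact: H.
  by rewrite normc_distC distrC; apply: H => //; exact: ltW.
set z := - (c +i* tau).
have pos u : x <= u <= t -> 0 < u.
  by move=> /andP[h _]; apply: lt_le_trans h; exact: lt_le_trans x0x.
have dF u : x <= u <= t -> cderiv (cpow ^~ z) u (z * cpow u (z - 1)).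
  by move=> /pos; exact: cderiv_cpow.
have cf u : x <= u <= t -> exists l, cderiv (fun u => z * cpow u (z - 1)) u l.
  by move=> /pos u0; eexists; apply: cderivMl; exact: cderiv_cpow.
rewrite -(cintegral_FTC2 xt dF cf).
have nz : normc z <= 1 + `|tau|.
  rewrite (le_trans (normc_le _))//= normrN normrN lerD2r ger0_norm ?ltW//.
set M := (1 + `|tau|) * x0 `^ (- c - 1).
have iM : mu.-integrable `[x, t] (fun=> M%:E).
  exact: (@integrable_continuous R (cst M) x t (fun u _ => cvg_cst _)).
apply: (le_trans (normc_cintegral_le _ (cintegrable_continuous cf) iM _)) => //.
  move=> u Du; have xut : x <= u <= t by move: Du; rewrite /= in_itv.
  rewrite normc_mulM normc_cpow ?(pos u)//.
  apply: ler_pM; rewrite ?normc_ge0 ?powR_ge0//.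
  rewrite ReB ReN/= -opprD !powRN lef_pV2 ?posrE ?powR_gt0 ?(pos u)//.
  apply: ge0_ler_powR; rewrite ?nnegrE ?addr_ge0 ?(ltW c0)//.
  - exact: ltW.
  - exact/ltW/pos.
  - by apply: le_trans x0x _; case/andP: xut.
have -> : Rintegral mu `[x, t] (fun=> M) = M * t - M * x.
  apply: (@Rintegral_FTC2 _ (fun u => M * u)) => // u _; last exact: cvg_cst.
  apply: (is_derive_eqv (is_derive_mul (is_derive_cst M u (1 : R))
    (is_derive_id u (1 : R)))) => //.
  by rewrite mul0r add0r mulr1.
by rewrite -mulrBr ger0_norm// subr_ge0.
Qed.

End Regularization.

Section IntegrableArith.
Context {R : realType} {d : measure_display} {T : measurableType d}.
Variables (m : {measure set T -> \bar R}) (D : set T).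
Hypothesis mD : measurable D.
Implicit Types (g h : T -> R).

Lemma integrable_scale (k : R) g : m.-integrable D (EFin \o g) ->
  m.-integrable D (EFin \o (fun t => k * g t)).
Proof. by move=> ig; rewrite /comp; under eq_fun do rewrite EFinM; exact: integrableZl. Qed.

Lemma integrable_plus g h : m.-integrable D (EFin \o g) ->
  m.-integrable D (EFin \o h) -> m.-integrable D (EFin \o (fun t => g t + h t)).
Proof. by move=> ig ih; rewrite /comp; under eq_fun do rewrite EFinD; exact: integrableD. Qed.

End IntegrableArith.

Section RegularizedKernel.
Context {R : realType}.
Local Notation mu := (@lebesgue_measure R).
Implicit Types (x t c tau : R) (s : R[i]) (phi : R -> R[i]) (n k : nat).

(* The reference function: its principal value against [1 / (t - x)] is [0],
   and its Mellin-type expansions on both sides of [x] are elementary. *)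
Definition rho x t : R := if t <= x then 1 else x / t.

(** Subtracting [phi x * rho x t] instead of [phi x] keeps the quotient integrable at infinity. At t
    = x the value is 0, by the convention on division. *)
Definition reg phi x t : R[i] := (phi t - phi x * (rho x t)%:C) / (t - x)%:C.

Lemma rho_ge0 x t : 0 < x -> 0 <= rho x t.
Proof.
move=> x0; rewrite /rho; case: (leP t x) => // xt.
by rewrite divr_ge0 ?ltW// (lt_trans x0).
Qed.

(** The exponent 1/4 - 1 is what remains of 1 / |t - x| after the interpolation. The function is
    used at t - x and at x - t, one for each side of [x]. *)
Definition near_kernel x t : R :=
  \1_(`]0, x / 2]%classic : set R) t * t `^ (4^-1 - 1).

(** One summand per regime: the singularity within distance x / 2 of [x], the constant terms up to 2
    x, the power t^(-c) up to [x], and the tail beyond [x]. The frequency does not occur; it is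
    confined to the factor [wgt tau] of [reg_le]. *)
Definition regmaj c x t : R :=
  (2 * (x / 2) `^ (- c) + (x / 2) `^ (- c - 1)) *
    (near_kernel x (t - x) + near_kernel x (x - t)) +
  (2 * (x `^ (- c) / x)) * \1_(`]0, 2 * x]%classic : set R) t +
  (2 / x) * (\1_(`]0, x]%classic : set R) t * t `^ (1 - c - 1)) +
  \1_(`]x, +oo[%classic : set R) t *
    (3 * t `^ (- c - 1) + 3 * (x `^ (- c) * x) * t `^ (- 1 - 1)).

Lemma near_kernel_ge0 x t : 0 <= near_kernel x t.
Proof. by rewrite mulr_ge0 ?powR_ge0. Qed.

Lemma integrable_near_kernel x : 0 < x ->
  mu.-integrable setT (EFin \o near_kernel x).
Proof.
move=> x0; apply: integrable_indic_mul => //.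
by apply: integrable_powR_low; rewrite ?divr_gt0// invr_gt0.
Qed.

Lemma integrable_regmaj c x : 0 < c -> c < 1 -> 0 < x ->
  mu.-integrable setT (EFin \o regmaj c x).
Proof.
move=> c0 c1 x0.
have h1 : mu.-integrable setT (EFin \o near_kernel x \o shift_map false (- x)).
  exact: integrable_shift (integrable_near_kernel x0).
have h2 : mu.-integrable setT (EFin \o near_kernel x \o shift_map true x).
  exact: integrable_shift (integrable_near_kernel x0).
apply: integrable_plus => //; first apply: integrable_plus => //;
  first apply: integrable_plus => //.
- apply: integrable_scale => //; apply: integrable_plus => //.
    apply: eq_integrable h1 => // t _; rewrite /= /shift_map expr0 mul1r.
    by rewrite addrC.
  by apply: eq_integrable h2 => // t _; rewrite /= /shift_map expr1 mulN1r.
- apply: integrable_scale => //.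
  have h3 : mu.-integrable setT (fun t => (\1_(`]0, (2 * x)]%classic : set R) t * (cst 1 t))%:E).
    apply: integrable_indic_mul => //.
    apply: (@integrableS _ _ _ mu `[0, 2 * x]%classic) => //; first exact: subset_itv_oc_cc.
    by apply: (@integrable_continuous R (cst 1)) => u _; exact: cvg_cst.
  by apply: eq_integrable h3 => // t _; rewrite mulr1.
- apply: integrable_scale => //; apply: integrable_indic_mul => //.
  by apply: integrable_powR_low; rewrite ?subr_gt0.
- apply: integrable_indic_mul => //.
  by apply: integrable_plus => //; apply: integrable_scale => //;
    apply: integrable_powR_high.
Qed.

(** The frequency matters only near [x]. At distance more than x / 2 the triangle inequality
    suffices, and the division by |t - x| is paid by the constants 2 / x on the left and 3 / t on
    the right. *)
Lemma reg_le c x tau t : 0 < c -> c < 1 -> 0 < x -> 0 < t ->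
  normc (reg (cpow ^~ (- (c +i* tau))) x t) <= wgt tau * regmaj c x t.
Proof.
move=> c0 c1 x0 t0; set z := - (c +i* tau).
have nz u : 0 < u -> normc (cpow u z) = u `^ (- c) by move=> u0; rewrite normc_cpow.
have x20 : 0 < x / 2 by rewrite divr_gt0.
have B0 : 0 <= 2 * (x / 2) `^ (- c) + (x / 2) `^ (- c - 1).
  by rewrite addr_ge0 ?mulr_ge0 ?powR_ge0.
set B := 2 * (x / 2) `^ (- c) + _ in B0.
pose T1 := B * (near_kernel x (t - x) + near_kernel x (x - t)).
pose T2 := (2 * (x `^ (- c) / x)) * \1_(`]0, 2 * x]%classic : set R) t.
pose T3 := (2 / x) * (\1_(`]0, x]%classic : set R) t * t `^ (1 - c - 1)).
pose T4 := \1_(`]x, +oo[%classic : set R) t *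
    (3 * t `^ (- c - 1) + 3 * (x `^ (- c) * x) * t `^ (- 1 - 1)).
have T10 : 0 <= T1 by rewrite mulr_ge0// addr_ge0// near_kernel_ge0.
have T20 : 0 <= T2 by rewrite !mulr_ge0 ?invr_ge0 ?powR_ge0 ?(ltW x0).
have T30 : 0 <= T3 by rewrite !mulr_ge0 ?invr_ge0 ?powR_ge0 ?(ltW x0).
have T40 : 0 <= T4.
  by rewrite mulr_ge0// addr_ge0 ?mulr_ge0 ?powR_ge0 ?(ltW x0).
have -> : regmaj c x t = T1 + T2 + T3 + T4 by [].
have w1 := wgt_ge1 tau.
have weak a : a <= T1 + T2 + T3 + T4 -> a <= wgt tau * (T1 + T2 + T3 + T4).
  by move=> h; apply: (le_trans h); rewrite ler_peMl// !addr_ge0.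
have [tx|tx] := eqVneq t x.
  by rewrite /reg tx subrr invr0 mulr0 Normc.normc0 mulr_ge0 ?(ltW (wgt_gt0 _))// !addr_ge0.
have d0 : 0 < `|t - x| by rewrite normr_gt0 subr_eq0.
rewrite /reg normc_mulM Normc.normcV normc_real ler_pdivrMr//.
have indE (A : set R) u : A u -> \1_A u = 1 :> R by move=> Au; rewrite indicE mem_set.
have rhox : x `^ (- c) * (1 - rho x t) <= x `^ (- c) / x * `|t - x|.
  rewrite -mulrA ler_pM2l ?powR_gt0// /rho; case: (leP t x) => h.
    by rewrite subrr mulr_ge0// invr_ge0 ltW.
  rewrite gtr0_norm ?subr_gt0//.
  have -> : 1 - x / t = t^-1 * (t - x) by field; rewrite gt_eqF.
  rewrite ler_wpM2r ?subr_ge0 ?(ltW h)//.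
  by rewrite lef_pV2 ?posrE// ltW.
have rho1 : rho x t <= 1.
  rewrite /rho; case: (leP t x) => h //.
  by rewrite ler_pdivrMr// mul1r ltW.
have [near|far] := leP `|t - x| (x / 2).
  (* close to [x]: interpolate between boundedness and Lipschitz continuity *)
  have /andP[tl tu] : x / 2 <= t <= 2 * x.
    move: near; rewrite ler_norml => /andP[h1 h2]; apply/andP; split; lra.
  have hT1 : B * `|t - x| `^ (4^-1 - 1) <= T1.
    rewrite ler_wpM2l//; move: tx; rewrite neq_lt => /orP[h|h].
      have e : `|t - x| = x - t by rewrite distrC gtr0_norm// subr_gt0.
      rewrite -[leLHS]add0r lerD ?near_kernel_ge0// e /near_kernel indE ?mul1r//.
      by rewrite /= in_itv/= subr_gt0 h -e.
    have e : `|t - x| = t - x by rewrite gtr0_norm// subr_gt0.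
    rewrite -[leLHS]addr0 lerD ?near_kernel_ge0// e /near_kernel indE ?mul1r//.
    by rewrite /= in_itv/= subr_gt0 h -e.
  have hT2 : x `^ (- c) / x <= T2.
    rewrite /T2 indE ?mulr1; last by rewrite /= in_itv/= t0.
    by rewrite ler_peMl// ?ler1n// divr_ge0 ?powR_ge0// ltW.
  have hL : normc (cpow t z - cpow x z) <= B * (wgt tau * `|t - x| `^ 4^-1).
    have n0 : 0 <= 1 + `|tau| by rewrite addr_ge0.
    have hx : x / 2 <= x by lra.
    rewrite /wgt -powRM//.
    apply: (@le_trans _ _ (B * Num.min 1 ((1 + `|tau|) * `|t - x|))); last first.
      by rewrite ler_wpM2l// min1_le_pow// mulr_ge0.
    have u0 : 0 <= (1 + `|tau|) * `|t - x| by rewrite mulr_ge0.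
    have P1 : 0 <= (x / 2) `^ (- c) by exact: powR_ge0.
    have P2 : 0 <= (x / 2) `^ (- c - 1) by exact: powR_ge0.
    have [hm|hm] := leP 1 ((1 + `|tau|) * `|t - x|).
      rewrite mulr1 (le_trans (normcB _ _))// !nz//.
      apply: (@le_trans _ _ (2 * (x / 2) `^ (- c))); last by rewrite lerDl.
      have mono u : x / 2 <= u -> u `^ (- c) <= (x / 2) `^ (- c).
        move=> hu; have u0' := lt_le_trans x20 hu.
        rewrite !powRN lef_pV2 ?posrE ?powR_gt0//.
        by apply: ge0_ler_powR; rewrite ?nnegrE// ltW.
      have h1 := mono t tl; have h2 := mono x hx; lra.
    have := normc_cpow_lipschitz tau c0 c1 x20 hx tl.
    rewrite -/z => /le_trans; apply.
    rewrite mulrAC mulrC ler_wpM2r// /B.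
    by rewrite lerDr mulr_ge0.
  (* The increment of the power carries the singularity; the defect 1 - rho vanishes to first order
     at [x], so its quotient is bounded. *)
  have -> : cpow t z - cpow x z * (rho x t)%:C =
      (cpow t z - cpow x z) + cpow x z * (1 - rho x t)%:C.
    by rewrite rmorphB rmorph1/=; ring.
  rewrite (le_trans (normcD _ _))// normc_mulM nz// normc_real ger0_norm ?subr_ge0//.
  apply: (@le_trans _ _ ((wgt tau * (B * `|t - x| `^ (4^-1 - 1)) + x `^ (- c) / x) * `|t - x|)).
    rewrite mulrDl lerD// (le_trans hL)// mulrCA -!mulrA.
    rewrite -[X in _ * (_ * (_ * X))](powRr1 (ltW d0)) -powRD ?(gt_eqF d0) ?implybT//.
    by rewrite subrK.
  rewrite ler_pM2r// !mulrDr -!addrA lerD//.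
    by rewrite ler_pM2l ?wgt_gt0.
  rewrite -[leLHS]addr0 lerD//.
    by rewrite (le_trans hT2)// ler_peMl.
  by rewrite addr_ge0// mulr_ge0// (le_trans ler01).
apply: (@le_trans _ _ ((T1 + T2 + T3 + T4) * `|t - x|)); last first.
  by rewrite ler_pM2r// weak.
apply: (le_trans (normcB _ _)).
rewrite normc_mulM !nz// normc_real ger0_norm ?rho_ge0//.
move: tx; rewrite neq_lt => /orP[h|h].
  have e : rho x t = 1 by rewrite /rho ltW.
  rewrite e mulr1.
  have hT2 : 2 * (x `^ (- c) / x) <= T2.
    by rewrite /T2 indE ?mulr1//= in_itv/= t0/= (le_trans (ltW h))// ler_peMl ?ler1n// ltW.
  have hT3 : 2 / x * t `^ (- c) <= T3.
    rewrite /T3 indE ?mul1r; last by rewrite /= in_itv/= t0 ltW.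
    by rewrite addrAC subrr sub0r.
  apply: (@le_trans _ _ ((2 / x * t `^ (- c) + 2 * (x `^ (- c) / x)) * `|t - x|)); last first.
    rewrite ler_pM2r//; lra.
  have hx : 1 <= 2 / x * `|t - x|.
    by rewrite mulrC -[2 / x]invf_div ler_pdivlMr// mul1r ltW.
  have -> : (2 / x * t `^ (- c) + 2 * (x `^ (- c) / x)) * `|t - x| =
     (2 / x * `|t - x|) * (t `^ (- c) + x `^ (- c)) by ring.
  by rewrite ler_peMl// addr_ge0// powR_ge0.
have e : rho x t = x / t by rewrite /rho leNgt h.
have et : `|t - x| = t - x by rewrite gtr0_norm// subr_gt0.
have hT4 : 3 * t `^ (- c - 1) + 3 * (x `^ (- c) * x) * t `^ (- 1 - 1) <= T4.
  by rewrite /T4 indE ?mul1r//= in_itv/= h.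
apply: (@le_trans _ _ ((3 * t `^ (- c - 1) + 3 * (x `^ (- c) * x) * t `^ (- 1 - 1)) * `|t - x|)); last first.
  rewrite ler_pM2r//; lra.
have tV (p : R) : t `^ (p - 1) = t `^ p / t.
  by rewrite powRB ?(gt_eqF t0) ?implybT// powRr1// ltW.
rewrite !tV (powRN t 1) powRr1 ?(ltW t0)// e et.
have h3 : 1 <= 3 / t * (t - x).
  rewrite mulrAC ler_pdivlMr// mul1r; move: far; rewrite et; lra.
have -> : (3 * (t `^ (- c) / t) + 3 * (x `^ (- c) * x) * (t^-1 / t)) * (t - x) =
  (3 / t * (t - x)) * (t `^ (- c) + x `^ (- c) * (x / t)) by ring.
by rewrite ler_peMl// addr_ge0 ?powR_ge0// mulr_ge0 ?powR_ge0// divr_ge0 ?ltW.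
Qed.

End RegularizedKernel.

(** * The cotangent as the integral of the regularized kernel *)

Section RegularizedIntegral.
Context {R : realType}.
Local Notation mu := (@lebesgue_measure R).
Implicit Types (x t c tau : R) (s : R[i]) (phi : R -> R[i]) (n k : nat).

Lemma measurable_Rplus : measurable (Rplus : set (measurableTypeR R)).
Proof. exact: measurable_itv. Qed.

Lemma RplusE x : 0 < x -> Rplus = (`]0, x] `|` `]x, +oo[)%classic :> set R.
Proof.
move=> x0; apply/seteqP; split => t; rewrite /Rplus /= !in_itv/= !andbT.
  by move=> t0; case: (leP t x) => h; [left; rewrite t0|right].
by move=> [/andP[]//|]; exact: lt_trans.
Qed.

Lemma Rplus_disj x : [disjoint (`]0, x] : set R) & (`]x, +oo[ : set R)].
Proof.
apply/disj_setPLR => t /=; rewrite !in_itv/= andbT => /andP[_ h].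
by apply/negP; rewrite -leNgt.
Qed.

Lemma measurable_rho x : measurable_fun (setT : set R) (rho x).
Proof.
have -> : rho x = (fun t => \1_(`]-oo, x]%classic : set R) t +
    \1_(`]x, +oo[%classic : set R) t * (x * t^-1)).
  apply/funext => t; rewrite /rho !indicE !mem_setE !in_itv/= andbT.
  by case: (leP t x) => h; rewrite ?mul0r ?addr0 ?mul1r ?add0r.
apply: measurable_funD; first exact: measurable_indic.
apply: measurable_funM; first exact: measurable_indic.
apply: measurable_funM; first exact: measurable_cst.
exact/measurable_funV/measurable_id.
Qed.

Lemma cmeasurable_reg (D : set R) phi x : cmeasurable D phi -> cmeasurable D (reg phi x).
Proof.
move=> mphi; apply: cmeasurableM.
  apply: cmeasurableB => //; apply: cmeasurableM; first exact: cmeasurable_cst.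
  apply: cmeasurable_real; apply: measurable_funTS; exact: measurable_rho.
apply: cmeasurableV; apply: cmeasurable_real.
by apply: measurable_funB; [exact: measurable_id|exact: measurable_cst].
Qed.

Lemma cintegrable_reg s x : 0 < Re s -> Re s < 1 -> 0 < x ->
  cintegrable mu Rplus (reg (cpow ^~ (- s)) x).
Proof.
case: s => c tau /= c0 c1 x0.
have i := integrable_scale measurableT (wgt tau) (integrable_regmaj c0 c1 x0).
apply: (@cintegrable_dom _ _ _ mu Rplus measurable_Rplus _
  (fun t => wgt tau * regmaj c x t)).
- by apply: cmeasurable_reg; exact: cmeasurable_cpowl.
- exact: (integrableS measurableT measurable_Rplus (@subsetT _ _) i).
move=> t Dt; apply: reg_le => //.
by move: Dt; rewrite /Rplus/= in_itv/= andbT.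
Qed.

Lemma sum_expr_geom (F : fieldType) (r : F) n : 
  (1 - r) * \sum_(k < n) r ^+ k = 1 - r ^+ n.
Proof. by rewrite -[RHS]opprB subrX1 -mulNr opprB. Qed.

(** Left of [x] one has rho = 1 and 1 / (t - x) = - sum_k t^k / x^(k+1); this is one term of the
    series. The harmonic part 1 / (k + 1), whose sum diverges, is compensated by the opposite one
    from the right of [x]. *)
Lemma reg_low_term s x k : 0 < Re s -> Re s < 1 -> 0 < x ->
  cintegrable mu `]0, x] (fun t => (cpow t (- s) - cpow x (- s)) * (- x^-1 * (t / x) ^+ k)%:C) /\
  cintegral mu `]0, x] (fun t => (cpow t (- s) - cpow x (- s)) * (- x^-1 * (t / x) ^+ k)%:C) =
  cpow x (- s) * (k.+1%:R^-1 + (s - k.+1%:R)^-1).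
Proof.
move=> s0 s1 x0; pose K : R[i] := (- x^-1 * x^-1 ^+ k)%:C.
have z1 : 0 < Re (k.+1%:R - s).
  by rewrite -opprB ReN ReBn opprB subr_gt0 (lt_le_trans s1)// ler1n.
have z2 : 0 < Re (k.+1%:R : R[i]) by rewrite -[k.+1%:R]add0r ReDn/= add0r ltr0n.
have [i1 e1] := cintegral_cpow_low x0 z1.
have [i2 e2] := cintegral_cpow_low x0 z2.
pose G t := K * (cpow t (k.+1%:R - s - 1) - cpow x (- s) * cpow t (k.+1%:R - 1)).
have E t : `]0, x]%classic t ->
    (cpow t (- s) - cpow x (- s)) * (- x^-1 * (t / x) ^+ k)%:C = G t.
  rewrite /= in_itv/= => /andP[t0 _]; rewrite /G /K.
  have -> : k.+1%:R - s - 1 = - s + k%:R :> R[i] by rewrite -natr1; ring.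
  have -> : k.+1%:R - 1 = k%:R :> R[i] by rewrite -natr1; ring.
  rewrite cpowD cpow_nat// exprMn !rmorphM/=; ring.
have iG : cintegrable mu `]0, x] G.
  by apply: cintegrableZ => //; apply: cintegrableB => //; exact: cintegrableZ.
split; first by apply: eq_cintegrable iG => // t /E.
rewrite (@eq_cintegral _ _ _ mu _ _ _ E) cintegralZ//; last first.
  by apply: cintegrableB => //; exact: cintegrableZ.
rewrite cintegralB//; last exact: cintegrableZ.
rewrite cintegralZ// e1 e2 cpowB cpow_nat// cpowN.
have xn : x != 0 by rewrite gt_eqF.
have xn' : (x%:C : R[i]) != 0 by rewrite -normc_eq0 normc_real normr_eq0.
have kn : (k.+1%:R : R[i]) != 0 by rewrite pnatr_eq0.
have sk : s - k.+1%:R != 0 by exact: strip_neq0'.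
have ks : k.+1%:R - s != 0 by rewrite -oppr_eq0 opprB.
have cx := cpow_neq0 x s.
rewrite -[s - _]opprB invrN /K rmorphM rmorphN rmorphXn rmorphXn/= fmorphV/= exprVn exprS.
have xk : (x%:C : R[i]) ^+ k != 0 by rewrite expf_neq0.
move: kn ks xn' cx xk; move: (x%:C : R[i]) (x%:C ^+ k) (cpow x s) (k.+1%:R : R[i]).
move=> y X C q q0 qs y0 C0 X0; field.
by rewrite q0 qs C0 y0 X0.
Qed.

(** Right of [x] one has rho = x / t and 1 / (t - x) = sum_k x^k / t^(k+1). The decay chosen for rho
    makes the harmonic part the exact opposite of the one on the left. *)
Lemma reg_high_term s x k : 0 < Re s -> Re s < 1 -> 0 < x ->
  cintegrable mu `]x, +oo[ (fun t => (cpow t (- s) - cpow x (- s) * (x / t)%:C) * (t^-1 * (x / t) ^+ k)%:C) /\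
  cintegral mu `]x, +oo[ (fun t => (cpow t (- s) - cpow x (- s) * (x / t)%:C) * (t^-1 * (x / t) ^+ k)%:C) =
  cpow x (- s) * ((s + k%:R)^-1 - k.+1%:R^-1).
Proof.
move=> s0 s1 x0; pose K : R[i] := (x ^+ k)%:C.
have z1 : 0 < Re (s + k%:R) by rewrite ReDn ltr_wpDr.
have z2 : 0 < Re (k.+1%:R : R[i]) by rewrite -[k.+1%:R]add0r ReDn/= add0r ltr0n.
have [i1 e1] := cintegral_cpow_high x0 z1.
have [i2 e2] := cintegral_cpow_high x0 z2.
pose G t := K * (cpow t (- (s + k%:R) - 1) - cpow x (- s) * x%:C * cpow t (- k.+1%:R - 1)).
have E t : `]x, +oo[%classic t ->
    (cpow t (- s) - cpow x (- s) * (x / t)%:C) * (t^-1 * (x / t) ^+ k)%:C = G t.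
  rewrite /= in_itv/= andbT => xt; have t0 : 0 < t := lt_trans x0 xt.
  have tn : (t%:C : R[i]) != 0 by rewrite -normc_eq0 normc_real normr_eq0 gt_eqF.
  rewrite /G /K opprD !cpowB !(cpowN t) !cpow_nat// cpow1// exprS exprMn exprVn.
  rewrite !(rmorphM, fmorphV, rmorphXn)/=.
  have tk : (t%:C : R[i]) ^+ k != 0 by rewrite expf_neq0.
  have ct := cpow_neq0 t s.
  move: tn tk ct; move: (t%:C : R[i]) (t%:C ^+ k : R[i]) (cpow t s) (x%:C ^+ k) => y T C X y0 T0 C0.
  by field; rewrite C0 T0 y0.
have iG : cintegrable mu `]x, +oo[ G.
  by apply: cintegrableZ => //; apply: cintegrableB => //; exact: cintegrableZ.
split; first by apply: eq_cintegrable iG => // t /E.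
rewrite (@eq_cintegral _ _ _ mu _ _ _ E) cintegralZ//; last first.
  by apply: cintegrableB => //; exact: cintegrableZ.
rewrite cintegralB//; last exact: cintegrableZ.
rewrite cintegralZ// e1 e2 opprD cpowB !cpowN !cpow_nat// exprS rmorphM/= /K.
have xn : (x%:C : R[i]) != 0 by rewrite -normc_eq0 normc_real normr_eq0 gt_eqF.
have kn : (k.+1%:R : R[i]) != 0 by rewrite pnatr_eq0.
have sk := strip_neq0 k s0.
have cx := cpow_neq0 x s.
rewrite rmorphXn/=.
have xk : (x%:C : R[i]) ^+ k != 0 by rewrite expf_neq0.
move: kn sk xn cx xk; move: (x%:C : R[i]) (x%:C ^+ k) (cpow x s) (k.+1%:R : R[i]) (s + k%:R).
move=> y X C q w q0 w0 y0 C0 X0; field.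
by rewrite q0 w0 C0 y0 X0.
Qed.

(** The factor 1 - m^n, with m the smaller of t / x and x / t, cuts the geometric series of 1 / (t -
    x) after n terms on both sides at once. It lies between 0 and 1, so [reg] itself provides the
    majorant, and the integrals are exactly the partial sums [cot_sum n s] times the power. *)
Lemma reg_integral s x : 0 < Re s -> Re s < 1 -> 0 < x ->
  cintegral mu Rplus (reg (cpow ^~ (- s)) x) =
  (pi : R)%:C * ccot ((pi : R)%:C * s) * cpow x (- s).
Proof.
move=> s0 s1 x0; have ireg := cintegrable_reg s0 s1 x0.
set f := reg _ x in ireg *.
pose m t : R := if t <= x then t / x else x / t.
have m01 t : Rplus t -> 0 <= m t <= 1.
  rewrite /Rplus/= in_itv/= andbT => t0; rewrite /m; case: (leP t x) => h.
    by rewrite divr_ge0 ?(ltW t0) ?(ltW x0)//= ler_pdivrMr// mul1r.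
  by rewrite divr_ge0 ?(ltW t0) ?(ltW x0)//= ler_pdivrMr// mul1r ltW.
have mm : measurable_fun (setT : set R) m.
  have -> : m = (fun t => \1_(`]-oo, x]%classic : set R) t * (t / x) +
      \1_(`]x, +oo[%classic : set R) t * (x * t^-1)).
    apply/funext => t; rewrite /m !indicE !mem_setE !in_itv/= andbT.
    by case: (leP t x) => h; rewrite ?mul0r ?addr0 ?mul1r ?add0r.
  apply: measurable_funD; (apply: measurable_funM; first exact: measurable_indic).
    by apply: measurable_funM; [exact: measurable_id|exact: measurable_cst].
  apply: measurable_funM; first exact: measurable_cst.
  exact/measurable_funV/measurable_id.
pose u n t : R[i] := (1 - m t ^+ n)%:C * f t.
have mu_ n : cmeasurable Rplus (u n).
  apply: cmeasurableM; last exact: (cintegrable_measurable ireg).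
  apply: cmeasurable_real; apply: measurable_funTS.
  by apply: measurable_funB; [exact: measurable_cst|exact: measurable_funX].
have ub n t : Rplus t -> normc (u n t) <= normc (f t).
  move=> /m01/andP[h0 h1]; rewrite /u normc_mulM normc_real ler_piMl ?normc_ge0//.
  have := exprn_ge0 n h0; have := exprn_ile1 n h0 h1.
  by move=> a b; rewrite ger0_norm; lra.
have cu t : Rplus t -> ccvg \oo (fun n => u n t) (f t).
  move=> /[dup] Dt /m01/andP[h0 h1]; rewrite -[X in ccvg _ _ X]mul1r.
  have [tx|tx] := eqVneq t x.
    by apply: (eq_ccvg (ccvg_cst _)) => n; rewrite /u /f /reg tx subrr invr0 !mulr0.
  apply: ccvgM; last exact: ccvg_cst.
  suff h : ccvg \oo (fun n => (1 - m t ^+ n)%:C) 1%:C by exact: h.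
  apply: ccvg_real; rewrite -[X in _ --> X]subr0.
  apply: cvgB; first exact: cvg_cst.
  apply: cvg_expr; rewrite ger0_norm// lt_neqAle h1 andbT.
  move: Dt; rewrite /Rplus/= in_itv/= andbT => t0.
  rewrite /m; case: (leP t x) => h.
    by apply: contra tx => /eqP e; rewrite -(mulfVK (lt0r_neq0 x0) t) e mul1r.
  by apply: contra tx => /eqP e; rewrite eq_sym -(mulfVK (lt0r_neq0 t0) x) e mul1r.
have [_ cI] := cdominated_cvg measurable_Rplus mu_ (cintegrable_measurable ireg)
  (cintegrable_norm measurable_Rplus ireg) cu ub.
have eI n : cintegral mu Rplus (u n) = cot_sum n s * cpow x (- s).
  have iu : cintegrable mu Rplus (u n).
    exact: (cintegrable_dom measurable_Rplus (mu_ n) (cintegrable_norm measurable_Rplus ireg) (ub n)).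
  rewrite (RplusE x0) in iu *.
  rewrite cintegralU//; last exact: Rplus_disj.
  have e1 t : `]0, x]%classic t -> u n t =
      \sum_(k < n) (cpow t (- s) - cpow x (- s)) * (- x^-1 * (t / x) ^+ k)%:C.
    rewrite /= in_itv/= => /andP[t0 tx].
    rewrite -mulr_sumr -rmorph_sum/= -mulr_sumr /u /f /reg /m /rho tx mulr1.
    have [->|txn] := eqVneq t x; first by rewrite !subrr invr0 !mulr0 mul0r.
    rewrite mulrCA -(fmorphV (real_complex R)) -rmorphM/=; congr (_ * _).
    rewrite -sum_expr_geom; congr (_%:C).
    have xn : x != 0 by rewrite gt_eqF.
    have txn' : t - x != 0 by rewrite subr_eq0.
    by move: (\sum_(k < n) _) => S; field; rewrite xn txn'.
  have e2 t : `]x, +oo[%classic t -> u n t =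
      \sum_(k < n) (cpow t (- s) - cpow x (- s) * (x / t)%:C) * (t^-1 * (x / t) ^+ k)%:C.
    rewrite /= in_itv/= andbT => xt; have t0 : 0 < t := lt_trans x0 xt.
    rewrite -mulr_sumr -rmorph_sum/= -mulr_sumr /u /f /reg /m /rho leNgt xt/=.
    rewrite mulrCA -(fmorphV (real_complex R)) -rmorphM/=; congr (_ * _).
    rewrite -sum_expr_geom; congr (_%:C).
    have tn : t != 0 by rewrite gt_eqF.
    have txn' : t - x != 0 by rewrite subr_eq0 gt_eqF.
    by move: (\sum_(k < n) _) => S; field; rewrite tn txn'.
  rewrite (@eq_cintegral _ _ _ mu _ _ _ e1) (@eq_cintegral _ _ _ mu _ _ _ e2).
  rewrite cintegral_sum//; last by move=> k; exact: (reg_low_term k s0 s1 x0).1.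
  rewrite cintegral_sum//; last by move=> k; exact: (reg_high_term k s0 s1 x0).1.
  rewrite -big_split mulr_suml; apply: eq_bigr => k _ /=.
  rewrite (reg_low_term k s0 s1 x0).2 (reg_high_term k s0 s1 x0).2; ring.
have c2 : ccvg \oo (fun n => cintegral mu Rplus (u n))
    ((pi : R)%:C * ccot ((pi : R)%:C * s) * cpow x (- s)).
  apply: (@eq_ccvg _ _ _ (fun n => cot_sum n s * cpow x (- s))) => //.
  by apply: ccvgM; [exact: cot_partial_fractions|exact: ccvg_cst].
exact: ccvg_unique cI c2.
Qed.

End RegularizedIntegral.

(** * Principal values through the regularized kernel *)

Section PrincipalValue.
Context {R : realType}.
Local Notation mu := (@lebesgue_measure R).
Implicit Types (x t c e : R) (s : R[i]) (phi : R -> R[i]) (n k : nat).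

Lemma is_derive_ln_comp (g : R -> R) t (l : R) : is_derive t (1 : R) g l ->
  0 < g t -> is_derive t (1 : R) (fun t => ln (g t)) ((g t)^-1 * l).
Proof.
move=> dg g0; have h := is_derive1_ln g0.
exact: (@is_derive1_comp R (@ln R) g t _ _ h dg).
Qed.

Lemma is_derive_inv_comp (g : R -> R) t (l : R) : is_derive t (1 : R) g l ->
  g t != 0 -> is_derive t (1 : R) (fun t => (g t)^-1) (- (g t) ^- 2 *: l).
Proof. by move=> dg g0; exact: (@is_deriveV R g t l 1 g0 dg). Qed.

Lemma measurable_pv_domain x e : measurable (pv_domain x e : set (measurableTypeR R)).
Proof.
have -> : pv_domain x e = Rplus `&` ([set` `]-oo, x - e[] `|` [set` `]x + e, +oo[]).
  apply/seteqP; split => t; rewrite /pv_domain /Rplus/= !in_itv/= !andbT.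
    move=> [t0]; rewrite ltr_normr => /orP[h|h]; split => //; [right|left]; lra.
  move=> [t0 h]; split => //; rewrite ltr_normr; apply/orP.
  by case: h => h; [right|left]; lra.
by apply: measurableI; [exact: measurable_Rplus|apply: measurableU; exact: measurable_itv].
Qed.

Lemma pv_domain_split x e : 0 < x -> 0 < e -> e < x ->
  pv_domain x e = (`]0, x - e[ `|` `]x + e, +oo[)%classic :> set R.
Proof.
move=> x0 e0 ex; apply/seteqP; split => t; rewrite /pv_domain /= !in_itv/= !andbT.
  move=> [t0]; rewrite ltr_normr => /orP[h|h]; [right|left]; first lra.
  by apply/andP; split; lra.
rewrite ltr_normr; move=> [/andP[h1 h2]|h]; split; rewrite ?h1//; lra.
Qed.

Definition rho_kernel x t : R := rho x t / (t - x).

Lemma rho_kernel_low x e : 0 < x -> 0 < e -> e < x ->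
  mu.-integrable `]0, (x - e)[ (EFin \o rho_kernel x) /\
  Rintegral mu `]0, x - e[ (rho_kernel x) = ln e - ln x.
Proof.
move=> x0 e0 ex; have xe : 0 <= x - e by rewrite subr_ge0 ltW.
pose p t : R := - (x - t)^-1.
have dom t : 0 <= t <= x - e -> 0 < x - t by move=> /andP[_ h]; lra.
have dx t : is_derive t (1 : R) (fun t => x - t) (0 - 1).
  by apply: is_derive_sub.
have dP t : 0 <= t <= x - e -> is_derive t (1 : R) (fun t => ln (x - t)) (p t).
  move=> /dom h.
  apply: (is_derive_eqv (is_derive_ln_comp (dx t) h)) => //.
  by rewrite sub0r mulrN1.
have cp t : 0 <= t <= x - e -> {for t, continuous p}.
  move=> /dom h.
  have hV := is_derive_inv_comp (dx t) (lt0r_neq0 h).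
  apply: cvgN; exact: (is_derive_continuous hV).
have ip := integrable_continuous cp.
have sub : `]0, x - e[%classic `<=` `[0, x - e]%classic.
  exact: subset_itv_oo_cc.
have E t : `]0, x - e[%classic t -> p t = rho_kernel x t.
  rewrite /= in_itv/= => /andP[t0 tx]; rewrite /rho_kernel /rho ifT; last by lra.
  by rewrite div1r /p -invrN opprB.
have i1 : mu.-integrable `]0, (x - e)[ (EFin \o p).
  by apply: (@integrableS _ _ _ mu `[0, x - e]%classic).
split.
  by apply: eq_integrable i1 => // t /set_mem Dt /=; rewrite (E t Dt).
have -> : Rintegral mu `]0, x - e[ (rho_kernel x) = Rintegral mu `]0, x - e[ p.
  by apply: eq_Rintegral => t /set_mem Dt; exact: (esym (E t Dt)).
have i2 : mu.-integrable `[0, (x - e)[ (EFin \o p).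
  apply: (@integrableS _ _ _ mu `[0, x - e]%classic) => //.
  exact: subset_itv_co_cc.
rewrite Rintegral_itv_obnd_cbnd// Rintegral_itv_bndo_bndc//.
by rewrite (Rintegral_FTC2 xe dP cp) subr0 subKr.
Qed.

Lemma rho_kernel_high x e : 0 < x -> 0 < e ->
  mu.-integrable `](x + e), +oo[ (EFin \o rho_kernel x) /\
  Rintegral mu `]x + e, +oo[ (rho_kernel x) = ln (x + e) - ln e.
Proof.
move=> x0 e0; pose y := x + e.
have y0 : 0 < y by rewrite addr_gt0.
have hh n : 0 < hseq n :> R by exact: hseq_gt0.
pose a n := y * (1 + hseq n); pose b n := y * (hseq n : R)^-1.
have h1 n t : a n <= t -> y < t.
  by apply: lt_le_trans; rewrite /a -[ltLHS]mulr1 ltr_pM2l// ltrDl hseq_gt0.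
pose P t : R := ln (t - x) - ln t.
have pos n t : a n <= t <= b n -> 0 < t /\ 0 < t - x.
  by move=> /andP[/h1 h _]; rewrite /y in h; split; lra.
have E t : y < t -> rho_kernel x t = (t - x)^-1 - t^-1.
  rewrite /y => yt; rewrite /rho_kernel /rho ifF; last by apply/negbTE; rewrite -ltNge; lra.
  field; apply/andP; split; [apply/eqP => ?|apply/eqP => ?]; lra.
have dP n t : a n <= t <= b n -> is_derive t (1 : R) P ((t - x)^-1 - t^-1).
  move=> /pos[t0 tx].
  have dx : is_derive t (1 : R) (fun t => t - x) (1 - 0) by apply: is_derive_sub.
  apply: is_derive_sub; last exact: is_derive1_ln.
  apply: (is_derive_eqv (is_derive_ln_comp dx tx)) => //.
  by rewrite subr0 mulr1.
have dp t : 0 < t -> 0 < t - x -> exists l, is_derive t (1 : R) (fun t => (t - x)^-1 - t^-1) l.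
  move=> t0 tx.
  have dx : is_derive t (1 : R) (fun t => t - x) (1 - 0) by apply: is_derive_sub.
  eexists; apply: is_derive_sub.
    exact: (is_derive_inv_comp dx (lt0r_neq0 tx)).
  exact: (is_derive_inv_comp (is_derive_id t 1) (lt0r_neq0 t0)).
have cp n t : a n <= t <= b n -> {for t, continuous (fun t => (t - x)^-1 - t^-1)}.
  by move=> /pos[t0 tx]; have [l] := dp t t0 tx; exact: is_derive_continuous.
have i1 : mu.-integrable `]y, +oo[ (EFin \o (fun t => (t - x)^-1 - t^-1)).
  apply: (@Rintegral_FTC_lim _ _ a b P _ (ln y - ln e)) => //.
  - by move=> n; exact: hseq_high_le.
  - by move=> n; exact: hseq_high_dec.
  - by move=> n; exact: hseq_high_inc.
  - by move=> n t /andP[h _] /=; rewrite in_itv/= andbT (h1 n)// ltW.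
  - by move=> t /=; rewrite in_itv/= andbT => xt; exact: near_hseq_high.
  - move=> n t /pos[t0 tx]; rewrite subr_ge0 lef_pV2 ?posrE//; lra.
  - move=> n.
    have /andP[an bn] : a n <= a n <= b n by rewrite lexx hseq_high_le.
    have [b0 bx] : 0 < b n /\ 0 < b n - x by apply: (pos n); rewrite bn lexx.
    have [a0 ax] : 0 < a n /\ 0 < a n - x by apply: (pos n); rewrite bn lexx.
    apply: (@le_trans _ _ (0 - P (a n))).
      rewrite lerD2r /P subr_le0 ler_ln ?posrE//; lra.
    have hy := h1 n _ an.
    rewrite sub0r /P opprB.
    (* The primitive ln ((t - x) / t) increases with t, hence at [a n] it is at least its value ln
       (e / y) at y = x + e. *)
    have : ln (a n / y) <= ln ((a n - x) / e).
      rewrite ler_ln ?posrE ?divr_gt0// ler_pdivrMr// mulrAC ler_pdivlMr//.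
      have hy' : 0 <= x * (a n - y) by apply: mulr_ge0; [exact: ltW|rewrite subr_ge0 ltW].
      have ey : y = x + e by [].
      by move: hy'; rewrite ey; move: (a n) => q; nra.
    rewrite !ln_div ?posrE//; lra.
have i2 : mu.-integrable `]y, +oo[ (EFin \o rho_kernel x).
  apply: eq_integrable i1 => // t /set_mem/=; rewrite in_itv/= andbT => h.
  by rewrite E.
split => //.
suff : cintegral mu `]y, +oo[ (fun t => (rho_kernel x t)%:C) = (ln y - ln e)%:C.
  by rewrite cintegral_real => /complexI.
have -> : cintegral mu `]y, +oo[ (fun t => (rho_kernel x t)%:C) =
    cintegral mu `]y, +oo[ (fun t => ((t - x)^-1 - t^-1)%:C).
  by apply: eq_cintegral => t /=; rewrite in_itv/= andbT => h; rewrite E.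
apply: (@cintegral_FTC_lim _ _ a b (fun t => (P t)%:C)) => //.
- by move=> n; exact: hseq_high_le.
- by move=> n t /andP[h _] /=; rewrite in_itv/= andbT (h1 n)// ltW.
- by move=> t /=; rewrite in_itv/= andbT => xt; exact: near_hseq_high.
- by move=> n t h; apply: cderiv_real; exact: dP h.
- move=> n t /pos[t0 tx]; have [l hl] := dp t t0 tx; exists l%:C; exact: cderiv_real.
- exact: cintegrable_real.
under [X in ccvg _ X]eq_fun do rewrite -rmorphB/=.
apply: ccvg_real.
have -> : ln y - ln e = 0 - P y by rewrite /P /y addrAC subrr !add0r opprB.
have yx : 0 < y - x by rewrite /y; lra.
have cPy : {for y, continuous P}.
  have [l hl] : exists l, is_derive y (1 : R) P l.
    have dx : is_derive y (1 : R) (fun t => t - x) (1 - 0) by apply: is_derive_sub.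
    eexists; apply: is_derive_sub; last exact: is_derive1_ln.
    exact: (is_derive_ln_comp dx yx).
  exact: is_derive_continuous hl.
apply: cvgB.
  have e1 n : P (b n) = ln (1 - x / y * hseq n).
    have [b0 bx] : 0 < b n /\ 0 < b n - x by apply: (pos n); rewrite lexx hseq_high_le.
    rewrite /P -ln_div ?posrE//; congr ln; rewrite /b.
    by field; rewrite ?(gt_eqF y0) ?(gt_eqF (hh n)).
  have c1 : 1 - x / y * hseq n @[n --> \oo] --> (1 : R).
    rewrite -[X in _ --> X](subr0 1); apply: cvgB; first exact: cvg_cst.
    by rewrite -(mulr0 (x / y)); apply: cvgM; [exact: cvg_cst|exact: cvg_hseq].
  have h : ln (1 - x / y * hseq n) @[n --> \oo] --> (ln 1 : R).
    exact: (cvg_comp _ _ c1 (continuous_ln ltr01)).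
  rewrite ln1 in h; apply: cvg_trans h; apply: near_eq_cvg.
  by apply: nearW => n; rewrite e1.
have ca : a n @[n --> \oo] --> y.
  rewrite -[X in _ --> X]mulr1; apply: cvgM; first exact: cvg_cst.
  rewrite -[X in _ --> X]addr0; apply: cvgD; first exact: cvg_cst.
  exact: cvg_hseq.
exact: (cvg_comp _ _ ca cPy).
Qed.

(** The singular logarithms of [e] on the two sides cancel. What remains tends to 0 with [e], so the
    reference function has principal value 0. *)
Lemma rho_kernel_pv x e : 0 < x -> 0 < e -> e < x ->
  mu.-integrable (pv_domain x e) (EFin \o rho_kernel x) /\
  Rintegral mu (pv_domain x e) (rho_kernel x) = ln (x + e) - ln x.
Proof.
move=> x0 e0 ex; have [i1 e1] := rho_kernel_low x0 e0 ex.
have [i2 e2] := rho_kernel_high x0 e0.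
have m1 : measurable (`]0, x - e[%classic : set (measurableTypeR R)) by exact: measurable_itv.
have m2 : measurable (`]x + e, +oo[%classic : set (measurableTypeR R)) by exact: measurable_itv.
have iC := cintegrableU m1 m2 (cintegrable_real i1) (cintegrable_real i2).
rewrite (pv_domain_split x0 e0 ex).
split; first exact: iC.1.
have dis : [disjoint (`]0, x - e[%classic : set (measurableTypeR R)) & `]x + e, +oo[%classic].
  apply/disj_setPLR => t /=; rewrite !in_itv/= andbT => /andP[_ h].
  by apply/negP; rewrite -leNgt; lra.
have := cintegralU m1 m2 dis iC; rewrite !cintegral_real -rmorphD/= e1 e2 => /complexI ->.
ring.
Qed.

Lemma cintegrable_pv phi x e : 0 < x -> 0 < e -> 
  cintegrable mu Rplus (reg phi x) ->
  cintegrable mu (pv_domain x e) (pv_kernel phi x).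
Proof.
move=> x0 e0 ir.
(* The domain shrinks as [e] grows, so for e >= x it lies inside the domain for x / 2. *)
wlog ex : e e0 / e < x => [H|].
  case: (ltP e x) => h; first exact: H.
  have x2 : 0 < x / 2 by rewrite divr_gt0.
  have ex2 : x / 2 < x by lra.
  apply: (cintegrableS (measurable_pv_domain x (x / 2)) (measurable_pv_domain x e) _ (H _ x2 ex2)).
  by move=> t [t0 te]; split => //; apply: lt_trans te; lra.
have [irho _] := rho_kernel_pv x0 e0 ex.
have ir' : cintegrable mu (pv_domain x e) (reg phi x).
  apply: (cintegrableS measurable_Rplus (measurable_pv_domain x e) _ ir).
  by move=> t [t0 _]; rewrite /Rplus/= in_itv/= t0.
have := cintegrableD (measurable_pv_domain x e) ir'
  (cintegrableZ (measurable_pv_domain x e) (phi x) (cintegrable_real irho)).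
apply: (eq_cintegrable (measurable_pv_domain x e)) => t [t0 te].
rewrite /reg /pv_kernel /rho_kernel rmorphM/= fmorphV/=.
by rewrite mulrBl -mulrA subrK.
Qed.

(** Off [x] the kernel is [reg] plus [phi x] times [rho_kernel]. The second part contributes a
    vanishing logarithm, and the first is integrable across [x], so dominated convergence applies
    along every sequence of radii. *)
Lemma pv_limit phi x : 0 < x -> cintegrable mu Rplus (reg phi x) ->
  ccvg (0 : R)^'+ (fun e => cintegral mu (pv_domain x e) (pv_kernel phi x))
    (cintegral mu Rplus (reg phi x)).
Proof.
move=> x0 ir; set I := cintegral mu Rplus _.
have seqlim (u : nat -> R) : (forall n, 0 < u n) -> u n @[n --> \oo] --> (0 : R) ->
    ccvg \oo (fun n => cintegral mu (pv_domain x (u n)) (pv_kernel phi x)) I.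
  move=> u0 cu.
  (* The point [x] belongs to no truncated domain; without it every point is eventually covered, and
     the integral is unchanged because [reg] is 0 at [x]. *)
  pose D : set (measurableTypeR R) := Rplus `\ x.
  have mD : measurable D.
    by apply: measurableD; [exact: measurable_Rplus|exact: measurable_set1].
  have iD : cintegrable mu D (reg phi x).
    by apply: (cintegrableS measurable_Rplus mD _ ir) => t [].
  have ID : cintegral mu D (reg phi x) = I.
    rewrite /I cintegral_mkcond [RHS]cintegral_mkcond; apply: eq_cintegral => t _.
    have [->|tx] := eqVneq t x; first by rewrite /reg subrr invr0 !mulr0.
    congr (_%:C * _); rewrite !indicE; congr (_%:R); congr nat_of_bool.
    apply/idP/idP => /set_mem h; apply/mem_set; first by case: h.
    by split => //; apply/eqP.
  have c1 : ccvg \oo (fun n => cintegral mu (pv_domain x (u n)) (reg phi x)) I.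
    rewrite -ID; apply: cintegral_bigcup_cvg => //.
    - by move=> n; exact: measurable_pv_domain.
    - move=> n t [t0 tu]; split; first by rewrite /Rplus/= in_itv/= t0.
      by move=> /= tx; move: tu; rewrite tx subrr normr0 ltNge ltW.
    - move=> t [/= t0 tx]; near=> n; split.
        by move: t0; rewrite /Rplus/= in_itv/= andbT.
      near: n; apply: (cvgr_lt _ cu); rewrite normr_gt0 subr_eq0; exact/eqP.
  have c2 : ccvg \oo (fun n => cintegral mu (pv_domain x (u n)) (reg phi x) +
      phi x * (ln (x + u n) - ln x)%:C) I.
    rewrite -[X in ccvg _ _ X]addr0 -(mulr0 (phi x)); apply: ccvgD => //.
    apply: ccvgM; first exact: ccvg_cst.
    suff h : ccvg \oo (fun n => (ln (x + u n) - ln x)%:C) (0%:C) by exact: h.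
    apply: ccvg_real; rewrite -(subrr (ln x)).
    have cx : x + u n @[n --> \oo] --> x.
      by rewrite -[X in _ --> X]addr0; apply: cvgD => //; exact: cvg_cst.
    exact: cvgB (cvg_comp _ _ cx (continuous_ln x0)) (cvg_cst _).
  have main : \forall n \near \oo, cintegral mu (pv_domain x (u n)) (pv_kernel phi x) =
      cintegral mu (pv_domain x (u n)) (reg phi x) + phi x * (ln (x + u n) - ln x)%:C.
    apply: filterS (cvgr_lt _ cu _ x0) => n un.
    have [irho erho] := rho_kernel_pv x0 (u0 n) un.
    have mE := measurable_pv_domain x (u n).
    have ir' : cintegrable mu (pv_domain x (u n)) (reg phi x).
      apply: (cintegrableS measurable_Rplus mE _ ir).
      by move=> t [t0 _]; rewrite /Rplus/= in_itv/= t0.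
    have irC := cintegrable_real irho.
    rewrite -erho -cintegral_real -(cintegralZ mE)// -(cintegralD mE)//; last first.
      exact: cintegrableZ.
    apply: eq_cintegral => t [t0 te].
    rewrite /reg /pv_kernel /rho_kernel rmorphM/= fmorphV/=.
    by rewrite mulrBl -mulrA subrK.
  case: c2 => c21 c22; split.
    by apply: cvg_trans c21; apply: near_eq_cvg; apply: filterS main => n ->.
  by apply: cvg_trans c22; apply: near_eq_cvg; apply: filterS main => n ->.
by split; apply/cvg_at_rightP => u [u0 cu]; have [] := seqlim u u0 cu.
Unshelve. all: by end_near. Qed.

End PrincipalValue.

(** * Term by term integration of the logarithmic kernel *)

Section LogSeries.
Context {R : realType}.
Implicit Types (v : R) (n k : nat).

Definition log_sum n v : R := \sum_(k < n) v ^+ k.+1 / k.+1%:R.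

Lemma is_derive_log_sum n v : v < 1 ->
  is_derive v (1 : R) (fun v => ln (1 - v) + log_sum n v) (- (v ^+ n / (1 - v))).
Proof.
move=> v1; have v0 : 0 < 1 - v by rewrite subr_gt0.
have d1 : is_derive v (1 : R) (fun v => 1 - v) (0 - 1) by apply: is_derive_sub.
have dk k : is_derive v (1 : R) (fun v => v ^+ k.+1 / k.+1%:R) (v ^+ k).
  have h := is_derive_mul (is_deriveX k.+1 (is_derive_id v (1 : R))) (is_derive_cst (k.+1%:R^-1 : R) v (1 : R)).
  apply: (is_derive_eqv h); first by apply/funext => u /=; rewrite fctE.
  rewrite mulr0 addr0 /GRing.scale/= mulr1 mulrAC mulfV ?mul1r// pnatr_eq0//.
have ds : is_derive v (1 : R) (log_sum n) (\sum_(k < n) v ^+ k).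
  elim: n => [|n IH].
    rewrite big_ord0; apply: (is_derive_eqv (is_derive_cst (0 : R) v (1 : R))) => //.
    by apply/funext => u; rewrite /log_sum big_ord0.
  rewrite big_ord_recr/=; apply: (is_derive_eqv (is_derive_add IH (dk n))) => //.
  by apply/funext => u; rewrite /log_sum big_ord_recr.
apply: (is_derive_eqv (is_derive_add (is_derive_ln_comp d1 v0) ds)) => //.
have vn : 1 - v != 0 by rewrite gt_eqF.
apply: (mulfI vn); rewrite mulrDr sum_expr_geom; field.
exact: vn.
Qed.

(** Mean value theorem for the remainder, whose derivative is -v^n / (1 - v). The upper bound makes
    -ln (1 - v) a majorant of the partial sums, the lower one gives their convergence. *)
Lemma log_sum_bound n v : 0 <= v -> v < 1 ->
  - (v ^+ n / (1 - v)) <= ln (1 - v) + log_sum n v <= 0.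
Proof.
rewrite le_eqVlt => /orP[/eqP<- _|v0 v1].
  have e : log_sum n 0 = 0 :> R.
    by rewrite /log_sum big1// => k _; rewrite expr0n mul0r.
  by rewrite e subr0 ln1 addr0 lexx andbT oppr_le0 divr1 exprn_ge0.
have dD (u : R) : u < 1 -> is_derive u (1 : R) (fun v => ln (1 - v) + log_sum n v) (- (u ^+ n / (1 - u))).
  exact: is_derive_log_sum.
have [||c] := @MVT R (fun v => ln (1 - v) + log_sum n v) (fun u => - (u ^+ n / (1 - u))) 0 v v0.
- by move=> u; rewrite in_itv/= => /andP[_ uv]; apply: dD; exact: lt_trans v1.
- apply: continuous_on_within => u /andP[_ uv].
  by apply: (is_derive_continuous (dD u _)); exact: le_lt_trans v1.
rewrite in_itv/= => /andP[c0 cv].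
have e : log_sum n 0 = 0 :> R.
  by rewrite /log_sum big1// => k _; rewrite expr0n mul0r.
rewrite e subr0 ln1 addr0 !subr0 => ->.
have c1 : 0 < 1 - c by rewrite subr_gt0 (lt_trans cv).
have v1' : 0 < 1 - v by rewrite subr_gt0.
have h : 0 <= c ^+ n / (1 - c) by rewrite divr_ge0 ?exprn_ge0// ltW.
have h2 : c ^+ n / (1 - c) <= v ^+ n / (1 - v).
  apply: ler_pM; rewrite ?exprn_ge0 ?invr_ge0 ?(ltW c0) ?(ltW c1)//.
    by apply: lerXn2r; rewrite ?nnegrE ?ltW.
  by rewrite lef_pV2 ?posrE//; lra.
move: h h2; move: (c ^+ n / (1 - c)) (v ^+ n / (1 - v)) => p q h h2.
by apply/andP; split; nra.
Qed.

Lemma log_sum_le n v : 0 <= v -> v < 1 -> log_sum n v <= - ln (1 - v).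
Proof. by move=> v0 v1; have /andP[_] := log_sum_bound n v0 v1; lra. Qed.

Lemma log_sum_ge0 n v : 0 <= v -> 0 <= log_sum n v.
Proof. by move=> v0; apply: sumr_ge0 => k _; rewrite divr_ge0// exprn_ge0. Qed.

Lemma cvg_log_sum v : 0 <= v -> v < 1 -> log_sum n v @[n --> \oo] --> - ln (1 - v).
Proof.
move=> v0 v1; apply/subr_cvg0.
have h : v ^+ n / (1 - v) @[n --> \oo] --> (0 : R).
  rewrite -(mul0r (1 - v)^-1); apply: cvgM; last exact: cvg_cst.
  by apply: cvg_expr; rewrite ger0_norm.
apply: norm_cvg0; apply: (squeeze_cvgr _ (cvg_cst 0) h); near=> n.
have := log_sum_bound n v0 v1; rewrite normr_ge0 opprK addrC => /andP[h1 h2].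
by rewrite ler0_norm//; lra.
Unshelve. all: by end_near. Qed.

End LogSeries.

Section LogSeriesIntegral.
Context {R : realType} {d : measure_display} {T : measurableType d}.
Variables (m : {measure set T -> \bar R}) (D : set T).
Hypothesis mD : measurable D.

Lemma integrable_mono_lim (g_ : nat -> T -> R) (g : T -> R) (M : R) :
  (forall n, measurable_fun D (g_ n)) -> measurable_fun D g ->
  (forall n x, D x -> 0 <= g_ n x) ->
  (forall n x, D x -> g_ n x <= g_ n.+1 x) ->
  (forall x, D x -> g_ n x @[n --> \oo] --> g x) ->
  (forall n, m.-integrable D (EFin \o g_ n)) ->
  (forall n, Rintegral m D (g_ n) <= M) ->
  m.-integrable D (EFin \o g).
Proof.
move=> mg_ mg g0 nd cg ig hM.
have gpos x : D x -> 0 <= g x.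
  by move=> Dx; apply: (cvgr_to_ge (cg x Dx)); apply: nearW => n; exact: g0.
apply/integrableP; split; first exact/measurable_EFinP.
have -> : (\int[m]_(x in D) `|(EFin \o g) x| = \int[m]_(x in D) limn (fun n => (g_ n x)%:E))%E.
  apply: eq_integral => x /set_mem Dx /=; rewrite ger0_norm ?gpos//.
  apply/esym/cvg_lim => //; apply: cvg_EFin; [exact: nearW|exact: cg].
have c := @cvg_monotone_convergence _ _ _ m D mD (fun n x => (g_ n x)%:E).
have {}c := c (fun n => (measurable_EFinP _ _).2 (mg_ n)).
have {}c := c (fun n x Dx => g0 n x Dx).
have {}c : (\int[m]_(x in D) (g_ n x)%:E @[n --> \oo] -->
    \int[m]_(x in D) limn (fun n => (g_ n x)%:E))%E.
  apply: c => x Dx; apply/nondecreasing_seqP => n.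
  by rewrite lee_fin; exact: nd.
rewrite -(cvg_lim _ c)//; apply: (@le_lt_trans _ _ M%:E); last exact: ltry.
apply: lime_le; first exact: cvgP c.
apply: nearW => n; rewrite -[leLHS]fineK; last exact: integrable_fin_num (ig n).
by rewrite lee_fin; exact: hM.
Qed.

(** Two rounds. With |w| all terms have one sign, so the bound [M] and monotone convergence make -ln
    (1 - v) |w| integrable; this function then dominates the partial sums carrying the complex
    factor [w]. *)
Lemma clog_series (v : T -> R) (w : T -> R[i]) (M : R) (J : nat -> R[i]) :
  (forall x, D x -> 0 <= v x < 1) ->
  measurable_fun D v -> cmeasurable D w ->
  (forall k, cintegrable m D (fun x => (v x ^+ k.+1)%:C * w x)) ->
  (forall n, \sum_(k < n) k.+1%:R^-1 *
     Rintegral m D (fun x => v x ^+ k.+1 * normc (w x)) <= M) ->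
  (forall k, cintegral m D (fun x => (v x ^+ k.+1)%:C * w x) = J k) ->
  cintegrable m D (fun x => (ln (1 - v x))%:C * w x) /\
  ccvg \oo (fun n => - \sum_(k < n) (k.+1%:R^-1)%:C * J k)
    (cintegral m D (fun x => (ln (1 - v x))%:C * w x)).
Proof.
move=> v01 mv mw iv hM hJ.
have n_ge0 x : D x -> 0 <= v x by move=> /v01/andP[].
have v1 x : D x -> v x < 1 by move=> /v01/andP[].
have mln : measurable_fun D (fun x => ln (1 - v x)).
  apply: (measurableT_comp (@measurable_ln R)).
  by apply: measurable_funB => //; exact: measurable_cst.
have mnw := measurable_normc mw.
have mls n : measurable_fun D (fun x => log_sum n (v x)).
  elim: n => [|n IH].
    by under eq_fun do rewrite /log_sum big_ord0; exact: measurable_cst.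
  under eq_fun do rewrite /log_sum big_ord_recr/=.
  apply: measurable_funD => //.
  by apply: measurable_funM; [exact: measurable_funX|exact: measurable_cst].
have ir k : m.-integrable D (EFin \o (fun x => v x ^+ k.+1 * normc (w x))).
  apply: eq_integrable (cintegrable_norm mD (iv k)) => // x /set_mem Dx /=.
  by rewrite normc_mulM normc_real ger0_norm// exprn_ge0// n_ge0.
have ils n : m.-integrable D (EFin \o (fun x => log_sum n (v x) * normc (w x))) /\
   Rintegral m D (fun x => log_sum n (v x) * normc (w x)) =
   \sum_(k < n) k.+1%:R^-1 * Rintegral m D (fun x => v x ^+ k.+1 * normc (w x)).
  elim: n => [|n [IH1 IH2]].
    have e : (fun x => log_sum 0 (v x) * normc (w x)) = (fun=> 0).
      by apply/funext => x; rewrite /log_sum big_ord0 mul0r.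
    rewrite e big_ord0; split; first exact: integrable0.
    by rewrite /Rintegral integral0.
  have e : (fun x => log_sum n.+1 (v x) * normc (w x)) =
      (fun x => log_sum n (v x) * normc (w x) + n.+1%:R^-1 * (v x ^+ n.+1 * normc (w x))).
    by apply/funext => x; rewrite /log_sum big_ord_recr/=; ring.
  have i2 := integrable_scale mD n.+1%:R^-1 (ir n).
  rewrite e; split; first exact: integrable_plus.
  by rewrite RintegralD// IH2 big_ord_recr/= RintegralZl.
have im : m.-integrable D (EFin \o (fun x => - ln (1 - v x) * normc (w x))).
  apply: (@integrable_mono_lim (fun n x => log_sum n (v x) * normc (w x)) _ M).
  - by move=> n; exact: measurable_funM.
  - by apply: measurable_funM => //; exact: measurableT_comp.
  - by move=> n x Dx; rewrite mulr_ge0 ?normc_ge0// log_sum_ge0// n_ge0.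
  - move=> n x Dx; rewrite ler_wpM2r ?normc_ge0// /log_sum big_ord_recr/=.
    by rewrite lerDl divr_ge0// exprn_ge0// n_ge0.
  - move=> x Dx; apply: cvgM; last exact: cvg_cst.
    by apply: cvg_log_sum; [exact: n_ge0|exact: v1].
  - by move=> n; exact: (ils n).1.
  - by move=> n; rewrite (ils n).2.
pose u n x := (- log_sum n (v x))%:C * w x.
have [||i c] := @cdominated_cvg _ _ _ m D mD u (fun x => (ln (1 - v x))%:C * w x) _
  (fun n => cmeasurableM (cmeasurable_real (measurable_funN (mls n))) mw)
  (cmeasurableM (cmeasurable_real mln) mw) im _ _.
- move=> x Dx; apply: ccvgM; last exact: ccvg_cst.
  apply: ccvg_real; rewrite -[X in _ --> X]opprK; apply: cvgN.
  by apply: cvg_log_sum; [exact: n_ge0|exact: v1].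
- move=> n x Dx; rewrite normc_mulM normc_real ler_wpM2r ?normc_ge0// normrN.
  by rewrite ger0_norm ?log_sum_ge0 ?n_ge0// log_sum_le ?n_ge0 ?v1.
split => //; apply: eq_ccvg c _ => n.
pose U k x := (- k.+1%:R^-1)%:C * ((v x ^+ k.+1)%:C * w x).
have iU k : cintegrable m D (U k) by exact: cintegrableZ.
have -> : cintegral m D (u n) = cintegral m D (fun x => \sum_(k < n) U k x).
  apply: eq_cintegral => x _; rewrite /u /U /log_sum.
  rewrite -sumrN rmorph_sum mulr_suml; apply: eq_bigr => k _ /=.
  by rewrite mulrA -rmorphM/=; congr (_%:C * _); rewrite mulNr mulrC.
rewrite cintegral_sum// -sumrN; apply: eq_bigr => k _.
by rewrite cintegralZ// hJ rmorphN/= mulNr.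
Qed.

End LogSeriesIntegral.

Section LogPotential.
Context {R : realType}.
Local Notation mu := (@lebesgue_measure R).
Implicit Types (x y t c : R) (s : R[i]) (f : R -> R[i]) (n k : nat).

Lemma cintegral_itv_oo_oc (a b : R) f : cintegrable mu `]a, b] f ->
  cintegral mu `]a, b[ f = cintegral mu `]a, b] f.
Proof.
move=> [h1 h2]; have sub : `]a, b[%classic `<=` `]a, b]%classic by exact: subset_itv_oo_oc.
congr Complex; apply: Rintegral_itv_bndo_bndc.
  by apply: (@integrableS _ _ _ mu `]a, b]%classic).
by apply: (@integrableS _ _ _ mu `]a, b]%classic).
Qed.

Lemma indic_del (D : set R) f y t : f y = 0 ->
  (\1_(D `\ y) t)%:C * f t = (\1_D t)%:C * f t.
Proof.
move=> fy; have [->|tx] := eqVneq t y; first by rewrite fy !mulr0.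
congr (_%:C * _); rewrite !indicE; congr (_%:R); congr nat_of_bool.
apply/idP/idP => /set_mem h; apply/mem_set; first by case: h.
by split => //; apply/eqP.
Qed.

Lemma harmonic_sqr_le n : \sum_(k < n) (k.+1%:R ^+ 2)^-1 <= 2 :> R.
Proof.
case: n => [|n]; first by rewrite big_ord0.
rewrite big_ord_recl/= expr1n invr1 -[leRHS]/(1 + 1)%R lerD2l.
have := @sum_inv_sqr_le R 1 n.+2 isT; rewrite invr1; apply: le_trans.
by rewrite big_add1/= big_add1/= big_mkord.
Qed.

Lemma log_low_term s y k : 0 < Re s -> Re s < 1 -> 0 < y ->
  cintegrable mu `]0, y[ (fun t => ((t / y) ^+ k.+1)%:C * cpow t (- s)) /\
  cintegral mu `]0, y[ (fun t => ((t / y) ^+ k.+1)%:C * cpow t (- s)) =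
  cpow y (1 - s) * (k.+2%:R - s)^-1.
Proof.
move=> s0 s1 y0.
have z1 : 0 < Re (k.+2%:R - s).
  by rewrite -opprB ReN ReBn opprB subr_gt0 (lt_le_trans s1)// ler1n.
have [i e] := cintegral_cpow_low y0 z1.
pose K : R[i] := (y ^- k.+1)%:C.
have E t : `]0, y]%classic t ->
    ((t / y) ^+ k.+1)%:C * cpow t (- s) = K * cpow t (k.+2%:R - s - 1).
  rewrite /= in_itv/= => /andP[t0 _].
  have -> : k.+2%:R - s - 1 = k.+1%:R - s :> R[i] by rewrite -natr1; ring.
  rewrite [X in K * X]cpowD cpow_nat// exprMn exprVn rmorphM/=; ring.
have iK := @cintegrableZ _ _ _ mu _ (measurable_itv _) _ K i.
have iE : cintegrable mu `]0, y] (fun t => ((t / y) ^+ k.+1)%:C * cpow t (- s)).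
  by apply: eq_cintegrable iK => // t /E.
split.
  by apply: (@cintegrableS _ _ _ mu `]0, y]%classic) => //; exact: subset_itv_oo_oc.
rewrite cintegral_itv_oo_oc// (@eq_cintegral _ _ _ mu _ _ _ E) cintegralZ// e.
rewrite mulrA; congr (_ / _).
have -> : k.+2%:R - s = k.+1%:R + (1 - s) :> R[i] by rewrite -natr1; ring.
rewrite cpowD cpow_nat// mulrA /K -rmorphM/= mulVf ?mul1r//.
by rewrite expf_neq0// gt_eqF.
Qed.

Lemma log_high_term s y k : 0 < Re s -> 0 < y ->
  cintegrable mu `]y, +oo[ (fun t => ((y / t) ^+ k.+1)%:C * cpow t (- s)) /\
  cintegral mu `]y, +oo[ (fun t => ((y / t) ^+ k.+1)%:C * cpow t (- s)) =
  cpow y (1 - s) * (s + k%:R)^-1.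
Proof.
move=> s0 y0.
have z1 : 0 < Re (s + k%:R) by rewrite ReDn ltr_wpDr.
have [i e] := cintegral_cpow_high y0 z1.
pose K : R[i] := (y ^+ k.+1)%:C.
have E t : `]y, +oo[%classic t ->
    ((y / t) ^+ k.+1)%:C * cpow t (- s) = K * cpow t (- (s + k%:R) - 1).
  rewrite /= in_itv/= andbT => yt; have t0 : 0 < t := lt_trans y0 yt.
  have -> : - (s + k%:R) - 1 = - k.+1%:R - s :> R[i] by rewrite -natr1; ring.
  rewrite [cpow t (_ - _)]cpowD [cpow t (- k.+1%:R)]cpowN cpow_nat// exprMn exprVn.
  by rewrite rmorphM fmorphV/= mulrA.
have iK := @cintegrableZ _ _ _ mu _ (measurable_itv _) _ K i.
split; first by apply: eq_cintegrable iK => // t /E.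
rewrite (@eq_cintegral _ _ _ mu _ _ _ E) cintegralZ// e.
rewrite mulrA; congr (_ / _).
have -> : - (s + k%:R) = (1 - s) - k.+1%:R :> R[i] by rewrite -natr1; ring.
rewrite [cpow y (_ - k.+1%:R)]cpowB cpow_nat// mulrCA /K divff ?mulr1//.
by rewrite -normc_eq0 normc_real normr_eq0 expf_neq0// gt_eqF.
Qed.

(** For t < y the kernel splits as ln |1 - y / t| = ln (y / t) + ln (1 - t / y). This is the first
    part, with a primitive found by integration by parts; the second is expanded in powers of t /
    y. *)
Lemma log_diff_term s y : 0 < Re s -> Re s < 1 -> 0 < y ->
  cintegrable mu `]0, y[ (fun t => (ln y - ln t)%:C * cpow t (- s)) /\
  cintegral mu `]0, y[ (fun t => (ln y - ln t)%:C * cpow t (- s)) =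
  cpow y (1 - s) / (1 - s) ^+ 2.
Proof.
move=> s0 s1 y0; set z := 1 - s; pose p := 1 - Re s.
have p0 : 0 < p by rewrite subr_gt0.
have pn : p != 0 by rewrite gt_eqF.
have zp : Re z = p by rewrite /z ReB.
have z0 : z != 0 by apply: Re_neq0; rewrite zp.
have h0 n : 0 < y * hseq n by rewrite mulr_gt0// hseq_gt0.
have dln t : 0 < t -> is_derive t (1 : R) (fun t => ln y - ln t) (0 - t^-1).
  by move=> t0; apply: is_derive_sub; exact: is_derive1_ln.
(* Real primitive at the exponent p = 1 - Re s. It gives integrability; its complex version [Q]
   below gives the value. *)
pose P t := t `^ p / p * (ln y - ln t) + t `^ p / p / p.
have dP t : 0 < t -> is_derive t (1 : R) P (t `^ (p - 1) * (ln y - ln t)).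
  move=> t0; have d1 := is_derive_powR_div t0 pn.
  have d2 := is_derive_mul d1 (is_derive_cst p^-1 t (1 : R)).
  apply: (is_derive_eqv (is_derive_add (is_derive_mul d1 (dln t t0)) d2)) => //.
  rewrite mulr0 addr0 powRB ?(gt_eqF t0) ?implybT// powRr1 ?(ltW t0)//.
  by rewrite /cst; field; rewrite pn gt_eqF.
have cp t : 0 < t -> {for t, continuous (fun t => t `^ (p - 1) * (ln y - ln t))}.
  move=> t0; have := is_derive_mul (is_derive1_powR (p - 1) t0) (dln t t0).
  exact: is_derive_continuous.
have lnm t : 0 < t -> t <= y -> 0 <= ln y - ln t.
  by move=> t0 ty; rewrite subr_ge0 ler_ln ?posrE.
have ir : mu.-integrable `]0, y] (EFin \o (fun t => t `^ (p - 1) * (ln y - ln t))).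
  apply: (@Rintegral_FTC_lim _ _ (fun n => y * hseq n) (fun=> y) P _ (P y)) => //.
  - by move=> n; rewrite -[leRHS]mulr1 ler_pM2l// ltW ?hseq_lt1.
  - by move=> n; rewrite ler_pM2l// hseq_dec.
  - by move=> n t /andP[h1 h2] /=; rewrite in_itv/= h2 (lt_trans (h0 n) h1).
  - by move=> t /=; rewrite in_itv/= => /andP[t0 tx]; exact: near_hseq_low.
  - by move=> n t /andP[h1 _]; apply: dP; exact: lt_le_trans (h0 n) h1.
  - by move=> n t /andP[h1 _]; apply: cp; exact: lt_le_trans (h0 n) h1.
  - move=> n t /andP[h1 h2]; rewrite mulr_ge0 ?powR_ge0// lnm//.
    exact: lt_le_trans (h0 n) h1.
  - move=> n; rewrite lerBlDr lerDl addr_ge0 ?mulr_ge0 ?invr_ge0 ?powR_ge0 ?(ltW p0)//.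
    by rewrite lnm// -[leRHS]mulr1 ler_pM2l// ltW ?hseq_lt1.
have ic : cintegrable mu `]0, y] (fun t => (ln y - ln t)%:C * cpow t (- s)).
  apply: (@cintegrable_dom _ _ _ mu _ (measurable_itv _) _ _ _ ir).
    apply: cmeasurableM; last exact: cmeasurable_cpowl.
    apply: cmeasurable_real; apply: measurable_funB; first exact: measurable_cst.
    by apply: measurable_funTS; exact: measurable_ln.
  move=> t Dt; have /andP[t0 ty] : 0 < t <= y by move: Dt; rewrite /= in_itv.
  rewrite normc_mulM normc_real ger0_norm ?lnm// normc_cpow// ReN mulrC.
  by rewrite /p addrAC subrr sub0r.
split.
  by apply: (@cintegrableS _ _ _ mu `]0, y]%classic) => //; exact: subset_itv_oo_oc.
rewrite cintegral_itv_oo_oc//.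
pose Q t := cpow t z / z * (ln y - ln t)%:C + cpow t z / z / z.
have dlnc t : 0 < t -> cderiv (fun t => (ln y - ln t)%:C) t (0 - t^-1)%:C.
  by move=> t0; exact: cderiv_real (dln t t0).
apply: (@cintegral_FTC_lim _ _ (fun n => y * hseq n) (fun=> y) Q) => //.
- by move=> n; rewrite -[leRHS]mulr1 ler_pM2l// ltW ?hseq_lt1.
- by move=> n t /andP[h1 h2] /=; rewrite in_itv/= h2 (lt_trans (h0 n) h1).
- by move=> t /=; rewrite in_itv/= => /andP[t0 tx]; exact: near_hseq_low.
- move=> n t /andP[h1 _]; have t0 := lt_le_trans (h0 n) h1.
  have d1 := cderiv_cpow_div t0 z0.
  apply: cderiv_eq (cderivD (cderivM d1 (dlnc t t0)) (cderivMr z^-1 d1)) _.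
  have -> : z - 1 = - s by rewrite /z; ring.
  have -> : cpow t z = t%:C * cpow t (- s) by rewrite /z cpowD cpow1.
  have tn : (t%:C : R[i]) != 0 by rewrite -normc_eq0 normc_real normr_eq0 gt_eqF.
  rewrite !rmorphB/= rmorph0 fmorphV/=.
  move: tn; move: (t%:C : R[i]) (cpow t (- s)) ((ln y)%:C : R[i]) ((ln t)%:C : R[i]) => u C a b u0.
  by field; rewrite u0 z0.
- move=> n t /andP[h1 _]; have t0 := lt_le_trans (h0 n) h1.
  by eexists; exact: cderivM (dlnc t t0) (cderiv_cpow _ t0).
- have -> : cpow y z / z ^+ 2 = Q y - 0.
    by rewrite /Q subrr subr0 mulr0 add0r expr2 invfM mulrA.
  apply: ccvgB; first exact: ccvg_cst.
  apply: (@ccvg_squeeze _ _ _ _ _ _ (fun n => y `^ p / normc z *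
     ((2 / p) * hseq n `^ (p / 2) + hseq n `^ p / normc z))).
    apply: nearW => n; rewrite subr0 /Q.
    have hh := @hseq_gt0 R n.
    have -> : (ln y - ln (y * hseq n))%:C = (ln (hseq n)^-1)%:C.
      have hV : ln (hseq n)^-1 = - ln (hseq n) :> R.
        by rewrite lnV ?posrE.
      by rewrite lnM ?posrE// hV; congr (_%:C); ring.
    rewrite (le_trans (normcD _ _))// (normc_mulM _ (_%:C)) !(normc_mulM _ z^-1).
    rewrite !Normc.normcV normc_real normc_cpow//.
    rewrite zp powRM ?(ltW y0) ?(ltW hh)// mulrDr; apply: lerD; last first.
      by rewrite le_eqVlt; apply/orP; left; apply/eqP; ring.
    have nz : 0 <= (normc z)^-1 by rewrite invr_ge0 normc_ge0.
    rewrite ger0_norm; last first.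
      by rewrite ln_ge0// -invr1 lef_pV2 ?posrE// ltW// hseq_lt1.
    have -> : y `^ p * hseq n `^ p / normc z * ln (hseq n)^-1 =
      y `^ p / normc z * (hseq n `^ p * ln (hseq n)^-1) by ring.
    by rewrite ler_wpM2l ?hseq_ln// mulr_ge0// powR_ge0.
  rewrite -(mulr0 (y `^ p / normc z)); apply: cvgM; first exact: cvg_cst.
  rewrite -[X in _ --> X](addr0 0); apply: cvgD.
    rewrite -(mulr0 (2 / p)); apply: cvgM; first exact: cvg_cst.
    by apply: cvg_hseq_pow; rewrite divr_gt0.
  rewrite -(mul0r (normc z)^-1); apply: cvgM; last exact: cvg_cst.
  exact: cvg_hseq_pow.
Qed.

Lemma log_low s y : 0 < Re s -> Re s < 1 -> 0 < y ->
  cintegrable mu `]0, y[ (fun t => (ln (1 - t / y))%:C * cpow t (- s)) /\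
  ccvg \oo (fun n => - \sum_(k < n) (k.+1%:R^-1)%:C * (cpow y (1 - s) * (k.+2%:R - s)^-1))
    (cintegral mu `]0, y[ (fun t => (ln (1 - t / y))%:C * cpow t (- s))).
Proof.
move=> s0 s1 y0.
apply: (@clog_series _ _ _ mu `]0, y[%classic (measurable_itv _)
  (fun t => t / y) (cpow ^~ (- s))
  (y `^ (1 - Re s) * 2)
  (fun k => cpow y (1 - s) * (k.+2%:R - s)^-1)) => //.
- move=> t; rewrite /= in_itv/= => /andP[t0 ty].
  by rewrite divr_ge0 ?(ltW t0) ?(ltW y0)//= ltr_pdivrMr// mul1r.
- by apply: measurable_funM; [exact: measurable_id|exact: measurable_cst].
- exact: cmeasurable_cpowl.
- by move=> k; exact: (log_low_term k s0 s1 y0).1.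
- move=> n; apply: le_trans (ler_wpM2l (powR_ge0 _ _) (harmonic_sqr_le n)).
  rewrite mulr_sumr; apply: ler_sum => k _.
  (* The modulus of t^(-s) is a power with real exponent, so the absolute integrals are the same
     formula at the real point Re s. They are O(1 / k), and the coefficient 1 / (k + 1) makes their
     sum converge. *)
  have [_ e] := log_low_term k (s := (Re s)%:C) s0 s1 y0.
  have -> : Rintegral mu `]0, y[ (fun t => (t / y) ^+ k.+1 * normc (cpow t (- s))) =
      y `^ (1 - Re s) * (k.+2%:R - Re s)^-1.
    apply: (@complexI R); rewrite -cintegral_real.
    have -> : (y `^ (1 - Re s) * (k.+2%:R - Re s)^-1)%:C =
        cpow y (1 - (Re s)%:C) * (k.+2%:R - (Re s)%:C)^-1 :> R[i].
      rewrite rmorphM fmorphV/= rmorphB rmorph_nat -cpow_real//.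
      by rewrite rmorphB rmorph1.
    rewrite -e; apply: eq_cintegral => t Dt.
    have /andP[t0 _] : 0 < t < y by move: Dt; rewrite /= in_itv.
    by rewrite normc_cpow// ReN -rmorphN cpow_real// -[RHS]rmorphM.
  rewrite mulrCA ler_wpM2l ?powR_ge0// expr2 invfM ler_wpM2l ?invr_ge0//.
  rewrite lef_pV2 ?posrE//.
    by rewrite -[k.+2%:R]natr1 -addrA lerDl subr_ge0 ltW.
  by rewrite subr_gt0 (lt_le_trans s1)// ler1n.
- by move=> k; exact: (log_low_term k s0 s1 y0).2.
Qed.

Lemma log_high s y : 0 < Re s -> Re s < 1 -> 0 < y ->
  cintegrable mu `]y, +oo[ (fun t => (ln (1 - y / t))%:C * cpow t (- s)) /\
  ccvg \oo (fun n => - \sum_(k < n) (k.+1%:R^-1)%:C * (cpow y (1 - s) * (s + k%:R)^-1))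
    (cintegral mu `]y, +oo[ (fun t => (ln (1 - y / t))%:C * cpow t (- s))).
Proof.
move=> s0 s1 y0.
apply: (@clog_series _ _ _ mu `]y, +oo[%classic (measurable_itv _)
  (fun t => y / t) (cpow ^~ (- s))
  (y `^ (1 - Re s) / Re s * 2)
  (fun k => cpow y (1 - s) * (s + k%:R)^-1)) => //.
- move=> t; rewrite /= in_itv/= andbT => yt; have t0 := lt_trans y0 yt.
  by rewrite divr_ge0 ?(ltW t0) ?(ltW y0)//= ltr_pdivrMr// mul1r.
- apply: measurable_funM; first exact: measurable_cst.
  exact/measurable_funV/measurable_id.
- exact: cmeasurable_cpowl.
- by move=> k; exact: (log_high_term k s0 y0).1.
- move=> n; apply: le_trans (ler_wpM2l _ (harmonic_sqr_le n)); last first.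
    by rewrite divr_ge0 ?powR_ge0// ltW.
  rewrite mulr_sumr; apply: ler_sum => k _.
  have [_ e] := log_high_term k (s := (Re s)%:C) s0 y0.
  have -> : Rintegral mu `]y, +oo[ (fun t => (y / t) ^+ k.+1 * normc (cpow t (- s))) =
      y `^ (1 - Re s) * (Re s + k%:R)^-1.
    apply: (@complexI R); rewrite -cintegral_real.
    have -> : (y `^ (1 - Re s) * (Re s + k%:R)^-1)%:C =
        cpow y (1 - (Re s)%:C) * ((Re s)%:C + k%:R)^-1 :> R[i].
      rewrite rmorphM fmorphV/= rmorphD rmorph_nat -cpow_real//.
      by rewrite rmorphB rmorph1.
    rewrite -e; apply: eq_cintegral => t Dt.
    have yt : y < t by move: Dt; rewrite /= in_itv/= andbT.
    by rewrite normc_cpow ?(lt_trans y0)// ReN -rmorphN cpow_real ?(lt_trans y0)// -[RHS]rmorphM.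
  rewrite mulrCA -mulrA ler_wpM2l ?powR_ge0// expr2 invfM mulrCA ler_wpM2l ?invr_ge0//.
  rewrite -invfM lef_pV2 ?posrE ?mulr_gt0 ?ltr_wpDr//.
  by rewrite -natr1 mulrDr mulr1 addrC lerD2l ler_piMl// ltW.
- by move=> k; exact: (log_high_term k s0 y0).2.
Qed.

(** Put a = 1 - s. The coefficients 1 / ((k + 1) (k + 2 - s)) and 1 / ((k + 1) (s + k)) split into
    simple fractions whose harmonic parts cancel, and the cotangent series at [a] times y^a / a is
    left. Finally cot (pi (1 - s)) = -cot (pi s). *)
Lemma log_kernel_integral s y : 0 < Re s -> Re s < 1 -> 0 < y ->
  cintegrable mu Rplus (log_kernel (cpow ^~ (- s)) y) /\
  cintegral mu Rplus (log_kernel (cpow ^~ (- s)) y) =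
  - ((pi : R)%:C * ccot ((pi : R)%:C * s) / (1 - s)) * cpow y (1 - s).
Proof.
move=> s0 s1 y0; set f := log_kernel _ y.
have [i1 c1] := log_low s0 s1 y0.
have [i2 c2] := log_high s0 s1 y0.
have [i3 e3] := log_diff_term s0 s1 y0.
have m1 : measurable (`]0, y[%classic : set (measurableTypeR R)) by exact: measurable_itv.
have m2 : measurable (`]y, +oo[%classic : set (measurableTypeR R)) by exact: measurable_itv.
(* By the convention ln 0 = 0 the kernel vanishes at the singular point, which can therefore be
   removed from the half-line. *)
have fy : f y = 0.
  by rewrite /f /log_kernel divff ?gt_eqF// subrr normr0 ln0// mul0r.
have E1 t : `]0, y[%classic t -> (ln y - ln t)%:C * cpow t (- s) +
    (ln (1 - t / y))%:C * cpow t (- s) = f t.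
  rewrite /= in_itv/= => /andP[t0 ty]; rewrite -mulrDl -rmorphD/=.
  have v1 : 0 < 1 - t / y by rewrite subr_gt0 ltr_pdivrMr// mul1r.
  rewrite -ln_div ?posrE// -lnM ?posrE ?divr_gt0//; congr ((ln _)%:C * _).
  have -> : y / t * (1 - t / y) = - (1 - y / t) by field; rewrite !gt_eqF.
  by rewrite ler0_norm// subr_le0 ler_pdivlMr// mul1r ltW.
have E2 t : `]y, +oo[%classic t -> (ln (1 - y / t))%:C * cpow t (- s) = f t.
  rewrite /= in_itv/= andbT => yt; have t0 := lt_trans y0 yt.
  rewrite /f /log_kernel gtr0_norm// subr_gt0 ltr_pdivrMr// mul1r//.
have j1 : cintegrable mu `]0, y[ f.
  by apply: eq_cintegrable (cintegrableD m1 i3 i1) => // t /E1.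
have j2 : cintegrable mu `]y, +oo[ f by apply: eq_cintegrable i2 => // t /E2.
have iU := cintegrableU m1 m2 j1 j2.
have UE : (`]0, y[ `|` `]y, +oo[)%classic = (Rplus `\ y) :> set R.
  apply/seteqP; split => t; rewrite /Rplus /= !in_itv/= !andbT.
    move=> [/andP[t0 ty]|yt]; split; rewrite ?t0 ?(lt_trans y0 yt)//.
      by move=> e; rewrite e ltxx in ty.
    by move=> e; rewrite e ltxx in yt.
  move=> [t0 /eqP]; rewrite neq_lt => /orP[h|h]; [left|right] => //.
  by rewrite t0.
have mR : measurable (Rplus `\ y : set (measurableTypeR R)).
  by apply: measurableD; [exact: measurable_Rplus|exact: measurable_set1].
have dis : [disjoint (`]0, y[%classic : set (measurableTypeR R)) & `]y, +oo[%classic].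
  apply/disj_setPLR => t /=; rewrite !in_itv/= andbT => /andP[_ h].
  by apply/negP; rewrite -leNgt ltW.
have := cintegralU m1 m2 dis iU.
rewrite UE in iU *; move=> eU.
split.
  apply/(@cintegrable_mkcond _ _ _ mu _ f measurable_Rplus).
  move/(@cintegrable_mkcond _ _ _ mu _ f mR) : iU; apply: eq_cintegrable => // t _.
  by rewrite indic_del.
have -> : cintegral mu Rplus f = cintegral mu (Rplus `\ y) f.
  rewrite cintegral_mkcond [RHS]cintegral_mkcond; apply: eq_cintegral => t _.
  by rewrite indic_del.
rewrite eU -(@eq_cintegral _ _ _ mu _ _ _ E1) -(@eq_cintegral _ _ _ mu _ _ _ E2).
rewrite cintegralD// e3.
set a := 1 - s.
have a0 : 0 < Re a by rewrite /a ReB subr_gt0.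
have a1 : Re a < 1 by rewrite /a ReB/= ltrBlDr ltrDl.
have an : a != 0 by exact: Re_neq0.
have c3 : ccvg \oo (fun n => cpow y a / a ^+ 2 +
   - (\sum_(k < n) (k.+1%:R^-1)%:C * (cpow y (1 - s) * (k.+2%:R - s)^-1)) +
   - (\sum_(k < n) (k.+1%:R^-1)%:C * (cpow y (1 - s) * (s + k%:R)^-1)))
   (cpow y a / a ^+ 2 +
    cintegral mu `]0, y[ (fun t => (ln (1 - t / y))%:C * cpow t (- s)) +
    cintegral mu `]y, +oo[ (fun t => (ln (1 - y / t))%:C * cpow t (- s))).
  apply: ccvgD; last exact: c2.
  by apply: ccvgD; [exact: ccvg_cst|exact: c1].
have c4 : ccvg \oo (fun n => (cot_sum n a + (a + n%:R)^-1) * (cpow y a / a))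
    (((pi : R)%:C * ccot ((pi : R)%:C * a) + 0) * (cpow y a / a)).
  apply: ccvgM; last exact: ccvg_cst.
  apply: ccvgD; first exact: cot_partial_fractions.
  apply: (@ccvg_squeeze _ _ _ _ _ _ (fun n => (Re a)^-1 * n.+1%:R^-1)).
    apply: nearW => n; rewrite subr0 Normc.normcV -invfM.
    have h : Re a * n.+1%:R <= normc (a + n%:R).
      apply: le_trans (normc_Re _); apply: le_trans (ler_norm _).
      by rewrite ReDn -natr1 mulrDr mulr1 addrC lerD2l ler_piMl// ltW.
    have h2 : 0 < Re a * n.+1%:R by rewrite mulr_gt0.
    by rewrite lef_pV2 ?posrE// (lt_le_trans h2).
  rewrite -(mulr0 (Re a)^-1); apply: cvgM; [exact: cvg_cst|exact: cvg_harmonic].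
(* The pairing of [cot_sum] is off by one from the sums obtained here: 1 / (a + n) is the unmatched
   term, equal to 1 / a for n = 0 and negligible in the limit. *)
have e n : (cot_sum n a + (a + n%:R)^-1) * (cpow y a / a) = cpow y a / a ^+ 2 +
   - (\sum_(k < n) (k.+1%:R^-1)%:C * (cpow y (1 - s) * (k.+2%:R - s)^-1)) +
   - (\sum_(k < n) (k.+1%:R^-1)%:C * (cpow y (1 - s) * (s + k%:R)^-1)).
  rewrite -/a; elim: n => [|n IH].
    by rewrite /cot_sum !big_ord0 addr0 add0r !subr0; field.
  rewrite /cot_sum !big_ord_recr/= -/(cot_sum n a).
  have b0 : a + n%:R != 0 by exact: strip_neq0.
  have b1 : a + n.+1%:R != 0 by exact: strip_neq0.
  have b2 : a - n.+1%:R != 0 by exact: strip_neq0'.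
  have nn : (n.+1%:R : R[i]) != 0 by rewrite pnatr_eq0.
  have -> : n.+2%:R - s = a + n.+1%:R by rewrite /a -[n.+2%:R]natr1; ring.
  have -> : s + n%:R = - (a - n.+1%:R) by rewrite /a -natr1; ring.
  rewrite fmorphV/= rmorph_nat.
  set S1 := \sum_(k < n) _ in IH *; set S2 := \sum_(k < n) _ in IH *.
  have IH' : cot_sum n a * (cpow y a / a) =
      cpow y a / a ^+ 2 - S1 - S2 - (a + n%:R)^-1 * (cpow y a / a).
    by rewrite -IH; ring.
  rewrite !mulrDl IH'.
  have -> : a + n%:R = a + n.+1%:R - 1 by rewrite -natr1; ring.
  have b0' : a + n.+1%:R - 1 != 0 by rewrite -natr1 addrA addrK.
  move: b1 b2 nn b0'; move: (n.+1%:R : R[i]) => q b1 b2 nn b0'.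
  by field; rewrite an b1 b2 nn b0'.
have := ccvg_unique (eq_ccvg c4 e) c3; rewrite addr0 => <-.
have -> : (pi : R)%:C * a = - ((pi : R)%:C * s) + (pi : R)%:C by rewrite /a; ring.
rewrite ccotDpi ccotN; field.
exact: an.
Qed.

End LogPotential.

Section DerivativeUnderIntegral.
Context {R : realType} {d : measure_display} {T : measurableType d}.
Variable m : {measure set T -> \bar R}.

Lemma cderiv_integral (D : set T) (f f' : R -> T -> R[i]) (u v x : R) (G : T -> R) :
  measurable D -> u < x < v ->
  (forall y, u < y < v -> cintegrable m D (f y)) ->
  (forall y t, u < y < v -> D t -> cderiv (f ^~ t) y (f' y t)) ->
  (forall t, 0 <= G t) -> m.-integrable D (EFin \o G) ->
  (forall y t, u < y < v -> D t -> normc (f' y t) <= G t) ->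
  cderiv (fun y => cintegral m D (f y)) x (cintegral m D (f' x)).
Proof.
move=> mD uxv fi df G0 iG fG.
have Ix : `]u, v[%classic x by rewrite /= in_itv.
have I y : `]u, v[%classic y -> u < y < v by rewrite /= in_itv.
have main (p : R[i] -> R) : (forall z, `|p z| <= normc z) ->
    (forall y, u < y < v -> m.-integrable D (fun t => (p (f y t))%:E)) ->
    (forall y t, u < y < v -> D t ->
       is_derive y (1 : R) (fun y => p (f y t)) (p (f' y t))) ->
    is_derive x (1 : R) (fun y => Rintegral m D (fun t => p (f y t)))
      (Rintegral m D (fun t => p (f' x t))).
  move=> pn ip dp.
  have E y t : u < y < v -> D t ->
      partial1of2 (fun y t => p (f y t)) y t = p (f' y t).
    move=> yi Dt; rewrite partial1of2E; have h := dp y t yi Dt.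
    exact: derive_val.
  have h1 y : `]u, v[%classic y -> m.-integrable D (EFin \o (fun t => p (f y t))).
    by move=> /I; exact: ip.
  have h2 y t : `]u, v[%classic y -> D t -> derivable (fun y => p (f y t)) y 1.
    by move=> /I yi Dt; have [] := dp y t yi Dt.
  have h3 y t : `]u, v[%classic y -> D t ->
      `|partial1of2 (fun y t => p (f y t)) y t| <= G t.
    by move=> /I yi Dt; rewrite E// (le_trans (pn _))// fG.
  have e := differentiation_under_integral mD Ix h1 h2 G0 iG h3.
  have dd := derivable_under_integral mD Ix h1 h2 G0 iG h3.
  apply: DeriveDef => //; rewrite -derive1E e.
  by apply: eq_Rintegral => t /set_mem Dt; rewrite E.
split.
  apply: (main (fun z => Re z)) => [z|y yi|y t yi Dt].
  - exact: normc_Re.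
  - exact: (fi y yi).1.
  - exact: (df y t yi Dt).1.
apply: (main (fun z => Im z)) => [z|y yi|y t yi Dt].
- exact: normc_Im.
- exact: (fi y yi).2.
- exact: (df y t yi Dt).2.
Qed.

End DerivativeUnderIntegral.

(** * Half-Hilbert transform as multiplication of the density *)

Section HalfHilbertPowers.
Context {R : realType}.
Local Notation mu := (@lebesgue_measure R).
Local Notation Pi := (pi : R).
Variables (c : R) (A : R -> R[i]) (phi : R -> R[i]).
Hypotheses (c0 : 0 < c) (c1 : c < 1).
Hypothesis mA : cmeasurable setT A.
Hypothesis iA : mu.-integrable setT (fun t => (wgt t * normc (A t))%:E).
Local Notation s_ t := (c +i* t)%C.
Hypothesis phiE : forall t, 0 < t ->
  phi t = cintegral mu setT (fun v => A v * cpow t (- s_ v)).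

Let measurable_line : cmeasurable setT (fun t : R => s_ t).
Proof. by apply: cmeasurable_pair; [exact: measurable_cst|exact: measurable_id]. Qed.

Let iA' : cintegrable mu setT A.
Proof.
apply: (@cintegrable_dom _ _ _ mu _ measurableT _ _ _ iA) => // t _.
by rewrite ler_peMl ?normc_ge0 ?wgt_ge1.
Qed.

Let iA_bounded (k : R -> R[i]) M : cmeasurable setT k ->
  (forall t, normc (k t) <= M) -> cintegrable mu setT (fun t => A t * k t).
Proof.
move=> mk kM; have i := integrable_scale measurableT M (cintegrable_norm measurableT iA').
apply: (@cintegrable_dom _ _ _ mu _ measurableT _ _ _ i) => [|t _].
  exact: cmeasurableM.
by rewrite normc_mulM mulrC ler_wpM2r ?normc_ge0.
Qed.

Let cintegrable_power t : 0 < t -> cintegrable mu setT (fun v => A v * cpow t (- s_ v)).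
Proof.
move=> t0; apply: (@iA_bounded _ (t `^ (- c))).
  apply: cmeasurable_cpow; first exact: measurable_cst.
  exact: cmeasurableN.
by move=> v; rewrite normc_cpow// ReN.
Qed.

Let mline2 (D : set (R * R)) : cmeasurable D (fun p : R * R => s_ p.1).
Proof.
apply: (@cmeasurableS _ _ _ _ setT) => //.
by apply: (@cmeasurable_comp _ _ _ _ _ _ _ measurable_line); exact: measurable_fst.
Qed.

Let mA2 : cmeasurable setT (fun p : R * R => A p.1).
Proof. by apply: (@cmeasurable_comp _ _ _ _ _ _ _ mA); exact: measurable_fst. Qed.

(** The modulus of t^(-s) depends on the line only, so |A(v)| times the modulus of the kernel at the
    real exponent [c] is a majorant of product form and Fubini applies. *)
Lemma log_potential_power y : 0 < y ->
  cintegrable mu Rplus (log_kernel phi y) /\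
  log_potential phi y = cintegral mu setT (fun v => A v *
    (- (Pi%:C * ccot (Pi%:C * s_ v) / (1 - s_ v)) * cpow y (1 - s_ v))).
Proof.
move=> y0.
pose f v t := A v * log_kernel (cpow ^~ (- s_ v)) y t.
have [i0 _] := log_kernel_integral (s := c%:C) c0 c1 y0.
have mf : cmeasurable setT (fun p : R * R => f p.1 p.2).
  apply: cmeasurableM => //; apply: cmeasurableM.
    apply: cmeasurable_real; apply: (measurableT_comp (@measurable_ln R)).
    apply: (measurableT_comp (@normr_measurable R _)).
    apply: measurable_funB; first exact: measurable_cst.
    apply: measurable_funM; first exact: measurable_cst.
    by apply: measurable_funV; exact: measurable_snd.
  by apply: cmeasurable_cpow; [exact: measurable_snd|exact: cmeasurableN].
have pt (t : R) : Rplus t -> 0 < t by rewrite /Rplus /= in_itv/= andbT.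
have le v t : setT v -> Rplus t -> normc (f v t) <=
    normc (A v) * normc (log_kernel (cpow ^~ (- c%:C)) y t).
  move=> _ /pt t0; rewrite /f /log_kernel !(normc_mulM _ (cpow _ _)) normc_mulM.
  by rewrite (normc_mulM (_%:C)) !normc_cpow// !ReN.
have [_ a e] := @cfubini_set _ _ _ _ _ mu mu _ _ f _ _ measurableT measurable_Rplus mf
  (cintegrable_norm measurableT iA') (cintegrable_norm measurable_Rplus i0) le.
have E t : Rplus t -> cintegral mu setT (fun v => f v t) = log_kernel phi y t.
  move=> /pt t0; rewrite /log_kernel (phiE t0) -(cintegralZ measurableT _ (cintegrable_power t0)).
  by apply: eq_cintegral => v _; rewrite /f /log_kernel mulrCA.
split; first exact: (eq_cintegrable measurable_Rplus E a).
rewrite /log_potential -(@eq_cintegral _ _ _ mu _ _ _ E) -e.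
apply: eq_cintegral => v _; have [i3 <-] := log_kernel_integral (s := s_ v) c0 c1 y0.
exact: (cintegralZ measurable_Rplus (A v) i3).
Qed.

Let mccot : cmeasurable setT (fun v => ccot (Pi%:C * s_ v)).
Proof. by apply: cmeasurable_ccot; apply: cmeasurableM => //; exact: cmeasurable_cst. Qed.

Let ccot_le v : normc (ccot (Pi%:C * s_ v)) <= `|sin (Pi * c)|^-1.
Proof.
have := @normc_ccot_le R (Pi%:C * s_ v); rewrite ReMr; apply.
by rewrite sin_pi_neq0// c0.
Qed.

Let cintegrable_ccot_power y : 0 < y ->
  cintegrable mu setT (fun v => A v * (ccot (Pi%:C * s_ v) * cpow y (- s_ v))).
Proof.
move=> y0; apply: (@iA_bounded _ (`|sin (Pi * c)|^-1 * y `^ (- c))) => [|v].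
  apply: cmeasurableM => //; apply: cmeasurable_cpow; first exact: measurable_cst.
  exact: cmeasurableN.
by rewrite (normc_mulM _ (cpow _ _)) normc_cpow// ReN ler_wpM2r ?powR_ge0.
Qed.

(** Differentiating y^(1 - s) cancels the denominator 1 - s left by the logarithmic integral; this
    is how the definition by a potential yields exactly the multiplier cot (pi s). *)
Lemma cderiv_log_potential x : 0 < x ->
  cderiv (log_potential phi) x (- Pi%:C *
    cintegral mu setT (fun v => A v * (ccot (Pi%:C * s_ v) * cpow x (- s_ v)))).
Proof.
move=> x0.
pose k v : R[i] := - (Pi%:C * ccot (Pi%:C * s_ v) / (1 - s_ v)).
pose f y v := A v * (k v * cpow y (1 - s_ v)).
pose f' y v := A v * (- Pi%:C * ccot (Pi%:C * s_ v) * cpow y (- s_ v)).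
have x2 : 0 < x / 2 by rewrite divr_gt0.
have S : `|sin (Pi * c)|^-1 >= 0 by rewrite invr_ge0.
have nB v : 1 - c <= normc (1 - s_ v).
  by apply: le_trans (normc_Re _); rewrite ReB/= ler_norm.
have c1' : 0 < 1 - c by rewrite subr_gt0.
have n0 v : 1 - s_ v != 0.
  by rewrite -normc_eq0 gt_eqF// (lt_le_trans c1').
have d0 : cderiv (fun y => cintegral mu setT (f y)) x (cintegral mu setT (f' x)).
  (* Between x / 2 and 2 x the power y^(-c) is at most its value at x / 2, which gives a majorant of
     the derivative independent of [y]. *)
  apply: (@cderiv_integral _ _ _ mu setT f f' (x / 2) (2 * x) x
    (fun v => normc (A v) * (Pi * `|sin (Pi * c)|^-1 * (x / 2) `^ (- c)))) => //.
  - by apply/andP; split; lra.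
  - move=> y /andP[h1 _]; have y0 : 0 < y by lra.
    apply: (@iA_bounded _ (Pi * `|sin (Pi * c)|^-1 / (1 - c) * y `^ (1 - c))) => [|v].
      apply: cmeasurableM.
        apply: cmeasurableN; apply: cmeasurableM; first by apply: cmeasurableM => //; exact: cmeasurable_cst.
        by apply: cmeasurableV; apply: cmeasurableB => //; exact: cmeasurable_cst.
      apply: cmeasurable_cpow; first exact: measurable_cst.
      by apply: cmeasurableB => //; exact: cmeasurable_cst.
    rewrite (normc_mulM _ (cpow _ _)) normc_cpow// (_ : Re (1 - s_ v) = 1 - c) ?ReB// ler_wpM2r ?powR_ge0//.
    rewrite /k normcN (normc_mulM _ (_^-1)) (normc_mulM (_%:C)) normc_real.
    rewrite Normc.normcV ger0_norm ?pi_ge0//; apply: ler_pM.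
    + by rewrite mulr_ge0 ?pi_ge0 ?normc_ge0.
    + by rewrite invr_ge0 normc_ge0.
    + by rewrite ler_wpM2l ?pi_ge0.
    + by rewrite lef_pV2 ?posrE// (lt_le_trans c1').
  - move=> y v /andP[h1 _] _; have y0 : 0 < y by lra.
    apply: cderiv_eq (cderivMl _ (cderivMl _ (cderiv_cpow _ y0))) _.
    have -> : 1 - s_ v - 1 = - s_ v by ring.
    rewrite /f' /k; congr (_ * _).
    have fE (a b e p : R[i]) : a != 0 -> - (p * b / a) * (a * e) = - p * b * e.
      by move=> a0; field.
    exact: fE.
  - by move=> v; rewrite mulr_ge0 ?normc_ge0// !mulr_ge0 ?powR_ge0 ?pi_ge0.
  - have := integrable_scale measurableT (Pi * `|sin (Pi * c)|^-1 * (x / 2) `^ (- c))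
      (cintegrable_norm measurableT iA').
    by apply: eq_integrable => // v _; rewrite /= mulrC.
  - move=> y v /andP[h1 _] _; have y0 : 0 < y by lra.
    rewrite normc_mulM ler_wpM2l ?normc_ge0// (normc_mulM _ (cpow _ _)).
    rewrite normc_cpow// (_ : Re (- s_ v) = - c) ?ReN//.
    apply: ler_pM; rewrite ?normc_ge0 ?powR_ge0//.
      by rewrite normc_mulM normcN normc_real ger0_norm ?pi_ge0// ler_wpM2l ?pi_ge0.
    rewrite !powRN lef_pV2 ?posrE ?powR_gt0//.
    by apply: ge0_ler_powR; rewrite ?nnegrE ?(ltW c0) ?(ltW x2) ?(ltW y0) ?(ltW h1).
have e' : cintegral mu setT (f' x) = - Pi%:C *
    cintegral mu setT (fun v => A v * (ccot (Pi%:C * s_ v) * cpow x (- s_ v))).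
  rewrite -(cintegralZ measurableT _ (cintegrable_ccot_power x0)).
  by apply: eq_cintegral => v _; rewrite /f'; ring.
rewrite -e'; have [d1 d2] := d0.
(* The formula for the potential is known for positive arguments only, hence a comparison near [x]
   instead of an equality of functions. *)
have near_e : \forall y \near x, cintegral mu setT (f y) = log_potential phi y.
  near=> y; have y0 : 0 < y by near: y; exact: lt_nbhsr.
  by rewrite (log_potential_power y0).2.
by split; [apply: near_eq_is_derive d1|apply: near_eq_is_derive d2];
  apply: filterS near_e => y ->.
Unshelve. all: by end_near. Qed.

Lemma half_hilbert_power x : 0 < x ->
  half_hilbert phi x =
  cintegral mu setT (fun v => A v * (ccot (Pi%:C * s_ v) * cpow x (- s_ v))).
Proof.
move=> x0; have [d1 d2] := cderiv_log_potential x0.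
rewrite /half_hilbert !derive1E !derive_val; set I := cintegral _ _ _.
have -> : (Re (- Pi%:C * I)) +i* (Im (- Pi%:C * I)) = - Pi%:C * I by case: (_ * I).
have p0 : (Pi%:C : R[i]) != 0 by rewrite -normc_eq0 normc_real normr_eq0 gt_eqF ?pi_gt0.
rewrite fmorphV/=; move: p0; move: (Pi%:C : R[i]) I => p I p0.
by field.
Qed.

(** Here the weight is spent: the majorant of the regularized kernel costs a factor [wgt v],
    absorbed by the density. The outcome is the same cotangent integral as for the derivative of the
    potential, so the principal value and the potential define the same transform. *)
Lemma reg_power x : 0 < x -> cintegrable mu Rplus (reg phi x) /\
  cintegral mu Rplus (reg phi x) = Pi%:C * half_hilbert phi x.
Proof.
move=> x0.
pose f v t := A v * reg (cpow ^~ (- s_ v)) x t.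
have mf : cmeasurable setT (fun p : R * R => f p.1 p.2).
  apply: cmeasurableM => //; apply: cmeasurableM.
    apply: cmeasurableB.
      by apply: cmeasurable_cpow; [exact: measurable_snd|exact: cmeasurableN].
    apply: cmeasurableM.
      by apply: cmeasurable_cpow; [exact: measurable_cst|exact: cmeasurableN].
    by apply: cmeasurable_real; apply: (measurableT_comp (measurable_rho x)).
  apply: cmeasurableV; apply: cmeasurable_real.
  by apply: measurable_funB; [exact: measurable_snd|exact: measurable_cst].
have pt (t : R) : Rplus t -> 0 < t by rewrite /Rplus /= in_itv/= andbT.
have le v t : setT v -> Rplus t -> normc (f v t) <= wgt v * normc (A v) * regmaj c x t.
  move=> _ /pt t0; rewrite /f normc_mulM mulrAC [leRHS]mulrC.
  by rewrite ler_wpM2l ?normc_ge0 ?reg_le.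
have im : mu.-integrable Rplus (EFin \o regmaj c x).
  exact: (integrableS measurableT measurable_Rplus (@subsetT _ _) (integrable_regmaj c0 c1 x0)).
have [_ a e] := @cfubini_set _ _ _ _ _ mu mu _ _ f _ _ measurableT measurable_Rplus mf iA im le.
have E t : Rplus t -> cintegral mu setT (fun v => f v t) = reg phi x t.
  move=> /pt t0; rewrite /reg (phiE t0) (phiE x0).
  have ix := cintegrable_power x0; have it := cintegrable_power t0.
  have ixz := @cintegrableZr _ _ _ mu setT measurableT _ (rho x t)%:C ix.
  have id := cintegrableB measurableT it ixz.
  rewrite -(cintegralZr measurableT _ ix) -(cintegralB measurableT it ixz).
  rewrite -(cintegralZr measurableT _ id).
  by apply: eq_cintegral => v _; rewrite /f/reg; ring.
split; first exact: (eq_cintegrable measurable_Rplus E a).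
have ih := cintegrable_ccot_power x0.
rewrite -(@eq_cintegral _ _ _ mu _ _ _ E) -e (half_hilbert_power x0).
rewrite -(cintegralZ measurableT _ ih).
apply: eq_cintegral => v _.
have ir := cintegrable_reg (s := s_ v) c0 c1 x0.
rewrite [LHS](cintegralZ measurable_Rplus (A v) ir).
rewrite (reg_integral (s := s_ v) c0 c1 x0); move: (ccot _) (cpow _ _) => b p.
ring.
Qed.

Lemma half_hilbert_cvg_power x : 0 < x -> half_hilbert_cvg phi x.
Proof.
move=> x0; have [ir er] := reg_power x0.
have [[h1 _] [h2 _]] := cderiv_log_potential x0.
split.
- by move=> y y0; have [] := log_potential_power y0.
- exact: h1.
- exact: h2.
- by move=> e e0; exact: cintegrable_pv.
apply/ccvgP.
have p0 : (Pi%:C : R[i]) != 0 by rewrite -normc_eq0 normc_real normr_eq0 gt_eqF ?pi_gt0.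
have -> : half_hilbert phi x = (Pi^-1)%:C * cintegral mu Rplus (reg phi x).
  rewrite er fmorphV/=; move: p0; move: (Pi%:C : R[i]) (half_hilbert _ _) => p I p0.
  by field.
by apply: ccvgM; [exact: ccvg_cst|exact: pv_limit].
Qed.

End HalfHilbertPowers.

(** * Plancherel's formula on vertical lines *)

Section Convolution.
Context {R : realType}.
Local Notation mu := (@lebesgue_measure R).
Implicit Types (A B k : R -> R[i]) (t v : R).

Definition conv A B t : R[i] := cintegral mu setT (fun v => A (t - v) * B v).

Lemma shift_mapE v t : shift_map false (- v) t = t - v.
Proof. by rewrite /shift_map expr0 mul1r addrC. Qed.

Lemma integrable_translate (h : R -> R) v : mu.-integrable setT (EFin \o h) ->
  mu.-integrable setT (fun t => (h (t - v))%:E).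
Proof.
move=> /(@integrable_shift _ false (- v)); apply: eq_integrable => // t _.
by rewrite /= shift_mapE.
Qed.

Lemma Rintegral_translate (h : R -> R) v : mu.-integrable setT (EFin \o h) ->
  Rintegral mu setT (fun t => h (t - v)) = Rintegral mu setT h.
Proof.
move=> hi; rewrite /Rintegral -(integral_shift false (- v) hi); congr fine.
by apply: eq_integral => t _; rewrite /= shift_mapE.
Qed.

Lemma cintegral_translate A v : cintegrable mu setT A ->
  cintegral mu setT (fun t => A (t - v)) = cintegral mu setT A.
Proof.
move=> [h1 h2]; congr Complex;
  [exact: (@Rintegral_translate (fun t => Re (A t)))|exact: (@Rintegral_translate (fun t => Im (A t)))].
Qed.

Lemma cmeasurable_translate A : cmeasurable setT A ->
  cmeasurable setT (fun p : R * R => A (p.1 - p.2)).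
Proof.
move=> mA; apply: (@cmeasurable_comp _ _ _ _ _ _ _ mA).
by apply: measurable_funB; [exact: measurable_fst|exact: measurable_snd].
Qed.

Lemma cmeasurable_fst A : cmeasurable setT A ->
  cmeasurable setT (fun p : R * R => A p.1).
Proof. by move=> mA; apply: (@cmeasurable_comp _ _ _ _ _ _ _ mA); exact: measurable_fst. Qed.

Lemma cmeasurable_snd A : cmeasurable setT A ->
  cmeasurable setT (fun p : R * R => A p.2).
Proof. by move=> mA; apply: (@cmeasurable_comp _ _ _ _ _ _ _ mA); exact: measurable_snd. Qed.

(** Substituting t - v for t gives the convolution against [k]. Integrability of the inner function
    is asked at every t, not at almost every one, because [conv] is later used as a function with a
    value at each point. *)
Lemma conv_integral A B k (M : R) : cintegrable mu setT A -> cintegrable mu setT B ->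
  (forall t, cintegrable mu setT (fun v => A (t - v) * B v)) ->
  cmeasurable setT k -> (forall t, normc (k t) <= M) ->
  [/\ cintegrable (mu \x mu)%E setT (fun p : R * R => A p.1 * B p.2 * k (p.1 + p.2)),
      cintegrable mu setT (fun t => conv A B t * k t) &
      cintegral mu setT (fun v => cintegral mu setT (fun t => A t * B v * k (t + v))) =
      cintegral mu setT (fun t => conv A B t * k t)].
Proof.
move=> iA iB iAB mk kM.
have mA : cmeasurable setT A := cintegrable_measurable iA.
have mB : cmeasurable setT B := cintegrable_measurable iB.
have nA := cintegrable_norm measurableT iA.
have nB := cintegrable_norm measurableT iB.
have M0 : 0 <= M := le_trans (normc_ge0 _) (kM 0).
have i1 : cintegrable (mu \x mu)%E setT (fun p : R * R => A p.1 * B p.2 * k (p.1 + p.2)).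
  have h := @integrable_prodM _ _ _ _ _ mu mu _ _ (integrable_scale measurableT M nA) nB.
  apply: (@cintegrable_dom _ _ _ (mu \x mu)%E _ measurableT _ _ _ h).
    apply: cmeasurableM.
      by apply: cmeasurableM; [exact: cmeasurable_fst|exact: cmeasurable_snd].
    apply: (@cmeasurable_comp _ _ _ _ _ _ _ mk).
    by apply: measurable_funD; [exact: measurable_fst|exact: measurable_snd].
  move=> [t v] _ /=; rewrite (normc_mulM _ (k _)) normc_mulM mulrC mulrA.
  by rewrite ler_wpM2r ?normc_ge0// ler_wpM2r ?normc_ge0.
pose f (p : R * R) : R[i] := A (p.1 - p.2) * B p.2 * k p.1.
have mf : cmeasurable setT f.
  apply: cmeasurableM; last exact: cmeasurable_fst.
  by apply: cmeasurableM; [exact: cmeasurable_translate|exact: cmeasurable_snd].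
have i2 : cintegrable (mu \x mu)%E setT f.
  have mn := measurable_normc mf.
  pose g (p : R * R) : R := M * (normc (A (p.1 - p.2)) * normc (B p.2)).
  have mg : measurable_fun setT g.
    apply: measurable_funM; first exact: measurable_cst.
    by apply: measurable_funM; apply: measurable_normc;
      [exact: cmeasurable_translate|exact: cmeasurable_snd].
  apply: (@cintegrable_dom _ _ _ (mu \x mu)%E _ measurableT _ g) => //; last first.
    move=> [t v] _ /=; rewrite (normc_mulM _ (k _)) normc_mulM mulrC.
    by rewrite ler_wpM2r ?mulr_ge0 ?normc_ge0.
  (* Integrating in [t] first, translation invariance makes the inner integral a constant times
     [normc (B v)]. *)
  apply/integrable21ltyP; first exact/measurable_EFinP.
  have E v : (\int[mu]_t `|(g (t, v))%:E| =
      (M * Rintegral mu setT (fun t => normc (A t)) * normc (B v))%:E)%E.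
    have nAv := integrable_translate v nA.
    have -> : (\int[mu]_t `|(g (t, v))%:E| = \int[mu]_t ((M * normc (B v))%:E * (normc (A (t - v)))%:E))%E.
      apply: eq_integral => t _; rewrite /g/= ger0_norm ?mulr_ge0 ?normc_ge0//.
      by rewrite -EFinM; congr EFin; ring.
    rewrite integralZl// -(Rintegral_translate v nA) mulrAC [RHS]EFinM; congr (_ * _)%E.
    by rewrite /Rintegral fineK//; apply: integrable_fin_num.
  under eq_integral do rewrite E.
  have := integrable_scale measurableT (M * Rintegral mu setT (fun t => normc (A t))) nB.
  exact: integrable_lty.
have [_ _ _ a] := @cfubini _ _ _ _ _ mu mu _ i1.
have [b1 b2 b3 b4] := @cfubini _ _ _ _ _ mu mu _ i2.
have E t : cintegral mu setT (fun v => f (t, v)) = conv A B t * k t.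
  exact: (cintegralZr measurableT (k t) (iAB t)).
split => //.
  exact: (@eq_cintegrable _ _ _ mu _ measurableT _ _ (fun t _ => E t) b1).
rewrite -[RHS](@eq_cintegral _ _ _ mu _ _ _ (fun t _ => E t)) b3 -b4.
apply: eq_cintegral => v _.
have iv : cintegrable mu setT (fun t => A t * B v * k (t + v)).
  have h := integrable_scale measurableT (normc (B v) * M) nA.
  apply: (@cintegrable_dom _ _ _ mu _ measurableT _ _ _ h) => [|t _].
    apply: cmeasurableM; first by apply: cmeasurableM => //; exact: cmeasurable_cst.
    apply: (@cmeasurable_comp _ _ _ _ _ _ _ mk).
    by apply: measurable_funD; [exact: measurable_id|exact: measurable_cst].
  rewrite (normc_mulM _ (k _)) (normc_mulM (A t)) -mulrA mulrC.
  by rewrite ler_wpM2r ?normc_ge0// ler_wpM2l ?normc_ge0.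
rewrite -[LHS](cintegral_translate v iv); apply: eq_cintegral => t _.
by rewrite /f/= subrK.
Qed.

(** By submultiplicativity of the weight, the weighted convolution is at most the convolution of the
    weighted moduli, which is integrable by [conv_integral] with k = 1. *)
Lemma conv_weighted A B : cmeasurable setT A -> cmeasurable setT B ->
  mu.-integrable setT (fun t => (wgt t * normc (A t))%:E) ->
  mu.-integrable setT (fun t => (wgt t * normc (B t))%:E) ->
  (forall t, cintegrable mu setT (fun v => A (t - v) * B v)) ->
  (forall t, cintegrable mu setT (fun v =>
     (wgt (t - v) * normc (A (t - v)))%:C * (wgt v * normc (B v))%:C)) ->
  cmeasurable setT (conv A B) ->
  mu.-integrable setT (fun t => (wgt t * normc (conv A B t))%:E).
Proof.
move=> mA mB iA iB iAB iab mAB.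
pose a t : R := wgt t * normc (A t); pose b t : R := wgt t * normc (B t).
have ia : cintegrable mu setT (fun t => (a t)%:C) by exact: cintegrable_real.
have ib : cintegrable mu setT (fun t => (b t)%:C) by exact: cintegrable_real.
have [_ h _] := conv_integral ia ib iab (cmeasurable_cst setT 1)
  (fun _ => lexx (normc (1 : R[i]))).
have mw : measurable_fun (setT : set R) wgt.
  apply: (measurableT_comp (measurable_powR _)).
  apply: measurable_funD; first exact: measurable_cst.
  exact: (measurableT_comp (@normr_measurable R _)).
apply: (@integrable_dom _ _ _ mu _ measurableT _ _ _ (cintegrable_norm measurableT h)).
  by apply: measurable_funM => //; exact: measurable_normc.
move=> t _; have w0 := ltW (wgt_gt0 t).
rewrite mulr1 ger0_norm ?mulr_ge0 ?normc_ge0//.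
pose g v : R := a (t - v) * b v.
have ig : mu.-integrable setT (EFin \o g).
  have [i _] := iab t; apply: eq_integrable i => // v _.
  by rewrite ReMr.
have -> : conv (fun t => (a t)%:C) (fun t => (b t)%:C) t = (Rintegral mu setT g)%:C.
  rewrite -cintegral_real; apply: eq_cintegral => v _.
  exact/esym/rmorphM.
rewrite normc_real; apply: le_trans (ler_norm _).
have iABt := cintegrableZ measurableT (wgt t)%:C (iAB t).
have -> : wgt t * normc (conv A B t) =
    normc (cintegral mu setT (fun v => (wgt t)%:C * (A (t - v) * B v))).
  rewrite (cintegralZ measurableT _ (iAB t)) normc_mulM normc_real.
  by rewrite ger0_norm.
apply: (normc_cintegral_le measurableT iABt ig) => v _.
rewrite !normc_mulM normc_real ger0_norm// /g/a/b mulrACA.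
rewrite ler_wpM2r ?mulr_ge0 ?normc_ge0//.
by rewrite -[X in wgt X](subrK v t) wgtD.
Qed.

End Convolution.

Section SquareIntegrable.
Context {R : realType}.
Local Notation mu := (@lebesgue_measure R).
Implicit Types (A B : R -> R[i]) (t v : R).

Definition L2sq A : R := Rintegral mu setT (fun t => normc (A t) ^+ 2).

Definition square_integrable A : Prop := cmeasurable setT A /\
  mu.-integrable setT (fun t => (normc (A t) ^+ 2)%:E).

Lemma L2sq_ge0 A : 0 <= L2sq A.
Proof. by apply: Rintegral_ge0 => t _; exact: sqr_ge0. Qed.

Lemma shift_map_true v t : shift_map true t v = t - v.
Proof. by rewrite /shift_map expr1 mulN1r. Qed.

Lemma integrable_reflect (h : R -> R) t : mu.-integrable setT (EFin \o h) ->
  mu.-integrable setT (fun v => (h (t - v))%:E).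
Proof.
move=> /(@integrable_shift _ true t); apply: eq_integrable => // v _.
by rewrite /= shift_map_true.
Qed.

Lemma Rintegral_reflect (h : R -> R) t : mu.-integrable setT (EFin \o h) ->
  Rintegral mu setT (fun v => h (t - v)) = Rintegral mu setT h.
Proof.
move=> hi; rewrite /Rintegral -(integral_shift true t hi); congr fine.
by apply: eq_integral => v _; rewrite /= shift_map_true.
Qed.

Lemma cintegrable_reflect A t : cintegrable mu setT A ->
  cintegrable mu setT (fun v => A (t - v)).
Proof.
by move=> [h1 h2]; split;
  [exact: (@integrable_reflect (fun t => Re (A t)))|exact: (@integrable_reflect (fun t => Im (A t)))].
Qed.

Lemma cintegral_reflect A t : cintegrable mu setT A ->
  cintegral mu setT (fun v => A (t - v)) = cintegral mu setT A.
Proof.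
move=> [h1 h2]; congr Complex;
  [exact: (@Rintegral_reflect (fun t => Re (A t)))|exact: (@Rintegral_reflect (fun t => Im (A t)))].
Qed.

Lemma cmeasurable_reflect A t : cmeasurable setT A -> cmeasurable setT (fun v => A (t - v)).
Proof.
move=> mA; apply: (@cmeasurable_comp _ _ _ _ _ _ _ mA).
by apply: measurable_funB; [exact: measurable_cst|exact: measurable_id].
Qed.

(** Stands in for the Cauchy-Schwarz inequality throughout; the free parameter [l] decides which
    factor bears the loss. *)
Lemma amgm (l a b : R) : 0 < l -> a * b <= 2^-1 * (l * a ^+ 2 + l^-1 * b ^+ 2).
Proof.
move=> l0; have : 0 <= l^-1 * (l * a - b) ^+ 2.
  by rewrite mulr_ge0 ?sqr_ge0// invr_ge0 ltW.
have -> : l^-1 * (l * a - b) ^+ 2 = l * a ^+ 2 + l^-1 * b ^+ 2 - 2 * (a * b).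
  by field; rewrite gt_eqF.
by move=> h; lra.
Qed.

Lemma conv_L2 A B l t : square_integrable A -> square_integrable B -> 0 < l ->
  cintegrable mu setT (fun v => A (t - v) * B v) /\
  normc (conv A B t) <= 2^-1 * (l * L2sq A + l^-1 * L2sq B).
Proof.
move=> [mA iA] [mB iB] l0.
have h1 := integrable_scale measurableT l
  (@integrable_reflect (fun v => normc (A v) ^+ 2) t iA).
have h2 := @integrable_scale _ _ _ mu setT measurableT l^-1 (fun v => normc (B v) ^+ 2) iB.
have h := integrable_scale measurableT 2^-1 (integrable_plus measurableT h1 h2).
have mAB : cmeasurable setT (fun v => A (t - v) * B v).
  by apply: cmeasurableM => //; exact: cmeasurable_reflect.
have le v : setT v -> normc (A (t - v) * B v) <=
    2^-1 * (l * normc (A (t - v)) ^+ 2 + l^-1 * normc (B v) ^+ 2).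
  by move=> _; rewrite normc_mulM; exact: amgm.
have i := @cintegrable_dom _ _ _ mu _ measurableT _ _ mAB h le.
split=> //.
apply: (le_trans (normc_cintegral_le measurableT i h le)).
rewrite /L2sq -(@Rintegral_reflect (fun v => normc (A v) ^+ 2) t iA).
rewrite RintegralZl//; last exact: integrable_plus.
rewrite RintegralD// !RintegralZl//.
exact: (@integrable_reflect (fun v => normc (A v) ^+ 2) t iA).
Qed.

End SquareIntegrable.

(** * Poisson kernel and Abel summation on the half-line *)

Section PoissonKernel.
Context {R : realType}.
Local Notation mu := (@lebesgue_measure R).
Local Notation Pi := (pi : R).
Implicit Types (e v x : R).

(** This is 2 pi times the Poisson kernel of the upper half-plane at height [e]; its mass is the
    constant in Plancherel's formula. *)
Definition poisson e v : R := 2 * e / (e ^+ 2 + v ^+ 2).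

Lemma poisson_den e v : 0 < e -> 0 < e ^+ 2 + v ^+ 2.
Proof. by move=> e0; rewrite ltr_pwDl ?sqr_ge0 ?exprn_gt0. Qed.

Lemma poisson_ge0 e v : 0 < e -> 0 <= poisson e v.
Proof. by move=> e0; rewrite divr_ge0 ?mulr_ge0 ?(ltW e0)// ltW ?poisson_den. Qed.

Lemma is_derive_poisson e v : 0 < e ->
  is_derive v (1 : R) (fun v => 2 * atan (v / e)) (poisson e v).
Proof.
move=> e0.
have d1 : is_derive v (1 : R) (fun v => v / e) (1 * e^-1).
  apply: (is_derive_eqv (is_derive_mul (is_derive_id v (1 : R)) (is_derive_cst e^-1 v (1 : R)))) => //.
  by rewrite mulr0 addr0.
have d2 : is_derive v (1 : R) (fun v => atan (v / e)) ((1 + (v / e) ^+ 2)^-1 * (1 * e^-1)).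
  have h := @is_derive1_comp _ (@atan R) (fun v => v / e) v _ _ (is_derive1_atan (v / e)) d1.
  by apply: (is_derive_eqv h) => //; rewrite mulrC.
apply: (is_derive_eqv (is_derive_mul (is_derive_cst (2 : R) v (1 : R)) d2)) => //.
rewrite mul0r add0r mul1r /poisson /cst; field.
have h := poisson_den v e0.
have h2 : e != 0 by rewrite gt_eqF.
rewrite h2 /= gt_eqF//.
Qed.

Lemma continuous_poisson e v : 0 < e -> {for v, continuous (poisson e)}.
Proof.
move=> e0; apply: cvgM; first exact: cvg_cst.
apply: cvgV; first by rewrite gt_eqF// poisson_den.
by apply: cvgD; [exact: cvg_cst|apply: cvgM; exact: cvg_id].
Qed.

Lemma measurable_poisson e : 0 < e -> measurable_fun (setT : set R) (poisson e).
Proof. by move=> e0; apply: continuous_measurable_fun => v; exact: continuous_poisson. Qed.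

Lemma Rintegral_poisson e : 0 < e ->
  mu.-integrable setT (fun v => (poisson e v)%:E) /\
  Rintegral mu setT (poisson e) = 2 * Pi.
Proof.
move=> e0.
have nat1 n : - n%:R <= n%:R :> R by rewrite (@le_trans _ _ 0)// oppr_le0.
have near_n (x : R) : setT x -> \forall n \near \oo, - n%:R < x <= n%:R.
  move=> _; near=> n; have h : `|x| < n%:R by near: n; exact: nbhs_infty_gtr.
  by move: h; rewrite ltr_norml => /andP[-> /ltW ->].
have i : mu.-integrable setT (fun v => (poisson e v)%:E).
  apply: (@Rintegral_FTC_lim _ setT (fun n => - n%:R) (fun n => n%:R)
    (fun v => 2 * atan (v / e)) (poisson e) (2 * Pi)) => //.
  - by move=> n; rewrite lerN2 ler_nat.
  - by move=> n; rewrite ler_nat.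
  - by move=> n x _; exact: is_derive_poisson.
  - by move=> n x _; exact: continuous_poisson.
  - by move=> n x _; exact: poisson_ge0.
  - move=> n; rewrite mulNr atanN -mulrBr ler_wpM2l// opprK.
    by have := atan_ltpi2 (n%:R / e); lra.
split=> //; apply: (@complexI R); rewrite -cintegral_real.
apply: (@cintegral_FTC_lim _ setT (fun n => - n%:R) (fun n => n%:R)
    (fun v => (2 * atan (v / e))%:C) _) => //.
- by move=> n x _; exact: (cderiv_real (is_derive_poisson x e0)).
- move=> n x _; eexists; have d := is_derive_add (is_derive_cst (e ^+ 2) x (1 : R))
    (is_derive_mul (is_derive_id x (1 : R)) (is_derive_id x (1 : R))).
  have n0 : e ^+ 2 + x * x != 0 by rewrite gt_eqF// poisson_den.
  exact: (cderiv_real (is_derive_mul (is_derive_cst (2 * e) x (1 : R)) (is_derive_inv_comp d n0))).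
- exact: cintegrable_real.
have -> : (2 * Pi)%:C = (2 * (Pi / 2))%:C - (2 * (- (Pi / 2)))%:C :> R[i].
  by rewrite -rmorphB; congr (_%:C); field.
have c : atan (n%:R / e) @[n --> \oo] --> Pi / 2.
  have c1 : n%:R / e @[n --> \oo] --> +oo.
    apply/cvgryPge => M; near=> n; rewrite ler_pdivlMr//.
    by near: n; exact: nbhs_infty_ger.
  exact: (cvg_comp _ _ c1 (@cvgy_atan R)).
apply: ccvgB; apply: ccvg_real; (apply: cvgM; first exact: cvg_cst); first exact: c.
under eq_fun do rewrite mulNr atanN.
exact: cvgN.
Unshelve. all: by end_near. Qed.

(* Against [x ^ (- i v)] on the half-line, this summation weight integrates to
   the Poisson kernel at [v]. *)
Definition abel_weight e x : R := if x <= 1 then x `^ (e - 1) else x `^ (- e - 1).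

Lemma abel_weightE e x : abel_weight e x =
  \1_(`]-oo, 1%R]%classic : set R) x * x `^ (e - 1) +
  \1_(`]1%R, +oo[%classic : set R) x * x `^ (- e - 1).
Proof.
rewrite /abel_weight !indicE !mem_setE !in_itv/= andbT.
by case: (leP x 1) => h; rewrite ?mul0r ?mul1r ?addr0 ?add0r.
Qed.

Lemma abel_weight_ge0 e x : 0 <= abel_weight e x.
Proof. by rewrite /abel_weight; case: ifP => _; exact: powR_ge0. Qed.

Lemma measurable_abel_weight e : measurable_fun (setT : set R) (abel_weight e).
Proof.
have -> : abel_weight e = _ := funext (abel_weightE e).
by apply: measurable_funD; apply: measurable_funM;
  (exact: measurable_indic || exact: measurable_powR).
Qed.

(** Smaller [e] means slower decay away from 1, on both sides. The weights thus increase to 1 / x as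
    [e] decreases to 0, and monotone convergence applies. *)
Lemma abel_weight_inc e e' x : 0 < x -> e' <= e -> abel_weight e x <= abel_weight e' x.
Proof.
move=> x0 ee; rewrite /abel_weight; case: (leP x 1) => h.
  by apply: ger_powR; rewrite ?x0// lerD2r.
by apply: ler_powR; [exact: ltW|rewrite lerD2r lerN2].
Qed.

Lemma cvg_abel_weight x : 0 < x -> abel_weight (hseq n) x @[n --> \oo] --> x^-1.
Proof.
move=> x0; have c (r : R) : x `^ (r * hseq n - 1) @[n --> \oo] --> x^-1.
  have h : (r * hseq n - 1) @[n --> \oo] --> (-1 : R).
    rewrite -[X in _ --> X](sub0r 1) -(mulr0 r).
    by apply: cvgB; [apply: cvgM; [exact: cvg_cst|exact: cvg_hseq]|exact: cvg_cst].
  have e (s : R) : x `^ s = expR (s * ln x) by rewrite /powR gt_eqF.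
  rewrite -powR_inv1 ?ltW// e; under eq_fun do rewrite e.
  apply: continuous_cvg; first exact: continuous_expR.
  by apply: cvgM => //; exact: cvg_cst.
rewrite /abel_weight; case: (leP x 1) => _.
  by have := c 1; under eq_fun do rewrite mul1r.
by have := c (-1); under eq_fun do rewrite mulN1r.
Qed.

(** The parts up to 1 and beyond 1 give 1 / (e - i v) and 1 / (e + i v), whose sum is 2 e / (e^2 +
    v^2). *)
Lemma abel_weight_integral e v : 0 < e ->
  cintegrable mu Rplus (fun x => (abel_weight e x)%:C * cpow x (- (0 +i* v)%C)) /\
  cintegral mu Rplus (fun x => (abel_weight e x)%:C * cpow x (- (0 +i* v)%C)) =
  (poisson e v)%:C.
Proof.
move=> e0; set f := fun x => _.
have z1 : 0 < Re (e +i* (- v))%C by [].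
have z2 : 0 < Re (e +i* v)%C by [].
have [i1 e1] := cintegral_cpow_low (@ltr01 R) z1.
have [i2 e2] := cintegral_cpow_high (@ltr01 R) z2.
have m1 : measurable (`]0, 1%R]%classic : set (measurableTypeR R)) by exact: measurable_itv.
have m2 : measurable (`]1%R, +oo[%classic : set (measurableTypeR R)) by exact: measurable_itv.
have E1 x : `]0, 1%R]%classic x -> cpow x ((e +i* (- v))%C - 1) = f x.
  rewrite /= in_itv/= => /andP[x0 x1]; rewrite /f /abel_weight x1 -cpow_real// -cpowD.
  by congr cpow; apply: complex_eqP; rewrite /= ?addr0 ?add0r; ring.
have E2 x : `]1%R, +oo[%classic x -> cpow x (- (e +i* v)%C - 1) = f x.
  rewrite /= in_itv/= andbT => x1; have x0 : 0 < x by rewrite (lt_trans ltr01).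
  rewrite /f /abel_weight leNgt x1/= -cpow_real// -cpowD.
  by congr cpow; apply: complex_eqP; rewrite /= ?addr0 ?add0r; ring.
have j1 := eq_cintegrable m1 E1 i1.
have j2 := eq_cintegrable m2 E2 i2.
have ij := cintegrableU m1 m2 j1 j2.
rewrite (RplusE (@ltr01 R)); split => //.
rewrite (cintegralU m1 m2 (Rplus_disj 1) ij).
rewrite -(@eq_cintegral _ _ _ mu _ _ _ E1) -(@eq_cintegral _ _ _ mu _ _ _ E2) e1 e2.
rewrite !cpow_1 !mul1r.
apply: complex_eqP; rewrite ?ReD ?ImD ?ReV ?ImV ?normc_sqr/= /poisson.
  rewrite sqrrN; field; exact: lt0r_neq0 (poisson_den v e0).
by rewrite sqrrN opprK -mulrDl addrN mul0r.
Qed.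

End PoissonKernel.

Section LinePower.
Context {R : realType}.
Local Notation mu := (@lebesgue_measure R).
Implicit Types (A B : R -> R[i]) (c t v x : R).

Lemma Rplus_gt0 x : Rplus x -> 0 < x.
Proof. by rewrite /Rplus/= in_itv/= andbT. Qed.

(** Up to the factor 2 pi, the inversion integral of a transform with value [A t] at c + i t. *)
Definition line_power c A x : R[i] :=
  cintegral mu setT (fun t => A t * cpow x (- (c +i* t))).

Lemma cmeasurable_line_exp c x : cmeasurable setT (fun t : R => cpow x (- (c +i* t)%C)).
Proof.
apply: cmeasurable_cpow; first exact: measurable_cst.
apply: cmeasurableN; apply: cmeasurable_pair; first exact: measurable_cst.
exact: measurable_id.
Qed.

Lemma normc_line_exp c x t : 0 < x -> normc (cpow x (- (c +i* t)%C)) = x `^ (- c).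
Proof. by move=> x0; rewrite normc_cpow// ReN. Qed.

Lemma cintegrable_line_power c A x : cintegrable mu setT A -> 0 < x ->
  cintegrable mu setT (fun t => A t * cpow x (- (c +i* t))).
Proof.
move=> iA x0.
have h := integrable_scale measurableT (x `^ (- c)) (cintegrable_norm measurableT iA).
apply: (@cintegrable_dom _ _ _ mu _ measurableT _ _ _ h) => [|t _].
  by apply: cmeasurableM; [exact: cintegrable_measurable iA|exact: cmeasurable_line_exp].
by rewrite normc_mulM normc_line_exp// mulrC.
Qed.

Lemma line_exp_add c d t v x :
  cpow x (- ((c + d) +i* (t + v))%C) = cpow x (- (c +i* t)%C) * cpow x (- (d +i* v)%C).
Proof. by rewrite -cpowD -opprD. Qed.

Lemma line_power_mul c d A B x : cintegrable mu setT A -> cintegrable mu setT B ->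
  (forall t, cintegrable mu setT (fun v => A (t - v) * B v)) -> 0 < x ->
  line_power c A x * line_power d B x = line_power (c + d) (conv A B) x.
Proof.
move=> iA iB iAB x0.
have le t : normc (cpow x (- ((c + d) +i* t)%C)) <= x `^ (- (c + d)).
  by rewrite normc_line_exp.
have [_ _ e] := conv_integral iA iB iAB (cmeasurable_line_exp (c + d) x) le.
rewrite /line_power -e.
have jA := cintegrable_line_power c iA x0; have jB := cintegrable_line_power d iB x0.
rewrite -[LHS](cintegralZ measurableT _ jB); apply: eq_cintegral => v _.
rewrite mulrC -[LHS](cintegralZ measurableT _ jA); apply: eq_cintegral => t _.
rewrite line_exp_add; ring.
Qed.

End LinePower.

(** * Plancherel's inequality *)

Section Plancherel.
Context {R : realType}.
Local Notation mu := (@lebesgue_measure R).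
Local Notation Pi := (pi : R).
Implicit Types (A B H : R -> R[i]) (c t v x e : R).

(** On the line of real part 0 this is the density of the conjugate function. The form [0 - v] makes
    it an instance of the reflections t - v. *)
Definition reflect_conj H v : R[i] := conjc (H (0 - v)).

Lemma square_integrable_reflect_conj H : square_integrable H ->
  square_integrable (reflect_conj H) /\ L2sq (reflect_conj H) = L2sq H.
Proof.
move=> [mH iH]; have E v : normc (reflect_conj H v) ^+ 2 = normc (H (0 - v)) ^+ 2.
  by rewrite normcJ.
split; first split.
- by apply: cmeasurableJ; exact: cmeasurable_reflect.
- have := @integrable_reflect _ (fun v => normc (H v) ^+ 2) 0 iH.
  by apply: eq_integrable => // v _; rewrite E.
rewrite /L2sq -(@Rintegral_reflect _ (fun v => normc (H v) ^+ 2) 0 iH).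
by apply: eq_Rintegral => v _; rewrite E.
Qed.

Lemma cintegrable_reflect_conj H : cintegrable mu setT H ->
  cintegrable mu setT (reflect_conj H).
Proof. by move=> iH; apply: cintegrable_conj => //; exact: cintegrable_reflect. Qed.

Lemma line_power_reflect_conj H x : cintegrable mu setT H -> 0 < x ->
  line_power 0 (reflect_conj H) x = conjc (line_power 0 H x).
Proof.
move=> iH x0; have j := cintegrable_line_power 0 iH x0.
rewrite /line_power -(cintegral_reflect 0 j).
rewrite -(cintegral_conj measurableT (cintegrable_reflect 0 j)).
apply: eq_cintegral => v _.
rewrite conjcM -cpowJ; congr (_ * cpow _ _).
by apply: complex_eqP; rewrite ?ReJ ?ImJ ?ReN ?ImN/= ?ReJ ?ImJ/= ?oppr0 ?sub0r ?opprK.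
Qed.

(* The density of the square modulus of a line power. *)
Definition autocorr H := conv H (reflect_conj H).

Section Regularized.
Variable H : R -> R[i].
Hypotheses (iH : cintegrable mu setT H) (sH : square_integrable H).

Lemma cintegrable_autocorr_kernel t :
  cintegrable mu setT (fun v => H (t - v) * reflect_conj H v).
Proof.
exact: (conv_L2 t sH (square_integrable_reflect_conj sH).1 (@ltr01 R)).1.
Qed.

Lemma autocorr_le t : normc (autocorr H t) <= L2sq H.
Proof.
have [s e] := square_integrable_reflect_conj sH.
have [_ le] := conv_L2 t sH s (@ltr01 R); apply: le_trans le _.
by rewrite e invr1 !mul1r; lra.
Qed.

(** The largest value that [autocorr_le] allows is attained at 0; it is the value that the Poisson
    kernels extract in the limit. *)
Lemma autocorr0 : autocorr H 0 = (L2sq H)%:C.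
Proof.
rewrite /L2sq -(@Rintegral_reflect _ (fun v => normc (H v) ^+ 2) 0 sH.2) -cintegral_real.
by apply: eq_cintegral => v _; rewrite mulcJ.
Qed.

Lemma cintegrable_autocorr : cintegrable mu setT (autocorr H).
Proof.
have [_ h _] := conv_integral iH (cintegrable_reflect_conj iH) cintegrable_autocorr_kernel
  (cmeasurable_cst setT 1) (fun _ => lexx (normc (1 : R[i]))).
by apply: (eq_cintegrable measurableT _ h) => t _; rewrite mulr1.
Qed.

Lemma line_power_sqr x : 0 < x ->
  (normc (line_power 0 H x) ^+ 2)%:C = line_power 0 (autocorr H) x.
Proof.
move=> x0; rewrite -mulcJ -(line_power_reflect_conj iH x0) -[in RHS](addr0 0).
exact: line_power_mul (cintegrable_reflect_conj iH) cintegrable_autocorr_kernel x0.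
Qed.

End Regularized.

Lemma integrable_abel_weight e : 0 < e -> mu.-integrable Rplus (EFin \o abel_weight e).
Proof.
move=> e0; have [i _] := abel_weight_integral 0 e0.
have := cintegrable_norm measurable_Rplus i.
apply: eq_integrable => [|x /set_mem/Rplus_gt0 x0]; first exact: measurable_Rplus.
congr EFin.
rewrite normc_mulM normc_line_exp// oppr0 powRr0 mulr1 normc_real ger0_norm//.
exact: abel_weight_ge0.
Qed.

(** Unlike 1 / x, the weight is integrable on the half-line, so the exchange is allowed and the
    average over x becomes a Poisson average of the density. *)
Lemma abel_fubini A e : cintegrable mu setT A -> 0 < e ->
  cintegrable mu Rplus (fun x => (abel_weight e x)%:C * line_power 0 A x) /\
  cintegral mu Rplus (fun x => (abel_weight e x)%:C * line_power 0 A x) =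
  cintegral mu setT (fun v => A v * (poisson e v)%:C).
Proof.
move=> iA e0; have mA := cintegrable_measurable iA.
pose f x v : R[i] := (abel_weight e x)%:C * (A v * cpow x (- (0 +i* v)%C)).
have mf : cmeasurable setT (fun p : R * R => f p.1 p.2).
  apply: cmeasurableM.
    apply: cmeasurable_real.
    by apply: (measurableT_comp (measurable_abel_weight e)).
  apply: cmeasurableM; first exact: cmeasurable_snd.
  apply: cmeasurable_cpow; first exact: measurable_fst.
  apply: cmeasurableN; apply: cmeasurable_pair; first exact: measurable_cst.
  exact: measurable_snd.
have le x v : Rplus x -> setT v -> normc (f x v) <= abel_weight e x * normc (A v).
  move=> /Rplus_gt0 x0 _; rewrite /f (normc_mulM (_%:C)) (normc_mulM (A v)) normc_line_exp// oppr0 powRr0 mulr1.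
  by rewrite normc_real ger0_norm// abel_weight_ge0.
have [a _ E] := @cfubini_set _ _ _ _ _ mu mu _ _ f _ _ measurable_Rplus measurableT mf
  (integrable_abel_weight e0) (cintegrable_norm measurableT iA) le.
have E1 x : Rplus x -> cintegral mu setT (fun v => f x v) =
    (abel_weight e x)%:C * line_power 0 A x.
  by move=> /Rplus_gt0 x0; exact: (cintegralZ measurableT _ (cintegrable_line_power 0 iA x0)).
split; first exact: (eq_cintegrable measurable_Rplus E1 a).
rewrite -(@eq_cintegral _ _ _ mu _ _ _ E1) E; apply: eq_cintegral => v _.
have [i <-] := abel_weight_integral v e0.
rewrite -(cintegralZ measurable_Rplus (A v) i); apply: eq_cintegral => x _.
by rewrite /f mulrCA.
Qed.

Lemma abel_weight_gt0 e x : 0 < x -> 0 < abel_weight e x.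
Proof. by move=> x0; rewrite /abel_weight; case: ifP => _; exact: powR_gt0. Qed.

Lemma line_power_shift c A x : cintegrable mu setT A -> 0 < x ->
  line_power c A x = cpow x (- c%:C) * line_power 0 A x.
Proof.
move=> iA x0.
rewrite -(cintegralZ measurableT _ (cintegrable_line_power 0 iA x0)).
apply: eq_cintegral => t _; rewrite [RHS]mulrCA -cpowD; congr (_ * cpow _ _).
by apply: complex_eqP; rewrite ?ReD ?ImD ?ReN ?ImN/=; ring.
Qed.

(** Fubini already yields measurability of the product with the positive weight. Dividing the weight
    out settles the line of real part 0, and a power of x leads to the other lines. *)
Lemma cmeasurable_line_power c A : cintegrable mu setT A ->
  cmeasurable Rplus (line_power c A).
Proof.
move=> iA; have [i _] := abel_fubini iA (@ltr01 R).
have m0 : cmeasurable Rplus (line_power 0 A).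
  apply: (@eq_cmeasurable _ _ _ _ (fun x => ((abel_weight 1 x)^-1)%:C *
      ((abel_weight 1 x)%:C * line_power 0 A x))).
    move=> x /Rplus_gt0 x0.
    by rewrite mulrA -rmorphM mulVf ?mul1r// gt_eqF// abel_weight_gt0.
  apply: cmeasurableM; last exact: cintegrable_measurable i.
  apply: cmeasurable_real; apply: measurable_funV; apply: measurable_funTS.
  exact: measurable_abel_weight.
apply: (@eq_cmeasurable _ _ _ _ (fun x => cpow x (- c%:C) * line_power 0 A x)).
  by move=> x /Rplus_gt0 x0; rewrite (line_power_shift c iA x0).
apply: cmeasurableM => //; apply: cmeasurable_cpow; last exact: cmeasurable_cst.
exact: measurable_id.
Qed.

Section Limit.
Variable H : R -> R[i].
Hypotheses (iH : cintegrable mu setT H) (sH : square_integrable H).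
Let G x : R := normc (line_power 0 H x) ^+ 2.

Let C_le t : normc (autocorr H t) <= L2sq H := autocorr_le sH t.

Lemma abel_plancherel e : 0 < e ->
  mu.-integrable Rplus (fun x => (abel_weight e x * G x)%:E) /\
  (Rintegral mu Rplus (fun x => abel_weight e x * G x))%:C =
  cintegral mu setT (fun v => autocorr H v * (poisson e v)%:C).
Proof.
move=> e0; have [i <-] := abel_fubini (cintegrable_autocorr iH sH) e0.
have E x : Rplus x -> (abel_weight e x)%:C * line_power 0 (autocorr H) x =
    (abel_weight e x * G x)%:C.
  by move=> /Rplus_gt0 x0; rewrite -line_power_sqr// -rmorphM.
split.
  by have [h _] := eq_cintegrable measurable_Rplus E i.
by rewrite -cintegral_real; apply: eq_cintegral => x /E.
Qed.

Lemma cintegrable_autocorr_poisson e : 0 < e ->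
  cintegrable mu setT (fun v => autocorr H v * (poisson e v)%:C).
Proof.
move=> e0; have [ip _] := Rintegral_poisson e0.
have h := integrable_scale measurableT (L2sq H) ip.
apply: (@cintegrable_dom _ _ _ mu _ measurableT _ _ _ h) => [|v _].
  apply: cmeasurableM; first exact: cintegrable_measurable (cintegrable_autocorr iH sH).
  by apply: cmeasurable_real; exact: measurable_poisson.
by rewrite normc_mulM normc_real ger0_norm ?poisson_ge0// ler_wpM2r ?poisson_ge0.
Qed.

(** The autocorrelation is at most [L2sq H] in modulus and the Poisson kernel has mass 2 pi. *)
Lemma abel_plancherel_le e : 0 < e ->
  Rintegral mu Rplus (fun x => abel_weight e x * G x) <= 2 * Pi * L2sq H.
Proof.
move=> e0; have [_ E] := abel_plancherel e0.
have [ip ep] := Rintegral_poisson e0.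
have h := integrable_scale measurableT (L2sq H) ip.
apply: le_trans (ler_norm _) _; rewrite -normc_real E.
apply: le_trans (normc_cintegral_le measurableT (cintegrable_autocorr_poisson e0) h _) _.
  move=> v _.
  by rewrite normc_mulM normc_real ger0_norm ?poisson_ge0// ler_wpM2r ?poisson_ge0.
by rewrite RintegralZl// ep mulrC.
Qed.

Lemma plancherel_limit :
  mu.-integrable Rplus (fun x => (x^-1 * G x)%:E) /\
  Rintegral mu Rplus (fun x => abel_weight (hseq n) x * G x) @[n --> \oo] -->
    Rintegral mu Rplus (fun x => x^-1 * G x).
Proof.
have h0 n := @hseq_gt0 R n.
have mG : measurable_fun Rplus G.
  by apply: measurable_funX; apply: measurable_normc; exact: cmeasurable_line_power.
have mI : measurable_fun Rplus (fun x => x^-1 * G x).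
  by apply: measurable_funM => //; apply: measurable_funV; exact: measurable_id.
have mn n : measurable_fun Rplus (fun x => abel_weight (hseq n) x * G x).
  by apply: measurable_funM => //; apply: measurable_funTS; exact: measurable_abel_weight.
have G0 x : 0 <= G x by exact: sqr_ge0.
have c x : Rplus x -> abel_weight (hseq n) x * G x @[n --> \oo] --> x^-1 * G x.
  by move=> /Rplus_gt0 x0; apply: cvgM; [exact: cvg_abel_weight|exact: cvg_cst].
have le n x : Rplus x -> abel_weight (hseq n) x * G x <= x^-1 * G x.
  move=> /Rplus_gt0 x0; rewrite ler_wpM2r//.
  apply: (cvgr_to_ge (cvg_abel_weight x0)).
  near=> m; apply: abel_weight_inc => //.
  by apply: ltW; near: m; exact: near_hseq.
have i : mu.-integrable Rplus (EFin \o (fun x => x^-1 * G x)).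
  apply: (@integrable_mono_lim _ _ _ mu Rplus measurable_Rplus
    (fun n x => abel_weight (hseq n) x * G x) _ (2 * Pi * L2sq H)) => //.
  - by move=> n x _; rewrite mulr_ge0 ?abel_weight_ge0.
  - by move=> n x /Rplus_gt0 x0; rewrite ler_wpM2r// abel_weight_inc// hseq_dec.
  - by move=> n; exact: (abel_plancherel (h0 n)).1.
  - by move=> n; exact: abel_plancherel_le.
split => //.
have le2 n x : Rplus x -> normc (abel_weight (hseq n) x * G x)%:C <= x^-1 * G x.
  by move=> Dx; rewrite normc_real ger0_norm ?le// mulr_ge0 ?abel_weight_ge0.
have [_ [+ _]] := @cdominated_cvg _ _ _ mu Rplus measurable_Rplus
  (fun n x => (abel_weight (hseq n) x * G x)%:C) (fun x => (x^-1 * G x)%:C) _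
  (fun n => cmeasurable_real (mn n)) (cmeasurable_real mI) i
  (fun x Dx => ccvg_real (c x Dx)) le2.
exact.
Unshelve. all: by end_near. Qed.

(** Obtained from a bound on the autocorrelation instead of its behaviour near 0, so it covers the
    discontinuous cut-off densities to which it is applied below. *)
Lemma plancherel_le :
  mu.-integrable Rplus (fun x => (x^-1 * G x)%:E) /\
  Rintegral mu Rplus (fun x => x^-1 * G x) <= 2 * Pi * L2sq H.
Proof.
have [i c] := plancherel_limit; split=> //.
apply: (cvgr_to_le c); apply: nearW => n; exact/abel_plancherel_le/hseq_gt0.
Qed.

End Limit.

End Plancherel.

(** * Plancherel's equality for continuous densities *)

Section ConvolutionContinuous.
Context {R : realType}.
Local Notation mu := (@lebesgue_measure R).
Implicit Types (A B : R -> R[i]) (t v : R).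

Definition ccontinuous A : Prop := forall t, ccvg (nbhs t) A (A t).

Lemma ccontinuous_measurable A : ccontinuous A -> cmeasurable setT A.
Proof.
move=> cA; split; apply: continuous_measurable_fun => t; have [h1 h2] := cA t.
  exact: h1.
exact: h2.
Qed.

Lemma ccontinuous_seq A (u : nat -> R) t : ccontinuous A ->
  u n @[n --> \oo] --> t -> ccvg \oo (fun n => A (u n)) (A t).
Proof.
move=> cA ut; have [h1 h2] := cA t.
by split; [exact: cvg_comp ut h1|exact: cvg_comp ut h2].
Qed.

Lemma seq_ccontinuous A : (forall (u : nat -> R) t, u n @[n --> \oo] --> t ->
  ccvg \oo (fun n => A (u n)) (A t)) -> ccontinuous A.
Proof.
have main (f : R -> R) t : (forall u : nat -> R, u n @[n --> \oo] --> t ->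
    f (u n) @[n --> \oo] --> f t) -> f x @[x --> t] --> f t.
  move=> h; have : f x @[x --> t^'] --> f t.
    by apply/cvgr_dnbhsP => u [_ ut]; exact: h.
  move=> /cvgrPdist_le h1; apply/cvgrPdist_le => e e0; have := h1 e e0.
  rewrite near_withinE; apply: filterS => y hy.
  by have [->|/hy//] := eqVneq y t; rewrite subrr normr0 ltW.
by move=> h t; split; apply: main => u ut; have [h1 h2] := h u t ut.
Qed.

Lemma conv_continuous A B M : ccontinuous A -> (forall t, normc (A t) <= M) ->
  cintegrable mu setT B -> ccontinuous (conv A B).
Proof.
move=> cA AM iB; apply: seq_ccontinuous => u t ut.
have mA := ccontinuous_measurable cA; have mB := cintegrable_measurable iB.
have mAB s : cmeasurable setT (fun v => A (s - v) * B v).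
  by apply: cmeasurableM => //; exact: cmeasurable_reflect.
have ig := integrable_scale measurableT M (cintegrable_norm measurableT iB).
have c v : setT v -> ccvg \oo (fun n => A (u n - v) * B v) (A (t - v) * B v).
  move=> _; apply: ccvgM; last exact: ccvg_cst.
  by apply: (ccontinuous_seq cA); apply: cvgB => //; exact: cvg_cst.
have le n v : setT v -> normc (A (u n - v) * B v) <= M * normc (B v).
  by move=> _; rewrite normc_mulM ler_wpM2r ?normc_ge0.
exact: (@cdominated_cvg _ _ _ mu setT measurableT _ _ _ (fun n => mAB (u n)) (mAB t) ig c le).2.
Qed.

Lemma bounded_square_integrable A M : cintegrable mu setT A ->
  (forall t, normc (A t) <= M) -> square_integrable A.
Proof.
move=> iA AM; have mA := cintegrable_measurable iA; split => //.
have h := integrable_scale measurableT M (cintegrable_norm measurableT iA).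
apply: (@integrable_dom _ _ _ mu _ measurableT _ _ _ h) => [|t _].
  by apply: measurable_funX; exact: measurable_normc.
by rewrite ger0_norm ?sqr_ge0// expr2 ler_wpM2r ?normc_ge0.
Qed.

(** Away from 0 the kernel is O(e) with a fixed integrable profile. Cleared of denominators, the
    inequality follows from v^2 / d^2 >= 1. *)
Lemma poisson_far (e d v : R) : 0 < e -> 0 < d -> d <= `|v| ->
  poisson e v <= e * (1 + d ^- 2) * poisson 1 v.
Proof.
move=> e0 d0 dv; have d1 := poisson_den v e0; have d2 : 0 < 1 + v ^+ 2 by rewrite ltr_wpDr ?sqr_ge0.
rewrite /poisson expr1n mulr1 mulrA ler_pdivrMr// mulrAC ler_pdivlMr//.
have dv2 : d ^+ 2 <= v ^+ 2.
  by rewrite -[leRHS]real_normK ?num_real// ler_pXn2r// nnegrE ltW.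
have dp : 0 < d ^+ 2 by rewrite exprn_gt0.
have h : 1 <= d ^- 2 * v ^+ 2 by rewrite mulrC ler_pdivlMr// mul1r.
have h2 : 0 <= e ^+ 2 * (1 + d ^- 2) by rewrite mulr_ge0 ?sqr_ge0// addr_ge0// invr_ge0 ltW.
have -> : e * (1 + d ^- 2) * 2 * (e ^+ 2 + v ^+ 2) =
  2 * e * (e ^+ 2 * (1 + d ^- 2) + v ^+ 2 + d ^- 2 * v ^+ 2) by ring.
rewrite ler_pM2l ?mulr_gt0//; move: h h2; lra.
Qed.

End ConvolutionContinuous.

Lemma ccvg_dist_le (R : realType) (T : Type) (F : set_system T) (FF : ProperFilter F)
  (u : T -> R[i]) (l : R[i]) :
  (forall e : R, 0 < e -> \forall x \near F, normc (u x - l) <= e) -> ccvg F u l.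
Proof.
move=> h; apply/ccvgP/cvgr0Pnorm_le => e /h; apply: filterS => x.
by rewrite ger0_norm ?normc_ge0.
Qed.

Lemma Rintegral_poissonZ (R : realType) (k e : R) : 0 < e ->
  Rintegral (@lebesgue_measure R) setT (fun v => k * poisson e v) = k * (2 * pi).
Proof. by move=> /Rintegral_poisson[ip <-]; rewrite RintegralZl. Qed.

Section PlancherelEq.
Context {R : realType}.
Local Notation mu := (@lebesgue_measure R).
Local Notation Pi := (pi : R).
Variables (H : R -> R[i]) (M : R).
Hypotheses (iH : cintegrable mu setT H) (HM : forall t, normc (H t) <= M)
  (cH : ccontinuous H).
Let sH : square_integrable H := bounded_square_integrable iH HM.

Lemma autocorr_continuous : ccontinuous (autocorr H).
Proof. exact: conv_continuous cH HM (cintegrable_reflect_conj iH). Qed.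

(** The Poisson kernels are an approximate identity of mass 2 pi. Near 0 the continuity of the
    autocorrelation controls the error, far from 0 [poisson_far] does. *)
Lemma autocorr_poisson_cvg :
  ccvg \oo (fun n => cintegral mu setT (fun v => autocorr H v * (poisson (hseq n) v)%:C))
    (2 * Pi * L2sq H)%:C.
Proof.
have L0 := L2sq_ge0 H.
have p0 : 0 < 2 * Pi by rewrite mulr_gt0 ?pi_gt0.
have h0 n := @hseq_gt0 R n.
have main n : normc (cintegral mu setT (fun v => autocorr H v * (poisson (hseq n) v)%:C) -
    (2 * Pi * L2sq H)%:C) =
    normc (cintegral mu setT (fun v => (autocorr H v - (L2sq H)%:C) * (poisson (hseq n) v)%:C)).
  have [ip ep] := Rintegral_poisson (h0 n).
  have i1 := cintegrable_autocorr_poisson iH sH (h0 n).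
  have i2 := cintegrableZ measurableT (L2sq H)%:C (@cintegrable_real _ _ _ mu setT _ ip).
  have -> : (2 * Pi * L2sq H)%:C =
      cintegral mu setT (fun v => (L2sq H)%:C * (poisson (hseq n) v)%:C).
    rewrite (cintegralZ measurableT _ (@cintegrable_real _ _ _ mu setT _ ip)).
    rewrite cintegral_real ep (mulrC (2 * Pi)).
    exact: rmorphM.
  rewrite -(cintegralB measurableT i1 i2); congr normc.
  by apply: eq_cintegral => v _; rewrite mulrBl.
apply: ccvg_dist_le => eta eta0.
(* Each of the two error terms is allowed this much times the mass 2 pi, that is eta / 2. *)
have eta2 : 0 < eta / (2 * (2 * Pi)) by rewrite divr_gt0// mulr_gt0.
have /ccvgP/cvgrPdist_le/(_ _ eta2) := autocorr_continuous 0.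
rewrite autocorr0// => /nbhs_ballP[d/= d0 hd].
pose K : R := 2 * L2sq H * (1 + d ^- 2).
have K0 : 0 <= K by rewrite mulr_ge0 ?mulr_ge0// addr_ge0// invr_ge0 exprn_ge0// ltW.
have bound n v : normc ((autocorr H v - (L2sq H)%:C) * (poisson (hseq n) v)%:C) <=
    eta / (2 * (2 * Pi)) * poisson (hseq n) v + hseq n * K * poisson 1 v.
  rewrite normc_mulM normc_real ger0_norm ?poisson_ge0//.
  have [vd|dv] := ltP `|v| d.
    apply: ler_wpDr; first by rewrite mulr_ge0 ?poisson_ge0// mulr_ge0// ltW.
    apply: ler_wpM2r; first exact: poisson_ge0.
    have := hd v; rewrite /ball/= sub0r normrN => /(_ vd).
    by rewrite sub0r normrN ger0_norm ?normc_ge0.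
  apply: ler_wpDl; first by rewrite mulr_ge0 ?poisson_ge0// ltW.
  have nb : normc (autocorr H v - (L2sq H)%:C) <= 2 * L2sq H.
    apply: le_trans (normcB _ _) _; rewrite normc_real ger0_norm//.
    by have := autocorr_le sH v; lra.
  apply: le_trans (ler_wpM2r (poisson_ge0 _ (h0 n)) nb) _.
  apply: le_trans (ler_wpM2l _ (poisson_far (h0 n) d0 dv)) _; first exact: mulr_ge0.
  by rewrite le_eqVlt; apply/orP; left; apply/eqP; rewrite /K; ring.
have c0 : hseq n * K @[n --> \oo] --> (0 : R).
  by rewrite -(mul0r K); apply: cvgM; [exact: cvg_hseq|exact: cvg_cst].
have nE : \forall n \near \oo, hseq n * K <= eta / (2 * (2 * Pi)).
  by apply: (cvgr_le _ c0).
suff fin n : hseq n * K <= eta / (2 * (2 * Pi)) ->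
    normc (cintegral mu setT (fun v => autocorr H v * (poisson (hseq n) v)%:C) -
      (2 * Pi * L2sq H)%:C) <= eta.
  by exact: filterS fin nE.
move=> hn; rewrite main.
have [ip ep] := Rintegral_poisson (h0 n).
have [ip1 ep1] := Rintegral_poisson (@ltr01 R).
have s1 := integrable_scale measurableT (eta / (2 * (2 * Pi))) ip.
have s2 := integrable_scale measurableT (hseq n * K) ip1.
have iAn : cintegrable mu setT (fun v => (autocorr H v - (L2sq H)%:C) * (poisson (hseq n) v)%:C).
  apply: (@cintegrable_dom _ _ _ mu _ measurableT _ _ _ (integrable_plus measurableT s1 s2)).
    apply: cmeasurableM; last by apply: cmeasurable_real; exact: measurable_poisson.
    apply: cmeasurableB; last exact: cmeasurable_cst.
    exact: ccontinuous_measurable autocorr_continuous.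
  by move=> v _; exact: bound.
apply: (le_trans (normc_cintegral_le measurableT iAn (integrable_plus measurableT s1 s2)
  (fun v _ => bound n v))).
rewrite RintegralD//.
rewrite !Rintegral_poissonZ// -mulrDl.
have E : (eta / (2 * (2 * Pi)) + eta / (2 * (2 * Pi))) * (2 * Pi) = eta.
  by move: p0; move: (2 * Pi) => P P0; field; rewrite gt_eqF.
by rewrite -[leRHS]E ler_pM2r// lerD2l.
Qed.

Lemma plancherel_eq :
  Rintegral mu Rplus (fun x => x^-1 * normc (line_power 0 H x) ^+ 2) = 2 * Pi * L2sq H.
Proof.
have [_ c] := plancherel_limit iH sH.
apply: (@complexI R); apply: ccvg_unique autocorr_poisson_cvg.
apply: (eq_ccvg (ccvg_real c)) => n.
by have [_ ->] := abel_plancherel iH sH (@hseq_gt0 R n).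
Qed.

End PlancherelEq.

(** * Mellin inversion *)

Section RintegralSets.
Context {R : realType} {d : measure_display} {T : measurableType d}.
Variable m : {measure set T -> \bar R}.

Lemma Rintegral_EFin (D : set T) (f : T -> R) : measurable D ->
  m.-integrable D (EFin \o f) ->
  (\int[m]_(x in D) (f x)%:E)%E = (Rintegral m D f)%:E.
Proof. by move=> mD i; rewrite /Rintegral fineK//; exact: integrable_fin_num. Qed.

Lemma Rintegral_subset (D E : set T) (f : T -> R) : measurable D -> measurable E ->
  D `<=` E -> m.-integrable E (EFin \o f) -> (forall x, E x -> 0 <= f x) ->
  Rintegral m D f <= Rintegral m E f.
Proof.
move=> mD mE DE i f0; rewrite -lee_fin -!Rintegral_EFin//; last first.
  exact: integrableS i.
apply: ge0_subset_integral => //; first exact: measurable_int i.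
Qed.

Lemma Rintegral_scale (D : set T) (f : T -> R) (mD : measurable D) k :
  m.-integrable D (EFin \o f) ->
  Rintegral m D (fun x => k * f x) = k * Rintegral m D f.
Proof. by move=> i; rewrite RintegralZl. Qed.

Lemma Rintegral_add (D : set T) (f g : T -> R) (mD : measurable D) :
  m.-integrable D (EFin \o f) -> m.-integrable D (EFin \o g) ->
  Rintegral m D (fun x => f x + g x) = Rintegral m D f + Rintegral m D g.
Proof. by move=> i j; rewrite RintegralD. Qed.

Lemma Rintegral_indic (D : set T) (f : T -> R) :
  Rintegral m D f = Rintegral m setT (fun x => \1_D x * f x).
Proof.
rewrite Rintegral_mkcond; apply: eq_Rintegral => x _.
by rewrite patchE indicE; case: ifP => _; rewrite ?mul1r ?mul0r.
Qed.

Lemma cmeasurable_indic (D : set T) (f : T -> R[i]) : measurable D ->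
  cmeasurable D f -> cmeasurable setT (fun x => (\1_D x)%:C * f x).
Proof.
move=> mD [f1 f2].
have E (g : T -> R) : (fun x => \1_D x * g x) = g \_ D.
  apply/funext => x; rewrite patchE indicE.
  by case: ifP => _; rewrite ?mul1r ?mul0r.
split; under eq_fun do rewrite ?ReMr ?ImMr.
  by have := (measurable_restrictT (fun x => Re (f x)) mD).1 f1; rewrite -E.
by have := (measurable_restrictT (fun x => Im (f x)) mD).1 f2; rewrite -E.
Qed.

End RintegralSets.

Lemma near_symmetric_itv (R : realType) (x : R) :
  \forall n \near \oo, `[- n%:R, n%:R]%classic x.
Proof.
by near=> n; rewrite /= in_itv/= -ler_norml; near: n; exact: nbhs_infty_ger.
Unshelve. all: by end_near. Qed.

(** * Energy of truncated Mellin transforms *)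

Section MellinTruncation.
Context {R : realType}.
Local Notation mu := (@lebesgue_measure R).
Local Notation Pi := (pi : R).
Variables (c K : R) (h : R -> R[i]) (a b : R).
Hypotheses (a0 : 0 < a) (mh : cmeasurable Rplus h)
  (hK : forall t, 0 < t -> normc (h t) <= K * t `^ (- c)).

Definition trunc_line (t : R) : R[i] := mellin_trunc h a b (c +i* t).

Let mab : measurable (`[a, b]%classic : set (measurableTypeR R)).
Proof. exact: measurable_itv. Qed.

Let pos t : `[a, b]%classic t -> 0 < t.
Proof. by rewrite /= in_itv/= => /andP[/(lt_le_trans a0)]. Qed.

Let ab_Rplus : `[a, b]%classic `<=` (Rplus : set R).
Proof. by move=> t /pos; rewrite /Rplus/= in_itv/= andbT. Qed.

Let mhab : cmeasurable `[a, b]%classic h.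
Proof. exact: cmeasurableS measurable_Rplus ab_Rplus mh. Qed.

Let inv_integrable : mu.-integrable `[a, b] (EFin \o (fun t => K * t^-1)).
Proof.
apply: integrable_continuous => t /andP[h1 _].
apply: cvgM; first exact: cvg_cst.
by apply: cvgV; [rewrite gt_eqF// (lt_le_trans a0)|exact: cvg_id].
Qed.

(** The bound assumed on [h] exactly offsets t^(c - 1), so the majorant K / t is the same for all
    frequencies. *)
Let kernel_le v t : `[a, b]%classic t ->
  normc (h t * cpow t ((c +i* v)%C - 1)) <= K * t^-1.
Proof.
move=> /pos t0; rewrite normc_mulM normc_cpow//.
apply: le_trans (ler_wpM2r (powR_ge0 _ _) (hK t0)) _.
have -> : Re ((c +i* v)%C - 1) = c - 1 by rewrite ReB.
rewrite -mulrA -powRD ?(gt_eqF t0) ?implybT//.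
by rewrite addrA addNr sub0r (powR_inv1 (ltW t0)).
Qed.

Let mkernel v : cmeasurable `[a, b]%classic (fun t => h t * cpow t ((c +i* v)%C - 1)).
Proof. by apply: cmeasurableM => //; exact: cmeasurable_cpowl. Qed.

Let ikernel v : cintegrable mu `[a, b] (fun t => h t * cpow t ((c +i* v)%C - 1)).
Proof. exact: (@cintegrable_dom _ _ _ mu _ mab _ _ (mkernel v) inv_integrable (kernel_le v)). Qed.

Definition trunc_bound : R := Rintegral mu `[a, b] (fun t => K * t^-1).

Lemma trunc_line_le v : normc (trunc_line v) <= trunc_bound.
Proof. exact: (normc_cintegral_le mab (ikernel v) inv_integrable (kernel_le v)). Qed.

Lemma line_exp_continuous t z : 0 < t -> ccontinuous (fun v : R => cpow t ((c +i* v)%C + z)).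
Proof.
move=> t0 v.
have d0 : cderiv (fun v : R => (c +i* v)%C) v 'i%C.
  split; first exact: is_derive_cst.
  exact: is_derive_id.
have d1 := cderiv_cexp (cderivMr (ln t)%:C (cderivD d0 (cderiv_cst z v))).
by have [h1 h2] := cderiv_continuous d1; split.
Qed.

Lemma trunc_line_continuous : ccontinuous trunc_line.
Proof.
apply: seq_ccontinuous => u v uv.
have cv t : `[a, b]%classic t -> ccvg \oo (fun n => h t * cpow t ((c +i* (u n))%C - 1))
    (h t * cpow t ((c +i* v)%C - 1)).
  move=> /pos t0; apply: ccvgM; first exact: ccvg_cst.
  exact: (ccontinuous_seq (line_exp_continuous (-1) t0) uv).
exact: (@cdominated_cvg _ _ _ mu _ mab _ _ _ (fun n => mkernel (u n)) (mkernel v)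
  inv_integrable cv (fun n => kernel_le (u n))).2.
Qed.

(** The truncated transform is the adjoint of the inversion integral, so estimates for functions of
    density [phi] transfer to truncated transforms. *)
Lemma trunc_duality phi : cintegrable mu setT phi ->
  cintegrable mu setT (fun v => conjc (phi v) * trunc_line v) /\
  cintegral mu setT (fun v => conjc (phi v) * trunc_line v) =
  cintegral mu `[a, b] (fun t => h t * (t `^ (c - 1))%:C * conjc (line_power 0 phi t)).
Proof.
move=> iphi.
pose h1 t : R[i] := (\1_(`[a, b]%classic : set R) t)%:C * h t.
pose f v t := conjc (phi v) * (h1 t * cpow t ((c +i* v)%C - 1)).
have mphi := cintegrable_measurable iphi.
have mh1 : cmeasurable setT h1 := cmeasurable_indic mab mhab.
have mf : cmeasurable setT (fun p : R * R => f p.1 p.2).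
  apply: cmeasurableM; first exact: (cmeasurable_fst (cmeasurableJ mphi)).
  apply: cmeasurableM; first exact: cmeasurable_snd mh1.
  apply: cmeasurable_cpow; first exact: measurable_snd.
  apply: cmeasurableB; last exact: cmeasurable_cst.
  by apply: cmeasurable_pair; [exact: measurable_cst|exact: measurable_fst].
have h1E t : `[a, b]%classic t -> h1 t = h t.
  by move=> Dt; rewrite /h1 indicE mem_set// mul1r.
have le v t : setT v -> `[a, b]%classic t -> normc (f v t) <= normc (phi v) * (K * t^-1).
  move=> _ Dt; rewrite /f h1E// (normc_mulM (conjc _)) normcJ.
  by rewrite ler_wpM2l ?normc_ge0// kernel_le.
have [i _ e] := @cfubini_set _ _ _ _ _ mu mu _ _ f _ _ measurableT mab mf
  (cintegrable_norm measurableT iphi) inv_integrable le.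
have E v : setT v -> cintegral mu `[a, b] (fun t => f v t) = conjc (phi v) * trunc_line v.
  move=> _; rewrite -[RHS](cintegralZ mab _ (ikernel v)); apply: eq_cintegral => t Dt.
  by rewrite /f h1E.
split; first exact: (eq_cintegrable measurableT E i).
rewrite -(@eq_cintegral _ _ _ mu _ _ _ E) e; apply: eq_cintegral => t Dt.
have t0 := pos Dt; have ip := cintegrable_line_power 0 iphi t0.
rewrite /line_power -(cintegral_conj measurableT ip).
rewrite -[RHS](cintegralZ measurableT _ (cintegrable_conj measurableT ip)).
apply: eq_cintegral => v _; rewrite /f (h1E _ Dt).
have -> : conjc (phi v * cpow t (- (0 +i* v)%C)) = conjc (phi v) * cpow t (0 +i* v)%C.
  rewrite -[in RHS](opprK (0 +i* v)%C).
  have -> : - - (0 +i* v)%C = conjc (- (0 +i* v)%C).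
    by apply: complex_eqP; rewrite ?ReJ ?ImJ ?ReN ?ImN/= ?oppr0.
  by rewrite cpowJ conjcM.
have -> : (c +i* v)%C - 1 = (c - 1)%:C + (0 +i* v)%C.
  by apply: complex_eqP; rewrite ?ReD ?ImD/= ?ReN ?ImN/= ?oppr0 ?addr0 ?add0r.
rewrite cpowD (cpow_real _ t0).
move: (cpow t _) (conjc (phi v)) ((t `^ (c - 1))%:C : R[i]) (h t) => p q r z.
ring.
Qed.

Let w t := normc (h t) ^+ 2 * t `^ (2 * c - 1).

Let mw : measurable_fun `[a, b]%classic w.
Proof.
apply: measurable_funM; first by apply: measurable_funX; exact: measurable_normc.
by apply: measurable_funTS; exact: measurable_powR.
Qed.

Let sqr_powR t (r : R) : 0 < t -> (t `^ r) ^+ 2 = t `^ (2 * r).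
Proof. by move=> t0; rewrite expr2 -powRD ?(gt_eqF t0) ?implybT// mulr_natl mulr2n. Qed.

Let iw : mu.-integrable `[a, b] (EFin \o w).
Proof.
have i2 : mu.-integrable `[a, b] (EFin \o (fun t => K ^+ 2 * t^-1)).
  apply: integrable_continuous => t /andP[h1 _].
  apply: cvgM; first exact: cvg_cst.
  by apply: cvgV; [rewrite gt_eqF// (lt_le_trans a0)|exact: cvg_id].
apply: (@integrable_dom _ _ _ mu _ mab _ _ mw i2) => t /pos t0.
rewrite ger0_norm ?mulr_ge0 ?normc_ge0 ?powR_ge0//.
have Kt : 0 <= K * t `^ (- c) := le_trans (normc_ge0 _) (hK t0).
have : normc (h t) ^+ 2 <= (K * t `^ (- c)) ^+ 2.
  by rewrite ler_pXn2r ?nnegrE ?normc_ge0// hK.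
rewrite exprMn sqr_powR// => /(ler_wpM2r (powR_ge0 t (2 * c - 1))) /le_trans; apply.
rewrite -mulrA -powRD ?(gt_eqF t0) ?implybT//.
by rewrite mulrN addrA addNr sub0r (powR_inv1 (ltW t0)).
Qed.

Definition trunc_energy : R := Rintegral mu `[a, b] w.

(* Duality: with [phi] the cut-off of [trunc_line] and [X] its energy, AM-GM and
   Plancherel's inequality for [phi] give [X <= (2 pi Y + X) / 2]. *)
Lemma trunc_cut_le n : Rintegral mu `[- n%:R, n%:R] (fun v => normc (trunc_line v) ^+ 2) <=
  2 * Pi * trunc_energy.
Proof.
pose I : set R := `[- n%:R, n%:R]%classic.
have mI : measurable (I : set (measurableTypeR R)) by exact: measurable_itv.
pose phi v : R[i] := (\1_I v)%:C * trunc_line v.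
have mQ := ccontinuous_measurable trunc_line_continuous.
have i1 : mu.-integrable setT (fun v => (\1_I v * trunc_bound)%:E).
  apply: integrable_indic_mul => //.
  exact: (@integrable_continuous R (cst trunc_bound) (- n%:R) n%:R (fun u _ => cvg_cst _)).
have iphi : cintegrable mu setT phi.
  apply: (@cintegrable_dom _ _ _ mu _ measurableT _ _ _ i1) => [|v _].
    by apply: cmeasurableM => //; apply: cmeasurable_real; exact: measurable_indic.
  rewrite normc_mulM normc_real ger0_norm ?ler_wpM2l ?trunc_line_le//.
have phi_le v : normc (phi v) <= trunc_bound.
  rewrite normc_mulM normc_real ger0_norm// indicE.
  case: (v \in I); rewrite ?mul1r ?trunc_line_le// mul0r.
  exact: le_trans (normc_ge0 _) (trunc_line_le v).
have sphi := bounded_square_integrable iphi phi_le.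
have ind2 v : \1_I v ^+ 2 = \1_I v :> R.
  by rewrite indicE; case: (v \in I); rewrite ?expr1n ?expr0n.
have E1 : Rintegral mu I (fun v => normc (trunc_line v) ^+ 2) = L2sq phi.
  rewrite Rintegral_indic; apply: eq_Rintegral => v _.
  by rewrite normc_mulM normc_real ger0_norm// exprMn ind2.
rewrite -/I E1; set X := L2sq phi; set Y := trunc_energy.
have [_ dual] := trunc_duality iphi.
have E2 : X%:C = cintegral mu setT (fun v => conjc (phi v) * trunc_line v).
  rewrite /X /L2sq -cintegral_real; apply: eq_cintegral => v _.
  rewrite -mulcJ /phi indicE; case: (v \in I); last by rewrite !(mul0r, rmorph0).
  by rewrite mul1r mulrC.
have [iG leG] := plancherel_le iphi sphi.
have p0 : 0 < 2 * Pi by rewrite mulr_gt0 ?pi_gt0.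
have iGab : mu.-integrable `[a, b] (EFin \o (fun x => x^-1 * normc (line_power 0 phi x) ^+ 2)).
  exact: (@integrableS _ _ _ mu Rplus `[a, b]%classic _ measurable_Rplus mab ab_Rplus iG).
have s1 := integrable_scale mab (2 * Pi) iw.
have s2 := integrable_scale mab (2 * Pi)^-1 iGab.
have s := integrable_scale mab 2^-1 (integrable_plus mab s1 s2).
have mker : cmeasurable `[a, b]%classic
    (fun t => h t * (t `^ (c - 1))%:C * conjc (line_power 0 phi t)).
  apply: cmeasurableM.
    apply: cmeasurableM => //; apply: cmeasurable_real; apply: measurable_funTS.
    exact: measurable_powR.
  apply: cmeasurableJ; apply: cmeasurableS measurable_Rplus ab_Rplus _.
  exact: cmeasurable_line_power.
have ker_le t : `[a, b]%classic t ->
    normc (h t * (t `^ (c - 1))%:C * conjc (line_power 0 phi t)) <=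
    2^-1 * (2 * Pi * w t + (2 * Pi)^-1 * (t^-1 * normc (line_power 0 phi t) ^+ 2)).
  move=> /pos t0; rewrite (normc_mulM _ (conjc _)) normcJ normc_mulM normc_real.
  rewrite ger0_norm ?powR_ge0//.
  have -> : t `^ (c - 1) = t^-1 * t `^ c.
    by rewrite powRB ?(gt_eqF t0) ?implybT// powRr1 1?ltW// mulrC.
  have tv : 0 <= t^-1 by rewrite invr_ge0 ltW.
  have h1 := ler_wpM2l tv (amgm (normc (h t) * t `^ c) (normc (line_power 0 phi t)) p0).
  rewrite [leLHS](_ : _ = t^-1 * (normc (h t) * t `^ c * normc (line_power 0 phi t))); last by ring.
  apply: le_trans h1 _; rewrite le_eqVlt; apply/orP; left; apply/eqP.
  rewrite /w exprMn sqr_powR// powRB ?(gt_eqF t0) ?implybT// powRr1 1?ltW//.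
  ring.
have iker := @cintegrable_dom _ _ _ mu _ mab _ _ mker s ker_le.
have : X <= 2^-1 * (2 * Pi * Y + X).
  rewrite -[leLHS]ger0_norm ?L2sq_ge0// -normc_real E2 dual.
  apply: (le_trans (normc_cintegral_le mab iker s ker_le)).
  rewrite RintegralZl//; last exact: (integrable_plus mab s1 s2).
  rewrite ler_wpM2l// RintegralD// (Rintegral_scale mab _ iw)
    (Rintegral_scale mab _ iGab) lerD2l.
  rewrite mulrC ler_pdivrMr// mulrC; apply: le_trans leG.
  apply: Rintegral_subset => //; first exact: measurable_Rplus.
  by move=> t /Rplus_gt0 t0; rewrite mulr_ge0 ?sqr_ge0// invr_ge0 ltW.
lra.
Qed.

(** Over a bounded interval of frequencies the energy is finite beforehand, the transform being
    bounded, so [trunc_cut_le] can be solved for it; the resulting bound does not depend on the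
    interval. *)
Lemma square_integrable_trunc_line : square_integrable trunc_line.
Proof.
have mQ := ccontinuous_measurable trunc_line_continuous.
have mQ2 : measurable_fun setT (fun v => normc (trunc_line v) ^+ 2).
  by apply: measurable_funX; exact: measurable_normc.
split => //.
apply: (@integrable_bigcup_le _ _ _ mu (fun n => `[- n%:R, n%:R]%classic) setT
  (fun v => normc (trunc_line v) ^+ 2) (2 * Pi * trunc_energy)) => //.
- move=> m n mn; rewrite subsetEset => x /=; rewrite !in_itv/= => /andP[h1 h2].
  by rewrite (le_trans _ h1) ?lerN2 ?ler_nat//= (le_trans h2)// ler_nat.
- apply/seteqP; split => // x _; have [n _ hn] := near_symmetric_itv x.
  by exists n => //; apply: hn => /=.
- move=> v _; exact: sqr_ge0.
move=> n; rewrite Rintegral_EFin//; first by rewrite lee_fin; exact: trunc_cut_le.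
have i : mu.-integrable `[- n%:R, n%:R] (EFin \o cst (trunc_bound ^+ 2)).
  exact: (@integrable_continuous R (cst _) (- n%:R) n%:R (fun u _ => cvg_cst _)).
apply: (@integrable_dom _ _ _ mu _ (measurable_itv _) _ _ _ i) => [|v _].
  exact: measurable_funS mQ2.
rewrite ger0_norm ?sqr_ge0// /cst ler_pXn2r ?nnegrE ?normc_ge0 ?trunc_line_le//.
exact: le_trans (normc_ge0 _) (trunc_line_le v).
Qed.

Lemma L2sq_trunc_line : L2sq trunc_line <= 2 * Pi * trunc_energy.
Proof.
have [mQ iQ] := square_integrable_trunc_line.
have [c1 _] := @cintegral_bigcup_cvg _ _ _ mu (fun n => `[- n%:R, n%:R]%classic) setT
  (fun v => (normc (trunc_line v) ^+ 2)%:C) (fun n => measurable_itv _) measurableT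
  (fun n => @subsetT _ _) (fun x _ => near_symmetric_itv x) (@cintegrable_real _ _ _ mu setT _ iQ).
apply: (cvgr_to_le c1); apply: nearW => n.
exact: trunc_cut_le.
Qed.

End MellinTruncation.

(** * The Mellin transform of an inversion integral *)

Section MellinInverse.
Context {R : realType}.
Local Notation mu := (@lebesgue_measure R).
Local Notation Pi := (pi : R).

Lemma mellin_inv_line_power c (F : R[i] -> R[i]) x :
  mellin_inv c F x = ((2 * Pi)^-1)%:C * line_power c (fun t => F (c +i* t)) x.
Proof.
rewrite /mellin_inv /line_integral -/(line_power c (fun t => F (c +i* t)%C) x).
have p0 : (Pi%:C : R[i]) != 0 by rewrite -normc_eq0 normc_real normr_eq0 gt_eqF ?pi_gt0.
have i0 : ('i%C : R[i]) != 0 by rewrite -normc_eq0 /= expr0n/= add0r expr1n sqrtr1 oner_eq0.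
rewrite fmorphV rmorphM rmorph_nat/=.
move: p0 i0; move: (Pi%:C : R[i]) ('i%C : R[i]) (line_power _ _ _) => p i l p0 i0.
by field; rewrite p0 i0.
Qed.

Lemma normc_sub_sqr (z w : R[i]) :
  normc (z - w) ^+ 2 = normc z ^+ 2 + normc w ^+ 2 - 2 * Re (conjc z * w).
Proof. by rewrite !normc_sqr ReB ImB ReM ReJ ImJ; ring. Qed.

Variables (c M : R) (F : R[i] -> R[i]) (f : R -> R[i]).
Let H t := F (c +i* t)%C.
Hypotheses (iH : cintegrable mu setT H) (HM : forall t, normc (H t) <= M)
  (cH : ccontinuous H) (fF : forall x, 0 < x -> f x = mellin_inv c F x).

Let sH : square_integrable H := bounded_square_integrable iH HM.
Let K := (2 * Pi)^-1 * Rintegral mu setT (fun t => normc (H t)).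
Let q2 x := x^-1 * normc (line_power 0 H x) ^+ 2.

Let p0 : 0 < 2 * Pi. Proof. by rewrite mulr_gt0 ?pi_gt0. Qed.

Lemma mellin_inverse_shift x : 0 < x -> f x = ((2 * Pi)^-1 * x `^ (- c))%:C * line_power 0 H x.
Proof.
move=> x0; rewrite fF// mellin_inv_line_power line_power_shift//.
rewrite -rmorphN cpow_real// mulrA; congr (_ * _).
exact/esym/rmorphM.
Qed.

Lemma cmeasurable_mellin_inverse : cmeasurable Rplus f.
Proof.
apply: (@eq_cmeasurable _ _ _ _ (fun x => ((2 * Pi)^-1 * x `^ (- c))%:C * line_power 0 H x)).
  by move=> x /Rplus_gt0 x0; rewrite mellin_inverse_shift.
apply: cmeasurableM; last exact: cmeasurable_line_power.
apply: cmeasurable_real; apply: measurable_funM; first exact: measurable_cst.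
by apply: measurable_funTS; exact: measurable_powR.
Qed.

Lemma mellin_inverse_le t : 0 < t -> normc (f t) <= K * t `^ (- c).
Proof.
move=> t0; rewrite mellin_inverse_shift// normc_mulM normc_real ger0_norm; last first.
  by rewrite mulr_ge0 ?powR_ge0// invr_ge0 ltW.
rewrite /K [leRHS]mulrAC; apply: ler_wpM2l; first by rewrite mulr_ge0 ?powR_ge0// invr_ge0 ltW.
have i := cintegrable_line_power 0 iH t0.
apply: (normc_cintegral_le measurableT i (cintegrable_norm measurableT iH)) => v _.
by rewrite normc_mulM normc_line_exp// oppr0 powRr0 mulr1.
Qed.

Let energyE t : 0 < t -> normc (f t) ^+ 2 * t `^ (2 * c - 1) = (2 * Pi)^-2 * q2 t.
Proof.
move=> t0; rewrite mellin_inverse_shift// normc_mulM normc_real ger0_norm; last first.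
  by rewrite mulr_ge0 ?powR_ge0// invr_ge0 ltW.
rewrite /q2 2!exprMn.
have -> : (t `^ (- c)) ^+ 2 = t `^ (- (2 * c)).
  by rewrite expr2 -powRD ?(gt_eqF t0) ?implybT//; congr (_ `^ _); ring.
rewrite powRB ?(gt_eqF t0) ?implybT// powRr1 1?ltW// powRN.
have := powR_gt0 (2 * c) t0; move: (t `^ (2 * c)) => u u0.
move: p0; move: (2 * Pi) (normc _) => P n P0; field.
by rewrite !gt_eqF.
Qed.

Let iq2 : mu.-integrable Rplus (EFin \o q2).
Proof. exact: (plancherel_le iH sH).1. Qed.

Lemma mellin_memL2_Rplus : memL2_Rplus c f.
Proof.
split; first exact: cmeasurable_mellin_inverse.
have -> : (\int[mu]_(x in Rplus) (normc (f x) ^+ 2 * x `^ (2 * c - 1))%:E =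
    \int[mu]_(x in Rplus) ((2 * Pi)^-2 * q2 x)%:E)%E.
  by apply: eq_integral => x /set_mem /Rplus_gt0 x0; rewrite energyE.
have i := integrable_scale measurable_Rplus ((2 * Pi) ^- 2) iq2.
by rewrite (Rintegral_EFin measurable_Rplus i) ltry.
Qed.

Lemma mellin_memL2_line : memL2_line c F.
Proof.
have [mH i] := sH; split => //.
by rewrite (Rintegral_EFin measurableT i) ltry.
Qed.

(** Expand the square. With E the subtracted quantity, the cross term is exactly -2 E by duality and
    the truncated transform contributes at most E. The sharp constant of Plancherel's inequality is
    essential here. *)
Lemma mellin_trunc_dist a b : 0 < a ->
  let g v := H v - trunc_line c f a b v in
  square_integrable g /\
  L2sq g <= L2sq H - (2 * Pi)^-1 * Rintegral mu `[a, b] q2.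
Proof.
move=> a0 g.
have mab : measurable (`[a, b]%classic : set (measurableTypeR R)) by exact: measurable_itv.
have pos t : `[a, b]%classic t -> 0 < t.
  by rewrite /= in_itv/= => /andP[/(lt_le_trans a0)].
have sub : `[a, b]%classic `<=` (Rplus : set R).
  by move=> t /pos; rewrite /Rplus/= in_itv/= andbT.
have iab : mu.-integrable `[a, b] (EFin \o q2).
  exact: (@integrableS _ _ _ mu Rplus `[a, b]%classic _ measurable_Rplus mab sub iq2).
have [mQ iQ] := square_integrable_trunc_line b a0 cmeasurable_mellin_inverse mellin_inverse_le.
have LQ := L2sq_trunc_line b a0 cmeasurable_mellin_inverse mellin_inverse_le.
have [iD eD] := trunc_duality b a0 cmeasurable_mellin_inverse mellin_inverse_le iH.
have [mH iH2] := sH.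
have [iR _] := iD.
have ig : mu.-integrable setT (EFin \o (fun v => normc (H v) ^+ 2 +
    normc (trunc_line c f a b v) ^+ 2 + (-2) * Re (conjc (H v) * trunc_line c f a b v))).
  apply: (integrable_plus measurableT (integrable_plus measurableT iH2 iQ)).
  exact: (integrable_scale measurableT (-2) iR).
have E v : normc (g v) ^+ 2 = normc (H v) ^+ 2 +
    normc (trunc_line c f a b v) ^+ 2 + (-2) * Re (conjc (H v) * trunc_line c f a b v).
  by rewrite normc_sub_sqr mulNr.
split; first split.
- exact: cmeasurableB.
- by apply: eq_integrable ig => // v _; rewrite /= E.
have -> : L2sq g = L2sq H + L2sq (trunc_line c f a b) +
    (-2) * Re (cintegral mu setT (fun v => conjc (H v) * trunc_line c f a b v)).
  rewrite -[Re (cintegral _ _ _)]/(Rintegral mu setT _).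
  rewrite -(Rintegral_scale measurableT (-2) iR) /L2sq.
  rewrite -(Rintegral_add measurableT iH2 iQ).
  rewrite -(Rintegral_add measurableT (integrable_plus measurableT iH2 iQ)
    (integrable_scale measurableT (-2) iR)).
  by apply: eq_Rintegral => v _; rewrite E.
have -> : Re (cintegral mu setT (fun v => conjc (H v) * trunc_line c f a b v)) =
    (2 * Pi)^-1 * Rintegral mu `[a, b] q2.
  rewrite eD -(Rintegral_scale mab _ iab).
  have E2 t : `[a, b]%classic t -> f t * (t `^ (c - 1))%:C * conjc (line_power 0 H t) =
      ((2 * Pi)^-1 * q2 t)%:C.
    move=> /pos t0; rewrite mellin_inverse_shift// /q2.
    have -> : t^-1 = t `^ (- c) * t `^ (c - 1).
      by rewrite -powRD ?(gt_eqF t0) ?implybT// addrA addNr sub0r powR_inv1// ltW.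
    have CM (x y : R) : (x * y)%:C = x%:C * y%:C :> R[i] by exact: rmorphM.
    transitivity (((2 * Pi)^-1 * t `^ (- c))%:C * (t `^ (c - 1))%:C *
      (line_power 0 H t * conjc (line_power 0 H t))).
      by move: (line_power 0 H t) => l; ring.
    rewrite mulcJ; move: (normc _ ^+ 2) (2 * Pi)^-1 => n P.
    by rewrite !CM; ring.
  by rewrite (@eq_cintegral _ _ _ mu _ _ _ E2) cintegral_real.
have : trunc_energy c f a b = (2 * Pi)^-2 * Rintegral mu `[a, b] q2.
  rewrite -(Rintegral_scale mab _ iab); apply: eq_Rintegral => t /set_mem /pos t0.
  exact: energyE.
move: LQ => + e; rewrite e; move: (Rintegral _ _ _) (L2sq _) (L2sq _) => z l1 l2.
have -> : 2 * Pi * ((2 * Pi)^-2 * z) = (2 * Pi)^-1 * z.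
  by move: p0; move: (2 * Pi) => P P0; field; rewrite gt_eqF.
lra.
Qed.

(** By [mellin_trunc_dist] the squared error is at most the part of Plancherel's equality not yet
    exhausted by the truncation interval, so it tends to 0. Continuity of [H] enters through that
    equality. *)
Theorem mellin_of_inverse : is_mellin c f F.
Proof.
split; [exact: mellin_memL2_Rplus|exact: mellin_memL2_line|].
pose r (p : R * R) := L2sq (fun v => H v - trunc_line c f p.1 p.2 v).
have fin (p : R * R) : 0 < p.1 ->
    (\int[mu]_t (normc (F (c +i* t) - mellin_trunc f p.1 p.2 (c +i* t)) ^+ 2)%:E)%E = (r p)%:E.
  by move=> /(mellin_trunc_dist p.2)[[_ i] _]; rewrite -(Rintegral_EFin measurableT i).
suff h e : 0 < e -> \forall p \near filter_prod (0 : R)^'+ (pinfty_nbhs R),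
    0 < p.1 /\ r p <= e.
  apply/fine_cvgP; split.
    have := h 1 ltr01; apply: filterS => p [p1 _].
    by rewrite (fin p p1).
  apply/cvgr0Pnorm_le => e e0; have := h e e0; apply: filterS => p [p1 re].
  by rewrite /= (fin p p1)/= ger0_norm// L2sq_ge0.
move=> e0.
have near_hseq_itv (x : R) : Rplus x -> \forall n \near \oo, `[hseq n, (hseq n)^-1]%classic x.
  move=> /Rplus_gt0 x0; near=> n; rewrite /= in_itv/=; apply/andP; split.
    by apply: ltW; near: n; exact: near_hseq.
  rewrite -[leLHS]invrK lef_pV2 ?posrE ?invr_gt0 ?hseq_gt0//.
  by apply: ltW; near: n; apply: near_hseq; rewrite invr_gt0.
have sub n : `[hseq n, (hseq n)^-1]%classic `<=` (Rplus : set R).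
  move=> x; rewrite /Rplus/= !in_itv/= andbT => /andP[h _].
  exact: lt_le_trans (hseq_gt0 _) h.
have [c1 _] := @cintegral_bigcup_cvg _ _ _ mu (fun n => `[hseq n, (hseq n)^-1]%classic) Rplus
  (fun v => (q2 v)%:C) (fun n => measurable_itv _) measurable_Rplus sub
  near_hseq_itv (@cintegrable_real _ _ _ mu Rplus _ iq2).
have pe : Rintegral mu Rplus q2 = 2 * Pi * L2sq H := plancherel_eq iH HM cH.
have {c1}c1 : Rintegral mu `[hseq n, (hseq n)^-1] q2 @[n --> \oo] --> 2 * Pi * L2sq H.
  by rewrite -pe; exact: c1.
have lt : 2 * Pi * L2sq H - 2 * Pi * e < 2 * Pi * L2sq H.
  by rewrite gtrBl mulr_gt0.
have [n _ /(_ n (leqnn n)) /= hn] := cvgr_gt _ c1 _ lt.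
(* The integral of the nonnegative [q2] grows with the interval, so one good level [n] handles all
   larger intervals, whatever the relative speed of the two ends. *)
suff main (p : R * R) : 0 < p.1 -> p.1 < hseq n -> (hseq n)^-1 < p.2 -> 0 < p.1 /\ r p <= e.
  exists ([set x | 0 < x /\ x < hseq n], [set x | (hseq n)^-1 < x]).
    split => /=; last by exists (hseq n)^-1; split => //; exact: num_real.
    near=> x; split; near: x; [exact: nbhs_right_gt|apply: nbhs_right_lt].
    exact: hseq_gt0.
  by move=> p [/= [? ?] ?]; exact: main.
move=> p1 p1' p2; split => //.
have [_ le] := mellin_trunc_dist p.2 p1; apply: le_trans le _.
have subn : `[hseq n, (hseq n)^-1]%classic `<=` (`[p.1, p.2]%classic : set R).
  move=> x /=; rewrite !in_itv/= => /andP[h1 h2].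
  by rewrite (le_trans (ltW p1') h1) (le_trans h2 (ltW p2)).
have subp : `[p.1, p.2]%classic `<=` (Rplus : set R).
  by move=> x; rewrite /Rplus/= !in_itv/= andbT => /andP[h _]; exact: lt_le_trans p1 h.
have mp : measurable (`[p.1, p.2]%classic : set (measurableTypeR R)) by exact: measurable_itv.
have mn : measurable (`[hseq n, (hseq n)^-1]%classic : set (measurableTypeR R)) by exact: measurable_itv.
have ip : mu.-integrable `[p.1, p.2] (EFin \o q2).
  exact: (@integrableS _ _ _ mu Rplus `[p.1, p.2]%classic _ measurable_Rplus mp subp iq2).
have q20 x : `[p.1, p.2]%classic x -> 0 <= q2 x.
  by move=> /subp /Rplus_gt0 x0; rewrite mulr_ge0 ?sqr_ge0// invr_ge0 ltW.
have := Rintegral_subset mn mp subn ip q20; move: hn.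
move: (Rintegral _ _ _) (Rintegral _ _ _) => z1 z2 h1 h2.
rewrite lerBlDr -lerBlDl mulrC ler_pdivlMr//; move: h1 h2; move: p0 e0.
move: (2 * Pi) (L2sq H) => P L P0 e0 h1 h2; nra.
Unshelve. all: by end_near. Qed.

End MellinInverse.

(** * The factorization *)

Section WeightedDensities.
Context {R : realType}.
Local Notation mu := (@lebesgue_measure R).
Implicit Types (A B k : R -> R[i]) (t v c : R).

(** The weighted L_1 condition is the one under which H_+ acts as a multiplier; the weighted L_2
    condition makes the convolution of two such densities, weights included, defined at every
    point. *)
Definition weighted_density A : Prop :=
  [/\ cmeasurable setT A,
      mu.-integrable setT (fun t => (wgt t * normc (A t))%:E) &
      mu.-integrable setT (fun t => ((wgt t * normc (A t)) ^+ 2)%:E)].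

Lemma measurable_wgt : measurable_fun (setT : set R) wgt.
Proof.
apply: (measurableT_comp (measurable_powR _)).
apply: measurable_funD; first exact: measurable_cst.
exact: (measurableT_comp (@normr_measurable R _)).
Qed.

Lemma measurable_wgt_normc A : cmeasurable setT A ->
  measurable_fun (setT : set R) (fun t => wgt t * normc (A t)).
Proof. by move=> mA; apply: measurable_funM; [exact: measurable_wgt|exact: measurable_normc]. Qed.

Lemma normc_le_wgt A t : normc (A t) <= wgt t * normc (A t).
Proof. by rewrite ler_peMl ?normc_ge0 ?wgt_ge1. Qed.

Lemma weighted_density_integrable A : weighted_density A -> cintegrable mu setT A.
Proof.
move=> [mA iA _]; apply: (@cintegrable_dom _ _ _ mu _ measurableT _ _ mA iA) => t _.
exact: normc_le_wgt.
Qed.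

Lemma weighted_density_L2 A : weighted_density A -> square_integrable A.
Proof.
move=> [mA _ iA]; split => //.
apply: (@integrable_dom _ _ _ mu _ measurableT _ _ _ iA) => [|t _].
  by apply: measurable_funX; exact: measurable_normc.
rewrite ger0_norm ?sqr_ge0// ler_pXn2r ?nnegrE ?normc_ge0 ?normc_le_wgt//.
exact: le_trans (normc_ge0 _) (normc_le_wgt A t).
Qed.

Lemma weighted_density_mul A k M : weighted_density A -> cmeasurable setT k ->
  (forall t, normc (k t) <= M) -> weighted_density (fun t => k t * A t).
Proof.
move=> [mA iA iA2] mk kM.
have M0 : 0 <= M := le_trans (normc_ge0 _) (kM 0).
have mkA : cmeasurable setT (fun t => k t * A t) by exact: cmeasurableM.
have w0 t : 0 <= wgt t by exact: ltW (wgt_gt0 t).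
have le t : wgt t * normc (k t * A t) <= M * (wgt t * normc (A t)).
  by rewrite normc_mulM mulrCA ler_wpM2r// mulr_ge0 ?normc_ge0.
have g0 t : 0 <= wgt t * normc (k t * A t) by rewrite mulr_ge0 ?normc_ge0.
split => //.
  apply: (@integrable_dom _ _ _ mu _ measurableT _ _ _ (integrable_scale measurableT M iA)) => [|t _].
    exact: measurable_wgt_normc.
  by rewrite ger0_norm.
apply: (@integrable_dom _ _ _ mu _ measurableT _ _ _ (integrable_scale measurableT (M ^+ 2) iA2)) => [|t _].
  by apply: measurable_funX; exact: measurable_wgt_normc.
rewrite ger0_norm ?sqr_ge0// -exprMn ler_pXn2r ?nnegrE//.
by rewrite mulr_ge0// mulr_ge0 ?normc_ge0.
Qed.

(** A convolution keeps the weighted L_1 condition, through [conv_weighted], and gains boundedness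
    in place of the weighted L_2 condition. This is what the half-Hilbert and Mellin statements ask
    of the density of f * g, apart from continuity. *)
Lemma weighted_density_conv A B : weighted_density A -> weighted_density B ->
  [/\ forall t, cintegrable mu setT (fun v => A (t - v) * B v),
      cmeasurable setT (conv A B),
      mu.-integrable setT (fun t => (wgt t * normc (conv A B t))%:E) &
      exists M, forall t, normc (conv A B t) <= M].
Proof.
move=> gA gB; have sA := weighted_density_L2 gA; have sB := weighted_density_L2 gB.
have iAB t := (conv_L2 t sA sB (@ltr01 R)).1.
have [_ h _] := conv_integral (weighted_density_integrable gA) (weighted_density_integrable gB)
  iAB (cmeasurable_cst setT 1) (fun _ => lexx (normc (1 : R[i]))).
have mAB : cmeasurable setT (conv A B).
  apply: eq_cmeasurable (cintegrable_measurable h) => t _.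
  by rewrite mulr1.
have [mA iA iA2] := gA; have [mB iB iB2] := gB.
have w0 t : 0 <= wgt t by exact: ltW (wgt_gt0 t).
have swg D : weighted_density D -> square_integrable (fun t => (wgt t * normc (D t))%:C).
  move=> [mD _ iD2]; split; first by apply: cmeasurable_real; exact: measurable_wgt_normc.
  by apply: eq_integrable iD2 => // t _; rewrite normc_real ger0_norm// mulr_ge0 ?normc_ge0.
split => //.
  apply: conv_weighted => // t.
  exact: (conv_L2 t (swg _ gA) (swg _ gB) (@ltr01 R)).1.
exists (2^-1 * (1 * L2sq A + 1^-1 * L2sq B)) => t.
exact: (conv_L2 t sA sB (@ltr01 R)).2.
Qed.

(** An even tail of order -3/2, dominated through the maps 1 + t and 1 - t by a power on a
    half-line. The exponent is the gap between the squared weight, of order 1/2, and |s|^2, of order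
    2. *)
Lemma integrable_wgt_tail : mu.-integrable setT (fun t => (((1 + `|t|) `^ (- (2^-1) - 1)))%:E).
Proof.
(* The first 1/2 is a threshold: any positive number below 1 would do, as 1 + |t| >= 1 must lie
   strictly beyond it. *)
have h := @integrable_powR_high R 2^-1 2^-1 ltac:(by rewrite invr_gt0) ltac:(by rewrite invr_gt0).
have mI : measurable (`]2^-1, +oo[%classic : set (measurableTypeR R)) by exact: measurable_itv.
have i := integrable_indic_mul mI h.
have i1 := integrable_shift false 1 i; have i2 := integrable_shift true 1 i.
pose p t : R := \1_(`]2^-1, +oo[%classic : set R) t * t `^ (- 2^-1 - 1).
have s := @integrable_plus _ _ _ mu setT measurableT (p \o shift_map false 1) (p \o shift_map true 1) i1 i2.
apply: (@integrable_dom _ _ _ mu _ measurableT _ _ _ s) => [|t _].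
  apply: (measurableT_comp (measurable_powR _)).
  apply: measurable_funD; first exact: measurable_cst.
  exact: (measurableT_comp (@normr_measurable R _)).
have p0 u : 0 <= p u by rewrite mulr_ge0 ?powR_ge0.
have pE u : 2^-1 < u -> p u = u `^ (- 2^-1 - 1).
  by move=> hu; rewrite /p indicE mem_set ?mul1r//= in_itv/= hu.
have h21 : (2^-1 : R) < 1 by rewrite invf_lt1// ltr1n.
rewrite ger0_norm ?powR_ge0// /comp /shift_map expr0 expr1 mul1r mulN1r.
case: (leP 0 t) => t0.
  by rewrite ger0_norm// ler_wpDr// pE// (lt_le_trans h21)// lerDl.
by rewrite ltr0_norm// ler_wpDl// pE// (lt_le_trans h21)// lerDl oppr_ge0 ltW.
Qed.

(** For 0 < c < 1 one has (1 + |t|)^2 <= 2 |c + i t|^2 / c^2, so the squared weighted density is at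
    most p = (1 + |t|)^(-3/2) times a multiple of |s F|^2. The weighted L_2 condition follows from p
    <= 1, the weighted L_1 condition from [amgm] with parameter p, as p is integrable. *)
Lemma weighted_density_of_memL2 c (F : R[i] -> R[i]) : 0 < c -> c < 1 ->
  memL2_line c F -> memL2_line c (fun s => s * F s) ->
  weighted_density (fun t => F (c +i* t)%C).
Proof.
move=> c0 c1 [mF _] [msF isF].
pose A t := F (c +i* t)%C.
pose q t := normc ((c +i* t)%C * F (c +i* t)%C) ^+ 2.
have mq : measurable_fun setT q by apply: measurable_funX; exact: measurable_normc.
have iq : mu.-integrable setT (EFin \o q).
  apply/integrableP; split; first exact/measurable_EFinP.
  rewrite (_ : (fun x => `|(EFin \o q) x|)%E = fun t => (q t)%:E)//.
  by apply/funext => t /=; rewrite ger0_norm// sqr_ge0.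
have w0 t : 0 <= wgt t by exact: ltW (wgt_gt0 t).
have n0 (t : R) : 1 <= 1 + `|t| :> R by rewrite lerDl.
have n1 (t : R) : 0 < 1 + `|t| :> R by exact: lt_le_trans ltr01 (n0 t).
have w2 t : wgt t ^+ 2 = (1 + `|t|) `^ 2^-1.
  rewrite expr2 /wgt -powRD ?(gt_eqF (n1 t)) ?implybT//; congr (_ `^ _); lra.
have s2 (t : R) : (1 + `|t|) ^+ 2 <= 2 * c ^- 2 * normc (c +i* t)%C ^+ 2.
  rewrite normc_sqr/= mulrAC ler_pdivlMr ?exprn_gt0//.
  have : `|t| ^+ 2 = t ^+ 2 by rewrite real_normK ?num_real.
  move: (normr_ge0 t); move: `|t| => u u0 <-.
  have c2 : c ^+ 2 <= 1 by rewrite expr_le1// ltW.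
  have := sqr_ge0 c; have := sqr_ge0 (1 - u).
  move: (c ^+ 2) c2 => d d1 h1 d0; nra.
have e21 (t : R) : (1 + `|t|) `^ 2^-1 = (1 + `|t|) `^ (- 2^-1 - 1) * (1 + `|t|) ^+ 2.
  rewrite -[X in _ * X]powR_mulrn ?(ltW (n1 t))// -powRD ?(gt_eqF (n1 t)) ?implybT//.
  by congr (_ `^ _); lra.
have ge (t : R) : (1 + `|t|) `^ (- 2^-1 - 1) <= 1 :> R.
  apply: (@le_trans _ _ ((1 + `|t|) `^ 0)); last by rewrite powRr0.
  by apply: ler_powR => //; lra.
have qE t : q t = normc (c +i* t)%C ^+ 2 * normc (A t) ^+ 2.
  by rewrite /q normc_mulM exprMn.
have C0 : 0 <= 2 * c ^- 2 by rewrite mulr_ge0// invr_ge0 sqr_ge0.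
have key t : wgt t ^+ 2 * normc (A t) ^+ 2 <=
    (1 + `|t|) `^ (- 2^-1 - 1) * (2 * c ^- 2 * q t).
  rewrite w2 e21 -mulrA ler_wpM2l ?powR_ge0// qE [leRHS]mulrA.
  by apply: ler_wpM2r; [exact: sqr_ge0|exact: s2].
split => //.
  have i1 := integrable_wgt_tail.
  have i2 := integrable_scale measurableT (2 * c ^- 2) iq.
  have i3 := @integrable_scale _ _ _ mu setT measurableT 1 (fun t => (1 + `|t|) `^ (- (2^-1) - 1)) i1.
  have i := integrable_scale measurableT 2^-1 (integrable_plus measurableT i3 i2).
  apply: (@integrable_dom _ _ _ mu _ measurableT _ _ _ i) => [|t _].
    exact: measurable_wgt_normc.
  rewrite ger0_norm ?mulr_ge0 ?normc_ge0//.
  set p := (1 + `|t|) `^ _.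
  have pp : 0 < p by exact: powR_gt0.
  have a0 : 0 <= wgt t * normc (A t) by rewrite mulr_ge0 ?normc_ge0.
  have k := key t; rewrite -exprMn -/p in k.
  move: a0 k; move: (wgt t * _) (2 * c ^- 2 * q t) => x y x0 k.
  have /= := amgm 1 x pp.
  rewrite expr1n mulr1 mul1r => h; apply: le_trans h _.
  by rewrite ler_wpM2l// mul1r lerD2l mulrC ler_pdivrMr// mulrC.
have i2 := integrable_scale measurableT (2 * c ^- 2) iq.
apply: (@integrable_dom _ _ _ mu _ measurableT _ _ _ i2) => [|t _].
  by apply: measurable_funX; exact: measurable_wgt_normc.
rewrite ger0_norm ?sqr_ge0// exprMn; apply: le_trans (key t) _.
by rewrite ler_piMl// mulr_ge0// sqr_ge0.
Qed.

End WeightedDensities.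

(** * The cotangent multiplier on vertical lines *)

Section CotangentLine.
Context {R : realType}.
Local Notation Pi := (pi : R).
Implicit Types (c t : R) (A B : R -> R[i]).

Lemma ccontinuousM A B : ccontinuous A -> ccontinuous B ->
  ccontinuous (fun t => A t * B t).
Proof. by move=> cA cB t; exact: ccvgM (cA t) (cB t). Qed.

Lemma ccontinuousV A : ccontinuous A -> (forall t, A t != 0) ->
  ccontinuous (fun t => (A t)^-1).
Proof. by move=> cA A0 t; exact: ccvgV (A0 t) (cA t). Qed.

Lemma ccontinuous_cst (z : R[i]) : ccontinuous (fun _ : R => z).
Proof. by move=> t; exact: ccvg_cst. Qed.

Lemma ccontinuous_cexp_line c (z : R[i]) :
  ccontinuous (fun t => cexp (z * (Pi%:C * (c +i* t)%C))).
Proof.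
move=> t; have d0 : cderiv (fun t : R => (c +i* t)%C) t 'i%C.
  by split; [exact: is_derive_cst|exact: is_derive_id].
by have [h1 h2] := cderiv_continuous (cderiv_cexp (cderivMl z (cderivMl Pi%:C d0))); split.
Qed.

Lemma ccontinuous_csin_line c : ccontinuous (fun t => csin (Pi%:C * (c +i* t)%C)).
Proof.
apply: ccontinuousM; last exact: ccontinuous_cst.
move=> t; apply: ccvgB; first exact: ccontinuous_cexp_line.
have := @ccontinuous_cexp_line c (- 'i%C) t.
by under eq_fun do rewrite mulNr; rewrite mulNr.
Qed.

Lemma ccontinuous_ccos_line c : ccontinuous (fun t => ccos (Pi%:C * (c +i* t)%C)).
Proof.
apply: ccontinuousM; last exact: ccontinuous_cst.
move=> t; apply: ccvgD; first exact: ccontinuous_cexp_line.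
have := @ccontinuous_cexp_line c (- 'i%C) t.
by under eq_fun do rewrite mulNr; rewrite mulNr.
Qed.

Lemma csin_line_neq0 c t : sin (Pi * c) != 0 -> csin (Pi%:C * (c +i* t)%C) != 0.
Proof. by move=> h; apply: csin_neq0; rewrite ReMr. Qed.

Lemma ccos_line_neq0 c t : cos (Pi * c) != 0 -> ccos (Pi%:C * (c +i* t)%C) != 0.
Proof. by move=> h; apply: ccos_neq0; rewrite ReMr. Qed.

Lemma ccontinuous_ccot_line c : sin (Pi * c) != 0 ->
  ccontinuous (fun t => ccot (Pi%:C * (c +i* t)%C)).
Proof.
move=> h; apply: ccontinuousM; first exact: ccontinuous_ccos_line.
by apply: ccontinuousV; [exact: ccontinuous_csin_line|move=> t; exact: csin_line_neq0].
Qed.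

Lemma ccot_line_neq0 c t : sin (Pi * c) != 0 -> cos (Pi * c) != 0 ->
  ccot (Pi%:C * (c +i* t)%C) != 0.
Proof. by move=> h1 h2; rewrite mulf_neq0 ?invr_neq0 ?ccos_line_neq0 ?csin_line_neq0. Qed.

Lemma normc_ccot_line c t : sin (Pi * c) != 0 ->
  normc (ccot (Pi%:C * (c +i* t)%C)) <= `|sin (Pi * c)|^-1.
Proof. by move=> h; have := @normc_ccot_le R (Pi%:C * (c +i* t)%C); rewrite ReMr; apply. Qed.

Lemma normc_ccotV_line c t : cos (Pi * c) != 0 ->
  normc (ccot (Pi%:C * (c +i* t)%C))^-1 <= `|cos (Pi * c)|^-1.
Proof. by move=> h; have := @normc_ccotV_le R (Pi%:C * (c +i* t)%C); rewrite ReMr; apply. Qed.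

(** By cot (z + w) = (cot z cot w - 1) / (cot z + cot w), the left side exceeds cot z + cot w by tan
    (z + w). The tangent is written as minus a shifted cotangent so that it can be read as a
    half-Hilbert multiplier on another line. *)
Lemma ccot_addition (z w : R[i]) : csin z != 0 -> csin w != 0 ->
  csin (z + w) != 0 -> ccos (z + w) != 0 ->
  ccot z * ccot w / ccot (z + w) =
  ccot z + ccot w - ccot (z + w + (Pi / 2)%:C).
Proof.
move=> z0 w0; rewrite /ccot csinDpihalf ccosDpihalf csinD ccosD.
move: (csin z) (csin w) (ccos z) (ccos w) z0 w0 => a b p q a0 b0 s0 c0.
by field; rewrite a0 b0 s0 c0.
Qed.

End CotangentLine.

(** * Continuity of the spectral density *)

Section MultiplierConvolution.
Context {R : realType}.
Local Notation mu := (@lebesgue_measure R).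
Variables (c S : R) (f : R -> R[i]) (F : R[i] -> R[i]) (k B : R -> R[i]).
Let H t := F (c +i* t)%C.
Hypotheses (fF : is_mellin c f F) (f_inv : forall x, 0 < x -> f x = mellin_inv c F x).
Hypotheses (gH : weighted_density H) (gB : weighted_density B).
Hypotheses (ck : ccontinuous k) (kS : forall t, normc (k t) <= S).

Let iH := weighted_density_integrable gH.
Let sH := weighted_density_L2 gH.
Let sB := weighted_density_L2 gB.

(** This exploits the mean-square convergence contained in [is_mellin]; it turns a merely measurable
    [H] into an L_2 limit of bounded continuous functions. *)
Lemma trunc_approx e : 0 < e -> exists a b, 0 < a /\
  square_integrable (fun v => H v - trunc_line c f a b v) /\
  L2sq (fun v => H v - trunc_line c f a b v) <= e.
Proof.
move=> e0; have [_ _ lim] := fF.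
have /fine_cvgP[n0 c0] := lim.
have n1 := cvgr_lt _ c0 _ e0.
have n2 : \forall p \near filter_prod (0 : R)^'+ (pinfty_nbhs R), 0 < p.1.
  exists ([set x | 0 < x], setT); first by split => /=; [exact: nbhs_right_gt|exact: filterT].
  by move=> p [].
have [[a b] [[h0 h1] a0]] := filter_ex (filterI (filterI n0 (n1 _)) n2).
exists a, b; split => //; set g := fun v => _.
have h : (\int[mu]_t (normc (g t) ^+ 2)%:E < e%:E)%E by rewrite -(fineK h0) lte_fin.
have mg : cmeasurable setT g.
  apply: cmeasurableB; first exact: sH.1.
  apply: ccontinuous_measurable; apply: trunc_line_continuous => //.
    exact: cmeasurable_mellin_inverse iH f_inv.
  exact: mellin_inverse_le iH f_inv.
have ig : mu.-integrable setT (fun v => (normc (g v) ^+ 2)%:E).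
  apply/integrableP; split.
    by apply/measurable_EFinP; apply: measurable_funX; exact: measurable_normc.
  have -> : (\int[mu]_x `|(normc (g x) ^+ 2)%:E| = \int[mu]_t (normc (g t) ^+ 2)%:E)%E.
    by apply: eq_integral => t _ /=; rewrite ger0_norm// sqr_ge0.
  exact: lt_trans h (ltry _).
split; first by split.
by rewrite -lee_fin /L2sq -(Rintegral_EFin measurableT ig) ltW.
Qed.

(* [H] need not be continuous; replacing it by its truncated transforms, which
   are, changes the convolution uniformly little. *)
Lemma conv_multiplier_continuous : ccontinuous (conv (fun t => k t * H t) B).
Proof.
have mk := ccontinuous_measurable ck.
have S0 : 0 <= S := le_trans (normc_ge0 _) (kS 0).
have gA := weighted_density_mul gH mk kS.
have sA := weighted_density_L2 gA.
have iB := weighted_density_integrable gB.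
have Y0 := L2sq_ge0 B; set Y := L2sq B in Y0.
have approx e : 0 < e -> exists2 P : R -> R[i], ccontinuous P &
    forall t, normc (conv (fun t => k t * H t) B t - P t) <= e.
  move=> e0.
  have S1 : 0 < S ^+ 2 + 1 by rewrite ltr_wpDl ?sqr_ge0.
  have Y1 : 0 < Y + 1 by rewrite ltr_wpDl.
  (* The parameter of [conv_L2] is large enough to keep the term in [L2sq B] below e; the
     approximation error e / l / (S^2 + 1) then brings the other term below e. The added ones keep
     both quantities positive. *)
  pose l := (Y + 1) / e.
  have l0 : 0 < l by rewrite divr_gt0.
  have [a [b [a0 [sg Lg]]]] := trunc_approx (divr_gt0 (divr_gt0 e0 l0) S1).
  have mf := cmeasurable_mellin_inverse iH f_inv.
  have fK := mellin_inverse_le iH f_inv.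
  have cQ := trunc_line_continuous b a0 mf fK.
  have bQ := trunc_line_le b a0 mf fK.
  have sQ := square_integrable_trunc_line b a0 mf fK.
  pose P t := k t * trunc_line c f a b t.
  have bP t : normc (P t) <= S * trunc_bound
      ((2 * pi)^-1 * Rintegral mu setT (fun t => normc (H t))) a b.
    by rewrite normc_mulM ler_pM ?normc_ge0.
  have mg := sg.1.
  pose D t := k t * (H t - trunc_line c f a b t).
  have sqk (A : R -> R[i]) : square_integrable A ->
      square_integrable (fun t => k t * A t) /\
      L2sq (fun t => k t * A t) <= S ^+ 2 * L2sq A.
    move=> [mA iA]; have i := integrable_scale measurableT (S ^+ 2) iA.
    have le t : normc (k t * A t) ^+ 2 <= S ^+ 2 * normc (A t) ^+ 2.
      rewrite normc_mulM exprMn ler_wpM2r ?sqr_ge0//.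
      by rewrite ler_pXn2r ?nnegrE ?normc_ge0.
    have mkA : cmeasurable setT (fun t => k t * A t) by exact: cmeasurableM.
    have ikA : mu.-integrable setT (fun t => (normc (k t * A t) ^+ 2)%:E).
      apply: (@integrable_dom _ _ _ mu _ measurableT _ _ _ i) => [|t _].
        by apply: measurable_funX; exact: measurable_normc.
      by rewrite ger0_norm ?sqr_ge0.
    split; first by split.
    rewrite /L2sq -(Rintegral_scale measurableT _ iA).
    by apply: le_Rintegral.
  have [sD LD] := sqk _ sg.
  have [sP _] := sqk _ sQ.
  exists (conv P B); first by apply: conv_continuous bP iB; exact: ccontinuousM.
  move=> t.
  have [i1 _] := conv_L2 t sA sB l0; have [i2 _] := conv_L2 t sP sB l0.
  have -> : conv (fun t => k t * H t) B t - conv P B t = conv D B t.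
    rewrite -(cintegralB measurableT i1 i2); apply: eq_cintegral => v _.
    by rewrite /D /P; ring.
  have [_ le] := conv_L2 t sD sB l0; apply: le_trans le _.
  have h1 : l * L2sq D <= e.
    rewrite mulrC -ler_pdivlMr//; apply: le_trans LD _.
    apply: le_trans (ler_wpM2l (sqr_ge0 S) Lg) _.
    rewrite mulrA ler_pdivrMr// mulrC ler_wpM2l//.
      by rewrite divr_ge0 ?ltW.
    by rewrite lerDl.
  have h2 : l^-1 * L2sq B <= e.
    by rewrite /l invf_div mulrAC ler_pdivrMr// ler_wpM2l ?ltW// ltrDl.
  lra.
move=> t; apply: ccvg_dist_le => e e0.
have e3 : 0 < e / 3 by rewrite divr_gt0.
have [P cP hP] := approx _ e3.
have /ccvgP/cvgr0Pnorm_le/(_ _ e3) := cP t.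
apply: filterS => v; rewrite ger0_norm ?normc_ge0// => hv.
set Q := conv _ B.
have -> : Q v - Q t = (Q v - P v) + (P v - P t) - (Q t - P t) by ring.
apply: le_trans (normcB _ _) _; apply: le_trans (lerD (normcD _ _) (lexx _)) _.
have := hP v; have := hP t; rewrite -/Q => h1 h2.
by move: h1 h2 hv; lra.
Qed.

End MultiplierConvolution.

Section LineTransforms.
Context {R : realType}.
Local Notation mu := (@lebesgue_measure R).
Local Notation Pi := (pi : R).
Implicit Types (A B : R -> R[i]) (t v x : R).

Lemma eq_line_power c A B x : (forall t, A t = B t) -> line_power c A x = line_power c B x.
Proof. by move=> e; apply: eq_cintegral => t _; rewrite e. Qed.

Lemma line_powerZ c (z : R[i]) A x : cintegrable mu setT A -> 0 < x ->
  line_power c (fun t => z * A t) x = z * line_power c A x.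
Proof.
move=> iA x0; rewrite -(cintegralZ measurableT z (cintegrable_line_power c iA x0)).
by apply: eq_cintegral => t _; rewrite mulrA.
Qed.

(** The constant [z] accommodates the normalization of inversion integrals: 1 / (2 pi) for f and g,
    its square for f * g and for the product f g. *)
Lemma half_hilbert_line c A (z : R[i]) (phi : R -> R[i]) : 0 < c -> c < 1 ->
  cmeasurable setT A -> mu.-integrable setT (fun t => (wgt t * normc (A t))%:E) ->
  (forall x, 0 < x -> phi x = z * line_power c A x) ->
  forall x, 0 < x ->
  [/\ half_hilbert_cvg phi x,
      half_hilbert phi x =
        z * line_power c (fun t => ccot (Pi%:C * (c +i* t)%C) * A t) x,
      cintegrable mu Rplus (reg phi x) &
      cintegral mu Rplus (reg phi x) = Pi%:C * half_hilbert phi x].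
Proof.
move=> c0 c1 mA wA phiE x x0.
have iA : cintegrable mu setT A.
  apply: (@cintegrable_dom _ _ _ mu _ measurableT _ _ mA wA) => t _.
  exact: normc_le_wgt.
pose zA t := z * A t.
have mzA : cmeasurable setT zA by apply: cmeasurableM => //; exact: cmeasurable_cst.
have wzA : mu.-integrable setT (fun t => (wgt t * normc (zA t))%:E).
  have := integrable_scale measurableT (normc z) wA.
  by apply: eq_integrable => // t _; rewrite /zA normc_mulM /= mulrCA.
have E u : 0 < u -> phi u = cintegral mu setT (fun v => zA v * cpow u (- (c +i* v)%C)).
  by move=> u0; rewrite phiE// -[RHS]/(line_power c zA u) line_powerZ.
have [h1 h2] := reg_power c0 c1 mzA wzA E x0.
split => //; first exact: (half_hilbert_cvg_power c0 c1 mzA wzA E x0).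
rewrite (half_hilbert_power c0 c1 mzA wzA E x0).
have ik : cintegrable mu setT (fun t => ccot (Pi%:C * (c +i* t)%C) * A t).
  have s0 := sin_pi_neq0 c0 c1.
  have ib := integrable_scale measurableT `|sin (Pi * c)|^-1 (cintegrable_norm measurableT iA).
  apply: (@cintegrable_dom _ _ _ mu _ measurableT _ _ _ ib) => [|t _].
    apply: cmeasurableM; last exact: mA.
    by apply: ccontinuous_measurable; exact: ccontinuous_ccot_line.
  by rewrite normc_mulM ler_wpM2r ?normc_ge0 ?normc_ccot_line.
rewrite -line_powerZ//; apply: eq_cintegral => t _.
by rewrite /zA; move: (ccot _) (cpow _ _) (A t) => p q r; ring.
Qed.

End LineTransforms.

(** * Transform of f * g, factorization and commutator formula *)

Section Factorization.
Context {R : realType}.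
Local Notation mu := (@lebesgue_measure R).
Local Notation Pi := (pi : R).
Variables (alpha : R) (f g : R -> R[i]) (F G : R[i] -> R[i]).
Hypotheses (alpha_gt0 : 0 < alpha) (alpha_lt : alpha < 4^-1)
    (fF : is_mellin alpha f F) (gG : is_mellin alpha g G)
    (sF_L2 : memL2_line alpha (fun s => s * F s))
    (sG_L2 : memL2_line alpha (fun s => s * G s))
    (f_inv : forall x, 0 < x -> f x = mellin_inv alpha F x)
    (g_inv : forall x, 0 < x -> g x = mellin_inv alpha G x).

Let Ft t := F (alpha +i* t)%C.
Let Gt t := G (alpha +i* t)%C.
Let cotl t : R[i] := ccot (Pi%:C * (alpha +i* t)%C).
Let A t := cotl t * Ft t.
Let B t := cotl t * Gt t.
Let k t : R[i] := (ccot (Pi%:C * ((2 * alpha) +i* t)%C))^-1.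
Let K : R[i] := ((2 * Pi)^-1)%:C.

Let alpha_lt1 : alpha < 1. Proof. by apply: lt_trans alpha_lt _; lra. Qed.
Let alpha2_gt0 : 0 < 2 * alpha. Proof. by rewrite mulr_gt0. Qed.
Let alpha2_lt : 2 * alpha < 2^-1. Proof. by move: alpha_lt; lra. Qed.
Let alpha2_lt1 : 2 * alpha < 1. Proof. by apply: lt_trans alpha2_lt _; lra. Qed.
Let sin1 : sin (Pi * alpha) != 0. Proof. exact: sin_pi_neq0. Qed.
Let sin2 : sin (Pi * (2 * alpha)) != 0. Proof. exact: sin_pi_neq0. Qed.
Let cos2 : cos (Pi * (2 * alpha)) != 0. Proof. exact: cos_pi_neq0. Qed.

Let gF : weighted_density Ft.
Proof. by apply: weighted_density_of_memL2 => //; have [_ h _] := fF. Qed.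
Let gG' : weighted_density Gt.
Proof. by apply: weighted_density_of_memL2 => //; have [_ h _] := gG. Qed.

Let cotl_continuous : ccontinuous cotl := ccontinuous_ccot_line sin1.
Let cotl_le t : normc (cotl t) <= `|sin (Pi * alpha)|^-1 := normc_ccot_line t sin1.
Let gA : weighted_density A :=
  weighted_density_mul gF (ccontinuous_measurable cotl_continuous) cotl_le.
Let gB : weighted_density B :=
  weighted_density_mul gG' (ccontinuous_measurable cotl_continuous) cotl_le.

Let k_continuous : ccontinuous k.
Proof.
apply: ccontinuousV; first exact: ccontinuous_ccot_line.
by move=> t; exact: ccot_line_neq0.
Qed.
Let k_le t : normc (k t) <= `|cos (Pi * (2 * alpha))|^-1 := normc_ccotV_line t cos2.

Let C := conv A B.
(** A weighted density is only measurable, so continuity of [C] is not automatic; Plancherel's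
    equality asks for it. *)
Let C_continuous : ccontinuous C.
Proof. exact: conv_multiplier_continuous fF f_inv gF gB cotl_continuous cotl_le. Qed.

Let iA := weighted_density_integrable gA.
Let iB := weighted_density_integrable gB.
Let iF := weighted_density_integrable gF.
Let iG := weighted_density_integrable gG'.

Let kC t := k t * C t.

Let kC_weighted : cmeasurable setT kC /\
  mu.-integrable setT (fun t => (wgt t * normc (kC t))%:E).
Proof.
have [_ mC wC _] := weighted_density_conv gA gB.
have mk := ccontinuous_measurable k_continuous.
have mkC : cmeasurable setT kC by exact: cmeasurableM.
split=> //.
have i := integrable_scale measurableT `|cos (Pi * (2 * alpha))|^-1 wC.
apply: (@integrable_dom _ _ _ mu _ measurableT _ _ _ i) => [|t _].
  exact: measurable_wgt_normc.
have w0 : 0 <= wgt t by exact: ltW (wgt_gt0 t).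
rewrite ger0_norm ?mulr_ge0 ?normc_ge0// normc_mulM mulrCA.
by rewrite ler_wpM2r ?mulr_ge0 ?normc_ge0 ?k_le.
Qed.

Let ikC : cintegrable mu setT kC.
Proof.
have [mkC w] := kC_weighted.
apply: (@cintegrable_dom _ _ _ mu _ measurableT _ _ mkC w) => t _.
exact: normc_le_wgt.
Qed.

Let line_add t v : (alpha +i* t)%C + (alpha +i* v)%C = ((2 * alpha) +i* (t + v))%C :> R[i].
Proof. by apply: complex_eqP; rewrite ?ReD ?ImD/=; ring. Qed.

Let line_sub t v : ((2 * alpha) +i* t)%C - (alpha +i* v)%C = (alpha +i* (t - v))%C :> R[i].
Proof. by apply: complex_eqP; rewrite ?ReB ?ImB/=; ring. Qed.

(** The cotangents of s and w go to the densities and the rest is a function of t + v, the shape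
    handled by [conv_integral]. *)
Let kernelE x t v : conv_kernel F G x (alpha +i* t)%C (alpha +i* v)%C =
  A t * B v * (k (t + v) * cpow x (- ((2 * alpha) +i* (t + v))%C)).
Proof.
rewrite /conv_kernel -line_add -opprD /A /B /cotl /k -line_add /Ft /Gt; ring.
Qed.

Let kpow x t : R[i] := k t * cpow x (- ((2 * alpha) +i* t)%C).

Let kernel_integral x : 0 < x ->
  [/\ mellin_conv_cvg alpha F G x,
      cintegrable mu setT (fun v => cintegral mu setT (fun t => A t * B v * kpow x (t + v))) &
      cintegral mu setT (fun v => cintegral mu setT (fun t => A t * B v * kpow x (t + v))) =
      line_power (2 * alpha) kC x].
Proof.
move=> x0; have [iAB _ _ _] := weighted_density_conv gA gB.
have mkp : cmeasurable setT (kpow x).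
  by apply: cmeasurableM; [exact: ccontinuous_measurable|exact: cmeasurable_line_exp].
have lekp t : normc (kpow x t) <= `|cos (Pi * (2 * alpha))|^-1 * x `^ (- (2 * alpha)).
  by rewrite normc_mulM normc_line_exp// ler_wpM2r ?powR_ge0 ?k_le.
have [i1 i2 e] := conv_integral iA iB iAB mkp lekp.
have [_ i3 _ _] := @cfubini _ _ _ _ _ mu mu _ i1.
split.
- by apply: (@eq_cintegrable _ _ _ (mu \x mu)%E _ measurableT _ _ _ i1) => p _; rewrite kernelE.
- exact: i3.
- by rewrite e; apply: eq_cintegral => t _; rewrite /kpow /kC mulrA (mulrC (C t)).
Qed.

Let K_neq0 : (Pi%:C : R[i]) != 0.
Proof. by rewrite -normc_eq0 normc_real normr_eq0 gt_eqF ?pi_gt0. Qed.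
Let i_neq0 : ('i%C : R[i]) != 0.
Proof. by rewrite -normc_eq0 /= expr0n/= add0r expr1n sqrtr1 oner_eq0. Qed.
Let KE : K = (2 * Pi%:C)^-1.
Proof. by rewrite /K fmorphV rmorphM rmorph_nat. Qed.

Let mellin_convE x : 0 < x -> mellin_conv alpha F G x = K ^+ 2 * line_power (2 * alpha) kC x.
Proof.
move=> x0; have [_ i e] := kernel_integral x0.
rewrite /mellin_conv /line_integral.
have -> : cintegral mu setT (fun v => 'i%C * cintegral mu setT
    (fun t => conv_kernel F G x (alpha +i* t)%C (alpha +i* v)%C)) =
    'i%C * line_power (2 * alpha) kC x.
  rewrite -e -(cintegralZ measurableT _ i); apply: eq_cintegral => v _; congr (_ * _).
  by apply: eq_cintegral => t _; rewrite kernelE.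
rewrite KE; move: K_neq0 i_neq0; move: (Pi%:C : R[i]) ('i%C : R[i]) (line_power _ _ _) => p j l p0 j0.
by field; rewrite p0 j0.
Qed.

Let spectral_convE t : spectral_conv alpha F G ((2 * alpha) +i* t)%C = K * kC t.
Proof.
rewrite /spectral_conv /line_integral.
have -> : cintegral mu setT (fun v => spectral_kernel F G ((2 * alpha) +i* t)%C (alpha +i* v)%C) = C t.
  apply: eq_cintegral => v _; rewrite /spectral_kernel line_sub /A /B /cotl /Ft /Gt; ring.
have k0 := ccot_line_neq0 t sin2 cos2.
have fld (q p j z : R[i]) : q != 0 -> p != 0 -> j != 0 ->
    (2 * p * j * q)^-1 * (j * z) = (2 * p)^-1 * (q^-1 * z).
  by move=> q0 p0 j0; field; rewrite q0 p0 j0.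
by rewrite /kC KE /k fld.
Qed.

Let conv_inverse x : 0 < x ->
  mellin_conv alpha F G x = mellin_inv (2 * alpha) (spectral_conv alpha F G) x.
Proof.
move=> x0; rewrite mellin_convE// mellin_inv_line_power.
rewrite (eq_line_power _ _ spectral_convE) line_powerZ//.
by rewrite mulrA -expr2.
Qed.

Lemma spectral_kernel_integrable s : Re s = 2 * alpha ->
  memL1_line alpha (spectral_kernel F G s).
Proof.
case: s => a t /= ->; have [iAB _ _ _] := weighted_density_conv gA gB.
apply: (eq_cintegrable measurableT _ (iAB t)) => v _.
by rewrite /spectral_kernel line_sub /A /B /cotl /Ft /Gt; ring.
Qed.

(** f * g is the inversion integral of [spectral_conv], whose values on the line, [K * kC t], are
    integrable, bounded and continuous in t; [mellin_of_inverse] does the rest. *)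
Lemma mellin_conv_is_mellin :
  is_mellin (2 * alpha) (mellin_conv alpha F G) (spectral_conv alpha F G).
Proof.
have [_ _ _ [M CM]] := weighted_density_conv gA gB.
have iH : cintegrable mu setT (fun t => spectral_conv alpha F G ((2 * alpha) +i* t)%C).
  apply: (eq_cintegrable measurableT _ (cintegrableZ measurableT K ikC)) => t _.
  by rewrite spectral_convE.
have k0 : 0 <= `|cos (Pi * (2 * alpha))|^-1 by rewrite invr_ge0.
have HM t : normc (spectral_conv alpha F G ((2 * alpha) +i* t)%C) <=
    normc K * (`|cos (Pi * (2 * alpha))|^-1 * M).
  rewrite spectral_convE normc_mulM ler_wpM2l ?normc_ge0// normc_mulM.
  by rewrite ler_pM ?normc_ge0 ?k_le.
have cH : ccontinuous (fun t => spectral_conv alpha F G ((2 * alpha) +i* t)%C).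
  rewrite (funext spectral_convE : (fun t => _) = (fun t => K * kC t)).
  apply: ccontinuousM; first exact: ccontinuous_cst.
  exact: ccontinuousM.
exact: mellin_of_inverse iH HM cH conv_inverse.
Qed.

Lemma conv_kernel_integrable x : 0 < x -> mellin_conv_cvg alpha F G x.
Proof. by move=> /kernel_integral[]. Qed.

Let fE x : 0 < x -> f x = K * line_power alpha Ft x.
Proof. by move=> x0; rewrite f_inv// mellin_inv_line_power. Qed.
Let gE x : 0 < x -> g x = K * line_power alpha Gt x.
Proof. by move=> x0; rewrite g_inv// mellin_inv_line_power. Qed.

Let hf x (x0 : 0 < x) :=
  let: And3 mA wA _ := gF in half_hilbert_line alpha_gt0 alpha_lt1 mA wA fE x0.
Let hg x (x0 : 0 < x) :=
  let: And3 mA wA _ := gG' in half_hilbert_line alpha_gt0 alpha_lt1 mA wA gE x0.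

Let double_alpha : alpha + alpha = 2 * alpha. Proof. by ring. Qed.

(** Applying H_+ to f * g multiplies its density [kC] by cot (pi s), which cancels [k] and leaves
    [C], the density of the product of the two transforms. Both sides carry the constant
    [K ^+ 2]. *)
Lemma half_hilbert_factorization x : 0 < x ->
  [/\ half_hilbert_cvg f x, half_hilbert_cvg g x,
      half_hilbert_cvg (mellin_conv alpha F G) x &
      half_hilbert (mellin_conv alpha F G) x = half_hilbert f x * half_hilbert g x].
Proof.
move=> x0; have [cf ef _ _] := hf x0; have [cg eg _ _] := hg x0.
have [mkC wkC] := kC_weighted.
have [cc ec _ _] := half_hilbert_line alpha2_gt0 alpha2_lt1 mkC wkC mellin_convE x0.
split=> //; rewrite ec ef eg.
have [iAB _ _ _] := weighted_density_conv gA gB.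
have := line_power_mul alpha alpha iA iB iAB x0.
rewrite double_alpha => e.
rewrite mulrACA -expr2; congr (_ * _); rewrite [RHS]e; apply: eq_line_power => t.
by rewrite /kC /k mulrA divff ?mul1r//; exact: ccot_line_neq0.
Qed.

Let D := conv Ft Gt.

Let D_weighted := weighted_density_conv gF gG'.

(* Dividing by [sqrt t] moves the line to [Re s = beta], where
   [cot (pi s) = - tan (pi (s - 1/2))]. *)
Let beta := 2 * alpha + 2^-1.
Let beta_gt0 : 0 < beta. Proof. by rewrite addr_gt0 ?invr_gt0. Qed.
Let beta_lt1 : beta < 1. Proof. by rewrite /beta; move: alpha_lt; lra. Qed.

Let psi t : R[i] := f t * g t / (Num.sqrt t)%:C.

Let iD : cintegrable mu setT D.
Proof.
have [_ mD wD _] := D_weighted.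
apply: (@cintegrable_dom _ _ _ mu _ measurableT _ _ mD wD) => t _.
exact: normc_le_wgt.
Qed.

Let fgE x : 0 < x -> f x * g x = K ^+ 2 * line_power (2 * alpha) D x.
Proof.
move=> x0; have [iFG _ _ _] := D_weighted.
rewrite fE// gE// mulrACA -expr2; congr (_ * _).
by rewrite (line_power_mul alpha alpha iF iG iFG x0) double_alpha.
Qed.

Let sqrtE x : 0 < x -> ((Num.sqrt x)%:C : R[i]) = cpow x (2^-1)%:C.
Proof. by move=> x0; rewrite cpow_real// -powR12_sqrt// ltW. Qed.

Let line_power_half c N x : cintegrable mu setT N -> 0 < x ->
  line_power (c + 2^-1) N x = line_power c N x / (Num.sqrt x)%:C.
Proof.
move=> iN x0; rewrite sqrtE// (line_power_shift (c + 2^-1) iN x0) (line_power_shift c iN x0) [RHS]mulrAC; congr (_ * _).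
by rewrite -cpowN -cpowD; congr cpow; rewrite rmorphD opprD.
Qed.

Let psiE x : 0 < x -> psi x = K ^+ 2 * line_power beta D x.
Proof. by move=> x0; rewrite /psi fgE// line_power_half// mulrA. Qed.

(* The reference terms [rho] of the two regularized kernels cancel. *)
Let commutatorE x t : 0 < x -> 0 < t -> commutator_kernel f g x t =
  (Num.sqrt x)%:C * reg psi x t - g x * reg f x t.
Proof.
move=> x0 t0; rewrite /commutator_kernel /reg /psi.
have nz u : 0 < u -> ((Num.sqrt u)%:C : R[i]) != 0.
  by move=> u0; rewrite -normc_eq0 normc_real normr_eq0 gt_eqF// sqrtr_gt0.
move: (nz _ x0) (nz _ t0).
move: ((Num.sqrt x)%:C : R[i]) ((Num.sqrt t)%:C : R[i]) (f t) (g t) (f x) (g x).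
move: ((rho x t)%:C : R[i]) ((t - x)%:C^-1 : R[i]) => r e p q a b c d p0 q0.
by field; rewrite p0 q0.
Qed.

Let iFB := weighted_density_conv gF gB.
Let iAG := weighted_density_conv gA gG'.

(** [ccot_addition] under the convolution integral, at the arguments of t - v and v. Their sum does
    not depend on v, so the last cotangent comes out in front of [D]; the other two each attach to
    one factor. *)
Let conv_identity t : C t * k t = conv Ft B t + conv A Gt t -
  ccot (Pi%:C * (beta +i* t)%C) * D t.
Proof.
have [iAB _ _ _] := weighted_density_conv gA gB.
have [i1 _ _ _] := iFB; have [i2 _ _ _] := iAG; have [i3 _ _ _] := D_weighted.
have j3 := cintegrableZ measurableT (ccot (Pi%:C * (beta +i* t)%C)) (i3 t).
rewrite -(cintegralZr measurableT _ (iAB t)) -(cintegralZ measurableT _ (i3 t)).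
rewrite -(cintegralD measurableT (i1 t) (i2 t)).
rewrite -(cintegralB measurableT (cintegrableD measurableT (i1 t) (i2 t)) j3).
apply: eq_cintegral => v _.
have E : Pi%:C * (beta +i* t)%C = Pi%:C * (alpha +i* (t - v))%C + Pi%:C * (alpha +i* v)%C + (Pi / 2)%:C.
  by rewrite -mulrDr line_add subrK rmorphM -mulrDr; congr (_ * _);
    apply: complex_eqP; rewrite ?ReD ?ImD/= ?addr0.
have E2 : Pi%:C * ((2 * alpha) +i* t)%C = Pi%:C * (alpha +i* (t - v))%C + Pi%:C * (alpha +i* v)%C.
  by rewrite -mulrDr line_add subrK.
rewrite -E2 in E; have := @ccot_addition R (Pi%:C * (alpha +i* (t - v))%C) (Pi%:C * (alpha +i* v)%C).
rewrite -E2 -E => h.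
have {}h := h (csin_line_neq0 _ sin1) (csin_line_neq0 _ sin1) (csin_line_neq0 _ sin2) (ccos_line_neq0 _ cos2).
have -> : A (t - v) * B v * k t = (cotl (t - v) * cotl v * k t) * (Ft (t - v) * Gt v).
  by rewrite /A /B; ring.
rewrite [cotl _ * _ * _]h /A /B /cotl; ring.
Qed.

Let hpsi x (x0 : 0 < x) :=
  let: And4 _ mA wA _ := D_weighted in half_hilbert_line beta_gt0 beta_lt1 mA wA psiE x0.

(** The commutator kernel is a combination of two regularized kernels, with integral pi (sqrt x H_+
    psi - g(x) H_+ f). The right side thus becomes f H_+ g + g H_+ f - sqrt x H_+ psi, and in terms
    of densities this is [conv_identity]. *)
Lemma commutator_identity x : 0 < x ->
  cintegrable mu Rplus (commutator_kernel f g x) /\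
  mellin_conv alpha F G x = half_hilbert g x * f x -
    (Pi^-1)%:C * cintegral mu Rplus (commutator_kernel f g x).
Proof.
move=> x0; have [_ ef irf erf] := hf x0; have [_ eg _ _] := hg x0.
have [_ ep irp erp] := hpsi x0.
have j1 := cintegrableZ measurable_Rplus (Num.sqrt x)%:C irp.
have j2 := cintegrableZ measurable_Rplus (g x) irf.
have E t : Rplus t -> (Num.sqrt x)%:C * reg psi x t - g x * reg f x t = commutator_kernel f g x t.
  by move=> /Rplus_gt0 t0; rewrite commutatorE.
split; first exact: (eq_cintegrable measurable_Rplus E (cintegrableB measurable_Rplus j1 j2)).
rewrite -(@eq_cintegral _ _ _ mu _ _ _ E) (cintegralB measurable_Rplus j1 j2).
rewrite (cintegralZ measurable_Rplus _ irp) (cintegralZ measurable_Rplus _ irf) erf erp.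
have -> : half_hilbert g x * f x - (Pi^-1)%:C * ((Num.sqrt x)%:C * (Pi%:C * half_hilbert psi x) -
    g x * (Pi%:C * half_hilbert f x)) =
    half_hilbert g x * f x + half_hilbert f x * g x - (Num.sqrt x)%:C * half_hilbert psi x.
  rewrite fmorphV/=; move: K_neq0; move: (Pi%:C : R[i]) => p p0.
  move: (half_hilbert f x) (half_hilbert g x) (half_hilbert psi x) => h1 h2 h3.
  move: (f x) (g x) ((Num.sqrt x)%:C : R[i]) => a b c.
  by field.
have [i1 _ _ _] := iFB; have [i2 _ _ _] := iAG.
pose cotb t : R[i] := ccot (Pi%:C * (beta +i* t)%C).
have icD : cintegrable mu setT (fun t => cotb t * D t).
  have s0 := sin_pi_neq0 beta_gt0 beta_lt1.
  have ib := integrable_scale measurableT `|sin (Pi * beta)|^-1 (cintegrable_norm measurableT iD).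
  apply: (@cintegrable_dom _ _ _ mu _ measurableT _ _ _ ib) => [|t _].
    apply: cmeasurableM; last exact: cintegrable_measurable iD.
    by apply: ccontinuous_measurable; exact: ccontinuous_ccot_line.
  by rewrite normc_mulM ler_wpM2r ?normc_ge0 ?normc_ccot_line.
rewrite ef eg ep fE// gE//.
(* Back from the line of real part [beta] to that of real part 2 alpha; the resulting 1 / sqrt x
   cancels the prefactor sqrt x. *)
rewrite -/beta (line_power_half _ icD x0).
have e1 : line_power alpha B x * line_power alpha Ft x = line_power (2 * alpha) (conv Ft B) x.
  rewrite mulrC -double_alpha; exact: (line_power_mul alpha alpha iF iB i1 x0).
have e2 : line_power alpha A x * line_power alpha Gt x = line_power (2 * alpha) (conv A Gt) x.
  rewrite -double_alpha; exact: (line_power_mul alpha alpha iA iG i2 x0).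
have iconv N1 N2 : weighted_density N1 -> weighted_density N2 -> cintegrable mu setT (conv N1 N2).
  move=> /weighted_density_conv h /h[_ mN wN _].
  apply: (@cintegrable_dom _ _ _ mu _ measurableT _ _ mN wN) => t _.
  exact: normc_le_wgt.
have l1 := cintegrable_line_power (2 * alpha) (iconv _ _ gF gB) x0.
have l2 := cintegrable_line_power (2 * alpha) (iconv _ _ gA gG') x0.
have l3 := cintegrable_line_power (2 * alpha) icD x0.
have e3 : line_power (2 * alpha) kC x = line_power (2 * alpha) (conv Ft B) x +
    line_power (2 * alpha) (conv A Gt) x - line_power (2 * alpha) (fun t => cotb t * D t) x.
  rewrite /line_power -(cintegralD measurableT l1 l2).
  rewrite -(cintegralB measurableT (cintegrableD measurableT l1 l2) l3).
  apply: eq_cintegral => t _; rewrite /kC (mulrC (k t)) conv_identity -/(cotb t); ring.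
rewrite (mellin_convE x0) e3 -e1 -e2.
have nz : ((Num.sqrt x)%:C : R[i]) != 0.
  by rewrite -normc_eq0 normc_real normr_eq0 gt_eqF// sqrtr_gt0.
have fld (z a b p q r u : R[i]) : r != 0 ->
    z ^+ 2 * (b * p + a * q - u) = z * b * (z * p) + z * a * (z * q) - r * (z ^+ 2 * (u / r)).
  by move=> r0; field.
exact: fld.
Qed.

End Factorization.

Theorem theorem3 (R : realType) (alpha : R) (f g : R -> R[i])
    (F G : R[i] -> R[i])
    (alpha_gt0 : 0 < alpha) (alpha_lt : alpha < 4^-1)
    (fF : is_mellin alpha f F) (gG : is_mellin alpha g G)
    (sF_L2 : memL2_line alpha (fun s => s * F s))
    (sG_L2 : memL2_line alpha (fun s => s * G s))
    (f_inv : forall x, 0 < x -> f x = mellin_inv alpha F x)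
    (g_inv : forall x, 0 < x -> g x = mellin_inv alpha G x) :
  [/\ forall x, 0 < x -> mellin_conv_cvg alpha F G x,
      (forall s, complex.Re s = 2 * alpha ->
         memL1_line alpha (spectral_kernel F G s)) /\
      memL2_line (2 * alpha) (spectral_conv alpha F G) /\
      is_mellin (2 * alpha) (mellin_conv alpha F G) (spectral_conv alpha F G),
      forall x, 0 < x ->
        [/\ half_hilbert_cvg f x, half_hilbert_cvg g x,
            half_hilbert_cvg (mellin_conv alpha F G) x &
            half_hilbert (mellin_conv alpha F G) x =
              half_hilbert f x * half_hilbert g x] &
      memL1_line alpha (fun s => s * F s) ->
      memL1_line alpha (fun s => s * G s) ->
      forall x, 0 < x ->
        cintegrable (@lebesgue_measure R) Rplus (commutator_kernel f g x) /\
        mellin_conv alpha F G x =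
          half_hilbert g x * f x
          - (pi^-1)%:C *
            cintegral (@lebesgue_measure R) Rplus (commutator_kernel f g x)].
Proof.
split.
- by move=> x x0; apply: (conv_kernel_integrable alpha_gt0 alpha_lt fF gG sF_L2 sG_L2).
- split; first by move=> s; apply: (spectral_kernel_integrable alpha_gt0 alpha_lt fF gG sF_L2 sG_L2).
  have m := mellin_conv_is_mellin alpha_gt0 alpha_lt fF gG sF_L2 sG_L2 f_inv.
  by split => //; have [_ h _] := m.
- move=> x x0.
  exact: (half_hilbert_factorization alpha_gt0 alpha_lt fF gG sF_L2 sG_L2 f_inv g_inv x0).
- move=> _ _ x x0.
  exact: (commutator_identity alpha_gt0 alpha_lt fF gG sF_L2 sG_L2 f_inv g_inv x0).
Qed.
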